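(* Let $n>1$ be odd, and consider $\mathbb{HP}^n=\mathrm{Sp}(n+1)/(\mathrm{Sp}(1)\times\mathrm{Sp}(n))$ with the $\mathrm{Sp}(n+1)$-invariant spin$^{3}$ (i.e. spin$^{\mathbb H}$) structure determined by the homomorphism $\varphi_1:\mathrm{Sp}(1)\times\mathrm{Sp}(n)\to\mathrm{SO}(3)$, $\varphi_1(x,y)=\lambda_3(x)$. Then the space of $\mathrm{Sp}(n+1)$-invariant $n$-twisted spin$^{\mathbb H}$ spinors is spanned over $\mathbb{C}$ by $$\psi=\sum_{j=0}^n(-1)^j\,\omega^j\otimes\bigl(\rho(Y)^{n-j}.\mathbf{1}\bigr),$$ where $\mathbf 1=\hat 1\otimes\cdots\otimes\hat1\in\Sigma_3^{\otimes n}$ ($n$ factors).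
   Context: Notation for matrices: $E^{(N)}_{i,j}$ is the $N\times N$ matrix with $-1$ at $(i,j)$, $+1$ at $(j,i)$ and zeros elsewhere; $F^{(N)}_{i,j}$ ($i\neq j$) has $1$ at $(i,j)$ and $(j,i)$ and zeros elsewhere; $F^{(N)}_{i,i}$ has a single $1$ at $(i,i)$; $B_0(X,Y)=-\mathrm{Re}\,\mathrm{tr}(XY)$; ${\rm i},{\rm j},{\rm k}$ are the quaternion units. Setting: $H=\mathrm{Sp}(1)\times\mathrm{Sp}(n)$ is block-diagonal in $\mathrm{Sp}(n+1)$. $\mathfrak{sp}(1)$ has basis $\xi_1={\rm i}F^{(n+1)}_{1,1}$, $\xi_2=-{\rm k}F^{(n+1)}_{1,1}$, $\xi_3={\rm j}F^{(n+1)}_{1,1}$. The reductive complement $\mathfrak m$ has basis $e_{4p}={\rm j}F^{(n+1)}_{1,p+1}$, $e_{4p+1}={\rm k}F^{(n+1)}_{1,p+1}$, $e_{4p+2}={\rm i}F^{(n+1)}_{1,p+1}$, $e_{4p+3}=E^{(n+1)}_{1,p+1}$ ($p=1,\dots,n$), orthonormal for the invariant metric $g=\tfrac12B_0|_{\mathfrak m\times\mathfrak m}$, oriented by $(e_4,\dots,e_{4n+3})$; $\sigma:H\to\mathrm{SO}(\mathfrak m)\cong\mathrm{SO}(4n)$ is the isotropy representation. Spin$^r$ structures: $\mathrm{Spin}^r(N)=(\mathrm{Spin}(N)\times\mathrm{Spin}(r))/\langle(-1,-1)\rangle$, and $\lambda_r:\mathrm{Spin}(r)\to\mathrm{SO}(r)$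 is the double cover ($\mathrm{Sp}(1)\cong\mathrm{Spin}(3)$). The structure determined by $\varphi_1$ is $\mathrm{Sp}(n+1)\times_{\phi_1}\mathrm{Spin}^3(4n)$, with $\phi_1$ the unique lift of $\sigma\times\varphi_1$ to $\mathrm{Spin}^3(4n)$. Invariant $m$-twisted spin$^3$ spinors ($m$ odd) are the elements of $\Sigma_{4n}\otimes\Sigma_3^{\otimes m}$ fixed by $H$ via $\phi_1$, where $\Sigma_N$ denotes the spin representation. Model of $\Sigma_{4n}$: put $x_{2p}=\frac1{\sqrt2}(e_{4p}-{\rm i}e_{4p+1})$, $y_{2p}=\frac1{\sqrt2}(e_{4p}+{\rm i}e_{4p+1})$, $x_{2p+1}=\frac1{\sqrt2}(e_{4p+2}-{\rm i}e_{4p+3})$, $y_{2p+1}=\frac1{\sqrt2}(e_{4p+2}+{\rm i}e_{4p+3})$ in $\mathfrak m^{\mathbb C}$, where here ${\rm i}$ is the complex unit. Then $\Sigma_{4n}=\Lambda^\bullet\mathrm{span}_{\mathbb C}\{y_2,\dots,y_{2n+1}\}$ with Clifford action $x_q\cdot\eta={\rm i}\sqrt2\,x_q\lrcorner\eta$, $y_q\cdot\eta={\rm i}\sqrt2\,y_q\wedge\eta$ (contraction via the complex bilinear extension of $g$, so $x_q\lrcorner y_{q'}=\delta_{qq'}$; Clifford convention $v\cdot v=-|v|^2$). Put $\omega=\sum_{p=1}^ny_{2p}\wedge y_{2p+1}$, with $\omega^j$ its exterior power. Model of $\Sigma_3=\mathbb C^2$ with basis $\hat1=(1,0)$, $\hat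 y_1=(0,1)$: via $\phi_1$, $\mathfrak{sp}(n)$ acts trivially and $\mathfrak{sp}(1)$ acts by $\rho(\xi_1)=\begin{pmatrix}{\rm i}&0\\0&-{\rm i}\end{pmatrix}$, $\rho(\xi_2)=\begin{pmatrix}0&1\\-1&0\end{pmatrix}$, $\rho(\xi_3)=\begin{pmatrix}0&{\rm i}\\{\rm i}&0\end{pmatrix}$. Put $Y=-\frac12(\xi_2+{\rm i}\xi_3)\in\mathfrak{sp}(1)^{\mathbb C}$, so $\rho(Y)=\begin{pmatrix}0&0\\1&0\end{pmatrix}$ on $\Sigma_3$; $\rho(Y)^{l}.\mathbf 1$ denotes the $l$-fold application of $Y$ in the tensor product (Lie algebra) action on $\Sigma_3^{\otimes n}$. *)

(* Defs.v *)
From HB Require Import structures.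
From mathcomp Require Import all_boot all_order all_algebra.
From mathcomp Require Import reals complex.
From mathcomp Require Import ring.

Set Implicit Arguments.
Unset Strict Implicit.
Unset Printing Implicit Defensive.

Import GRing.Theory Num.Theory.
Local Open Scope ring_scope.
Local Open Scope complex_scope.

Record quat (R : Type) := Quat { q1 : R; qi : R; qj : R; qk : R }.

Definition quat_tuple (R : Type) (x : quat R) := (q1 x, qi x, qj x, qk x).
Definition tuple_quat (R : Type) (t : R * R * R * R) :=
  let: (a, b, c, d) := t in Quat a b c d.
Lemma quat_tupleK (R : Type) : cancel (@quat_tuple R) (@tuple_quat R).
Proof. by case. Qed.

HB.instance Definition _ (R : choiceType) :=
  Choice.copy (quat R) (can_type (@quat_tupleK R)).

Section QuaternionRing.
Variable R : comNzRingType.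
Implicit Types x y z : quat R.

Definition quat_zero : quat R := Quat 0 0 0 0.
Definition quat_opp x : quat R := Quat (- q1 x) (- qi x) (- qj x) (- qk x).
Definition quat_add x y : quat R :=
  Quat (q1 x + q1 y) (qi x + qi y) (qj x + qj y) (qk x + qk y).
Definition quat_one : quat R := Quat 1 0 0 0.
Definition quat_mul x y : quat R :=
  Quat (q1 x * q1 y - qi x * qi y - qj x * qj y - qk x * qk y)
       (q1 x * qi y + qi x * q1 y + qj x * qk y - qk x * qj y)
       (q1 x * qj y - qi x * qk y + qj x * q1 y + qk x * qi y)
       (q1 x * qk y + qi x * qj y - qj x * qi y + qk x * q1 y).

Lemma quat_addA : associative quat_add.
Proof. by move=> [????] [????] [????]; rewrite /quat_add /= !addrA. Qed.
Lemma quat_addC : commutative quat_add.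
Proof. by move=> [????] [????]; congr Quat => /=; rewrite addrC. Qed.
Lemma quat_add0 : left_id quat_zero quat_add.
Proof. by move=> [????]; rewrite /quat_add /= !add0r. Qed.
Lemma quat_addN : left_inverse quat_zero quat_opp quat_add.
Proof. by move=> [????]; rewrite /quat_add /= !addNr. Qed.

HB.instance Definition _ :=
  GRing.isZmodule.Build (quat R) quat_addA quat_addC quat_add0 quat_addN.

Lemma quat_mulA : associative quat_mul.
Proof. by move=> [????] [????] [????]; rewrite /quat_mul /=; congr Quat; ring. Qed.
Lemma quat_mul1l : left_id quat_one quat_mul.
Proof. by move=> [????]; rewrite /quat_mul /=; congr Quat; ring. Qed.
Lemma quat_mul1r : right_id quat_one quat_mul.
Proof. by move=> [????]; rewrite /quat_mul /=; congr Quat; ring. Qed.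
Lemma quat_mulDl : left_distributive quat_mul quat_add.
Proof.
by move=> [????] [????] [????]; rewrite /quat_mul /quat_add /=; congr Quat; ring.
Qed.
Lemma quat_mulDr : right_distributive quat_mul quat_add.
Proof.
by move=> [????] [????] [????]; rewrite /quat_mul /quat_add /=; congr Quat; ring.
Qed.
Lemma quat_one_neq0 : quat_one != 0.
Proof. by apply/eqP => /(congr1 (@q1 R)) /= /eqP; rewrite oner_eq0. Qed.

HB.instance Definition _ :=
  GRing.Zmodule_isNzRing.Build (quat R)
    quat_mulA quat_mul1l quat_mul1r quat_mulDl quat_mulDr quat_one_neq0.

Definition qconj x : quat R := Quat (q1 x) (- qi x) (- qj x) (- qk x).
Definition Qi : quat R := Quat 0 1 0 0.
Definition Qj : quat R := Quat 0 0 1 0.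
Definition Qk : quat R := Quat 0 0 0 1.

End QuaternionRing.

Section SetParity.
Variable N : nat.
Implicit Types A B C : {set 'I_N}.

Definition symdiff A B : {set 'I_N} := [set k | (k \in A) (+) (k \in B)].
Definition inversions A B : nat := \sum_(a in A) \sum_(b in B) (b < a)%N.

Lemma symdiffA : associative symdiff.
Proof. by move=> A B C; apply/setP => k; rewrite !inE addbA. Qed.
Lemma symdiffC : commutative symdiff.
Proof. by move=> A B; apply/setP => k; rewrite !inE addbC. Qed.
Lemma symdiff0 : left_id set0 symdiff.
Proof. by move=> A; apply/setP => k; rewrite !inE. Qed.
Lemma symdiffK A : involutive (symdiff A).
Proof. by move=> B; apply/setP => k; rewrite !inE addbA addbb. Qed.

Lemma odd_sum_in A (f : 'I_N -> nat) :
  odd (\sum_(a in A) f a) = \big[addb/false]_a ((a \in A) && odd (f a)).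
Proof.
rewrite big_mkcond; elim/big_ind2: _ => // [x b y c <- <-|i _]; first exact: oddD.
by case: (i \in A).
Qed.

Lemma odd_sum_symdiff A B (f : 'I_N -> nat) :
  odd (\sum_(a in symdiff A B) f a) =
  odd (\sum_(a in A) f a) (+) odd (\sum_(a in B) f a).
Proof.
by rewrite !odd_sum_in -big_split /=; apply: eq_bigr => a _; rewrite inE andb_addl.
Qed.

Lemma odd_inversions_symdiffl A B C :
  odd (inversions (symdiff A B) C) = odd (inversions A C) (+) odd (inversions B C).
Proof. exact: odd_sum_symdiff. Qed.

Lemma odd_inversions_symdiffr A B C :
  odd (inversions A (symdiff B C)) = odd (inversions A B) (+) odd (inversions A C).
Proof. by rewrite /inversions ![\sum_(a in A) _]exchange_big odd_sum_symdiff. Qed.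

Lemma card_symdiff_cocycle A B C :
  (#|A :&: symdiff B C| + #|B :&: C| = #|A :&: B| + #|symdiff A B :&: C|)%N.
Proof.
rewrite -!sum1_card ![\sum_(_ in _) 1%N]big_mkcond -!big_split /=.
apply: eq_bigr => k _; rewrite !inE.
by case: (k \in A); case: (k \in B); case: (k \in C).
Qed.

End SetParity.

(* The Clifford algebra over K on generators e_k (k < N) with e_k e_k = q and
   e_j e_k = - e_k e_j for j <> k, in its basis of ordered monomials e_A.  For
   q = -1 it is the Clifford algebra with v.v = -|v|^2; for q = 0 it is the
   exterior algebra on the e_k. *)
Definition clifford (K : comNzRingType) (q : K) (N : nat) :=
  {ffun {set 'I_N} -> K}.

HB.instance Definition _ (K : comNzRingType) (q : K) (N : nat) :=
  GRing.Lmodule.copy (clifford q N) {ffun {set 'I_N} -> K^o}.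

Section CliffordRing.
Variables (K : comNzRingType) (q : K) (N : nat).
Implicit Types (A B C : {set 'I_N}) (x y z : clifford q N).

Definition cl_mono A : clifford q N := [ffun B => (B == A)%:R].

(* e_A e_B = cl_coef A B e_(symdiff A B). *)
Definition cl_coef A B : K := (-1) ^+ inversions A B * q ^+ #|A :&: B|.

Definition cl_mul x y : clifford q N :=
  [ffun C => \sum_A x A * y (symdiff A C) * cl_coef A (symdiff A C)].

Lemma cl_coef_cocycle A B C :
  cl_coef A (symdiff B C) * cl_coef B C = cl_coef A B * cl_coef (symdiff A B) C.
Proof.
rewrite /cl_coef !mulrA ![_ * _ * (-1) ^+ _]mulrAC -!mulrA -!exprD !mulrA -!exprD.
rewrite card_symdiff_cocycle; congr (_ * _).
rewrite -[LHS]signr_odd -[RHS]signr_odd !oddD.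
by rewrite odd_inversions_symdiffl odd_inversions_symdiffr addbA.
Qed.

Lemma cl_coef0l A : cl_coef set0 A = 1.
Proof. by rewrite /cl_coef /inversions big_set0 set0I cards0 mulr1. Qed.

Lemma cl_coef0r A : cl_coef A set0 = 1.
Proof.
rewrite /cl_coef /inversions big1 => [|a _]; last by rewrite big_set0.
by rewrite setI0 cards0 mulr1.
Qed.

Lemma cl_mulA : associative cl_mul.
Proof.
move=> x y z; apply/ffunP => C; rewrite !ffunE.
under eq_bigr => A _ do rewrite ffunE mulr_sumr mulr_suml.
under [RHS]eq_bigr => D _ do rewrite ffunE !mulr_suml.
rewrite [RHS]exchange_big /=; apply: eq_bigr => A _.
rewrite [RHS](reindex_inj (can_inj (symdiffK A))) /=; apply: eq_bigr => B _.
rewrite symdiffK -symdiffA.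
set E := symdiff B (symdiff A C).
have -> : symdiff A (symdiff B C) = E by rewrite /E !symdiffA (symdiffC A).
have -> : symdiff A C = symdiff B E by rewrite symdiffK.
transitivity (x A * y B * z E * (cl_coef A (symdiff B E) * cl_coef B E)).
  by ring.
by rewrite cl_coef_cocycle; ring.
Qed.

Lemma cl_mul1l : left_id (cl_mono set0) cl_mul.
Proof.
move=> x; apply/ffunP => C; rewrite ffunE (bigD1 set0) //= big1 => [|A nA].
  by rewrite ffunE eqxx symdiff0 cl_coef0l mul1r mulr1 addr0.
by rewrite ffunE (negPf nA) !mul0r.
Qed.

Lemma cl_mul1r : right_id (cl_mono set0) cl_mul.
Proof.
move=> x; apply/ffunP => C; rewrite ffunE (bigD1 C) //= big1 => [|A nA].
  have -> : symdiff C C = set0 by apply/setP => k; rewrite !inE addbb.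
  by rewrite ffunE eqxx cl_coef0r !mulr1 addr0.
rewrite ffunE (_ : _ == _ = false) ?mulr0 ?mul0r //; apply/negP => /eqP h.
by move/eqP: nA; apply; rewrite -[C](symdiffK A) h symdiffC symdiff0.
Qed.

Lemma cl_mulDl : left_distributive cl_mul +%R.
Proof.
move=> x y z; apply/ffunP => C; rewrite !ffunE -big_split /=.
by apply: eq_bigr => A _; rewrite ffunE !mulrDl.
Qed.

Lemma cl_mulDr : right_distributive cl_mul +%R.
Proof.
move=> x y z; apply/ffunP => C; rewrite !ffunE -big_split /=.
by apply: eq_bigr => A _; rewrite ffunE mulrDr mulrDl.
Qed.

Lemma cl_one_neq0 : cl_mono set0 != 0.
Proof. by apply/eqP => /ffunP/(_ set0)/eqP; rewrite !ffunE eqxx oner_eq0. Qed.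

HB.instance Definition _ :=
  GRing.Zmodule_isNzRing.Build (clifford q N)
    cl_mulA cl_mul1l cl_mul1r cl_mulDl cl_mulDr cl_one_neq0.

Lemma cl_scaleAl a x y : a *: (x * y) = (a *: x) * y.
Proof.
apply/ffunP => C; rewrite !ffunE /GRing.scale /= mulr_sumr.
by apply: eq_bigr => A _; rewrite ffunE !mulrA.
Qed.
Lemma cl_scaleAr a x y : a *: (x * y) = x * (a *: y).
Proof.
apply/ffunP => C; rewrite !ffunE /GRing.scale /= mulr_sumr.
by apply: eq_bigr => A _; rewrite ffunE /GRing.scale /=; ring.
Qed.

HB.instance Definition _ :=
  GRing.Lmodule_isLalgebra.Build K (clifford q N) cl_scaleAl.
HB.instance Definition _ :=
  GRing.Lalgebra_isAlgebra.Build K (clifford q N) cl_scaleAr.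

Definition cl_gen (k : 'I_N) : clifford q N := cl_mono [set k].

Lemma cl_monoM A B : cl_mono A * cl_mono B = cl_coef A B *: cl_mono (symdiff A B).
Proof.
apply/ffunP => C; rewrite ffunE [RHS]ffunE (bigD1 A) //= big1 => [|D nD].
  rewrite !ffunE eqxx mul1r addr0 (can2_eq (symdiffK A) (symdiffK A)).
  rewrite [RHS]mulrC; case: eqP => [->|_]; last by rewrite !mul0r.
  by rewrite symdiffK.
by rewrite ffunE (negPf nD) !mul0r.
Qed.

Lemma cl_gen_sqr k : cl_gen k * cl_gen k = q *: 1.
Proof.
rewrite cl_monoM /cl_coef /inversions !big_set1 ltnn setIid cards1 mul1r.
by congr (_ *: cl_mono _); apply/setP => j; rewrite !inE addbb.
Qed.

Lemma cl_gen_anticomm j k : j != k -> cl_gen j * cl_gen k = - (cl_gen k * cl_gen j).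
Proof.
move=> njk; rewrite !cl_monoM symdiffC -scaleNr /cl_coef /inversions !big_set1.
have dis i l : i != l -> #|[set i] :&: [set l : 'I_N]| = 0%N.
  move=> nil; apply/eqP; rewrite cards_eq0; apply/eqP/setP => m.
  by rewrite !inE; case: eqP => // ->; rewrite (negPf nil).
rewrite !dis //; last by rewrite eq_sym.
rewrite expr0 !mulr1; congr (_ *: _).
case: (ltngtP j k) => [_|_|/val_inj ejk]; rewrite ?opprK //.
by rewrite ejk eqxx in njk.
Qed.

End CliffordRing.

Section Spin.
Variable R : realType.
Local Notation C := R[i].

Definition Cl (N : nat) := clifford (-1 : R) N.

Definition cl_vec N (v : 'rV[R]_N) : Cl N := \sum_k v 0 k *: cl_gen _ k.

Definition in_Spin N (u : Cl N) : Prop :=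
  exists s : seq 'rV[R]_N,
    [/\ ~~ odd (size s), forall v, v \in s -> \sum_k v 0 k ^+ 2 = 1 &
        u = \prod_(v <- s) cl_vec v].

(* The anti-automorphism reversing products of vectors; on Spin(N), where
   v.v = -1 for the unit factors and their number is even, it is the inverse. *)
Definition cl_rev N (u : Cl N) : Cl N := [ffun A : {set 'I_N} => (-1) ^+ 'C(#|A|, 2) * u A].

(* The matrix of v |-> u v u^-1, for u in Spin(N). *)
Definition spin_cover N (u : Cl N) : 'M[R]_N :=
  \matrix_(i, j) (u * cl_gen _ j * cl_rev u) [set i].

(* Spin^r(N) is represented by the pairs in Spin(N) x Spin(r) taken modulo
   multiplication by (-1,-1). *)
Definition in_Spinr N r (z : Cl N * Cl r) : Prop := in_Spin z.1 /\ in_Spin z.2.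
Definition Spinr_eq N r (z z' : Cl N * Cl r) : Prop :=
  z' = z \/ z' = (- z.1, - z.2).
Definition Spinr_mul N r (z z' : Cl N * Cl r) : Cl N * Cl r :=
  (z.1 * z'.1, z.2 * z'.2).

(* The action on V of an element of Cl(N), when e_k acts by c k. *)
Definition cl_act N (V : lmodType C) (c : 'I_N -> V -> V) (u : Cl N) (v : V) : V :=
  \sum_(A : {set 'I_N}) (u A)%:C *: foldr c v (enum A).

Lemma cl_act_mono N (V : lmodType C) (c : 'I_N -> V -> V) A v :
  cl_act c (cl_mono _ A) v = foldr c v (enum A).
Proof.
rewrite /cl_act (bigD1 A) //= big1 => [|B nB]; first by rewrite ffunE eqxx scale1r addr0.
by rewrite ffunE (negPf nB) scale0r.
Qed.

Lemma cl_act_scale N (V : lmodType C) (c : 'I_N -> V -> V) a (u : Cl N) v :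
  cl_act c (a *: u) v = a%:C *: cl_act c u v.
Proof.
rewrite /cl_act scaler_sumr; apply: eq_bigr => A _.
by rewrite ffunE rmorphM scalerA.
Qed.

Lemma cl_act_opp N (V : lmodType C) (c : 'I_N -> V -> V) (u : Cl N) v :
  cl_act c (- u) v = - cl_act c u v.
Proof.
rewrite /cl_act -sumrN; apply: eq_bigr => A _.
by rewrite ffunE rmorphN scaleNr.
Qed.

Definition Sigma3 := 'cV[C]_2.

Definition mx2 (a b c d : C) : 'M[C]_2 :=
  \matrix_(i, j) if i == 0 then (if j == 0 then a else b)
                 else (if j == 0 then c else d).

Lemma sqr_i : 'i * 'i = -1 :> C.
Proof. by apply/eqP; rewrite eq_complex /=; apply/andP; split; apply/eqP; ring. Qed.

Definition rho_xi1 : 'M[C]_2 := mx2 'i 0 0 (- 'i).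
Definition rho_xi2 : 'M[C]_2 := mx2 0 1 (-1) 0.
Definition rho_xi3 : 'M[C]_2 := mx2 0 'i 'i 0.
Definition rho_Y : 'M[C]_2 := (- 2^-1) *: (rho_xi2 + 'i *: rho_xi3).

Definition ord3 (k : nat) : 'I_3 := inord k.
Definition cl3_gen (k : nat) : Cl 3 := cl_gen _ (ord3 k).

(* The identification Sp(1) = Spin(3), extended R-linearly to the quaternions:
   i, j, k correspond to e_1 e_2, e_2 e_0, e_0 e_1. *)
Definition spin_of_quat (x : quat R) : Cl 3 :=
  q1 x *: 1 + qi x *: (cl3_gen 1 * cl3_gen 2)
  + qj x *: (cl3_gen 2 * cl3_gen 0) + qk x *: (cl3_gen 0 * cl3_gen 1).

(* Clifford multiplication on C^2 by e_0, e_1, e_2; the choice is fixed, up to a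
   common sign which does not affect Spin(3), by requiring that the imaginary
   units xi_1 = i, xi_2 = -k, xi_3 = j act by rho_xi1, rho_xi2, rho_xi3 (lemmas
   Sigma3_xi1, Sigma3_xi2, Sigma3_xi3). *)
Definition cliff3 (k : 'I_3) (s : Sigma3) : Sigma3 :=
  nth 0 [:: rho_xi1; rho_xi3; - rho_xi2] k *m s.

Definition Sigma3_act (w : Cl 3) (s : Sigma3) : Sigma3 := cl_act cliff3 w s.

Lemma Sigma3_pair (j k : nat) (s : Sigma3) : (j < k < 3)%N ->
  Sigma3_act (cl3_gen j * cl3_gen k) s = cliff3 (ord3 j) (cliff3 (ord3 k) s).
Proof.
move=> /andP[ltjk ltk]; have ltj := ltn_trans ltjk ltk.
rewrite cl_monoM /cl_coef /inversions !big_set1 !inordK // ltnNge ltnW //= expr0 mul1r.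
have njk : ord3 j != ord3 k by rewrite -val_eqE /= !inordK // ltn_eqF.
have -> : [set ord3 j] :&: [set ord3 k] = set0.
  by apply/setP => i; rewrite !inE; case: eqP => // ->; rewrite (negPf njk).
rewrite cards0 expr0 scale1r /Sigma3_act cl_act_mono.
suff -> : enum (symdiff [set ord3 j] [set ord3 k]) = [:: ord3 j; ord3 k] by [].
apply: (@irr_sorted_eq _ (relpre val ltn)) => //.
- by move=> ? ? ?; apply: ltn_trans.
- by move=> ? /=; rewrite ltnn.
- rewrite -sorted_map; apply: (subseq_sorted ltn_trans (s2 := iota 0 3)).
    by rewrite -val_enum_ord map_subseq // enumT filter_subseq.
  exact: iota_ltn_sorted.
- by rewrite /= !inordK // ltjk.
move=> i; rewrite mem_enum !inE.
by case: (i =P ord3 j) => [->|]; rewrite ?(negPf njk) //.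
Qed.

Lemma mx2M a b c d a' b' c' d' :
  mx2 a b c d *m mx2 a' b' c' d' =
  mx2 (a * a' + b * c') (a * b' + b * d') (c * a' + d * c') (c * b' + d * d').
Proof.
apply/matrixP => i j; rewrite !mxE !big_ord_recl big_ord0 !mxE addr0 /=.
by case: ifP; case: ifP.
Qed.
Lemma mx2N a b c d : - mx2 a b c d = mx2 (- a) (- b) (- c) (- d).
Proof. by apply/matrixP => i j; rewrite !mxE; do 2!case: ifP. Qed.

Lemma mx2D a b c d a' b' c' d' :
  mx2 a b c d + mx2 a' b' c' d' = mx2 (a + a') (b + b') (c + c') (d + d').
Proof. by apply/matrixP => i j; rewrite !mxE; do 2!case: ifP. Qed.
Lemma mx2Z k a b c d : k *: mx2 a b c d = mx2 (k * a) (k * b) (k * c) (k * d).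
Proof. by apply/matrixP => i j; rewrite !mxE; do 2!case: ifP. Qed.

Lemma rho_YE : rho_Y = mx2 0 0 1 0.
Proof.
have h2 : 2^-1 * 2 = 1 :> C by rewrite mulVf // pnatr_eq0.
rewrite /rho_Y mx2Z mx2D mx2Z sqr_i; congr mx2; rewrite ?mulr0 ?addr0 ?subrr ?mulr0 //.
by rewrite -opprD mulrNN -[1 + 1]/2 h2.
Qed.

Lemma Sigma3_xi1 (s : Sigma3) : Sigma3_act (spin_of_quat (@Qi R)) s = rho_xi1 *m s.
Proof.
rewrite /spin_of_quat /= !scale0r scale1r add0r !addr0 Sigma3_pair //.
rewrite /cliff3 !inordK //= mulmxA; congr (_ *m s).
rewrite mx2N mx2M; congr mx2; apply/eqP;
  rewrite eq_complex /=; apply/andP; split; apply/eqP; ring.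
Qed.

Lemma Sigma3_xi2 (s : Sigma3) : Sigma3_act (spin_of_quat (- @Qk R)) s = rho_xi2 *m s.
Proof.
rewrite /spin_of_quat /= !oppr0 !scale0r !add0r /Sigma3_act cl_act_scale.
rewrite -/(Sigma3_act _ _) Sigma3_pair // rmorphN rmorph1 scaleN1r.
rewrite /cliff3 !inordK //= mulmxA -mulNmx; congr (_ *m s).
rewrite mx2M mx2N; congr mx2; apply/eqP;
  rewrite eq_complex /=; apply/andP; split; apply/eqP; ring.
Qed.

Lemma Sigma3_xi3 (s : Sigma3) : Sigma3_act (spin_of_quat (@Qj R)) s = rho_xi3 *m s.
Proof.
rewrite /spin_of_quat /= !scale0r scale1r !add0r !addr0.
rewrite cl_gen_anticomm; last by rewrite -val_eqE /= !inordK.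
rewrite -scaleN1r /Sigma3_act cl_act_scale -/(Sigma3_act _ _) Sigma3_pair //.
rewrite rmorphN rmorph1 scaleN1r /cliff3 !inordK //= mulmxA -mulNmx.
congr (_ *m s); rewrite mx2N mx2M mx2N; congr mx2; apply/eqP;
  rewrite eq_complex /=; apply/andP; split; apply/eqP; ring.
Qed.

Section HPn.
Variable n : nat.

Local Notation mC := 'rV[C]_(4 * n).
Local Notation sqrt2 := ((Num.sqrt (2 : R))%:C : C).

(* Index conventions: e_(4 + k) has index k in 'I_(4 * n), and x_(2 + q), y_(2 + q)
   have index q in 'I_(2 * n).  With them, the two families of formulas for x and
   y (even and odd indices) become a single one: x, y at index q are
   (e_(2q) -/+ i e_(2q+1)) / sqrt 2. *)
Definition x_vec (q : 'I_(2 * n)) : mC :=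
  \row_k (((k == (2 * q)%N :> nat)%:R - 'i * (k == (2 * q).+1%N :> nat)%:R) / sqrt2).
Definition y_vec (q : 'I_(2 * n)) : mC :=
  \row_k (((k == (2 * q)%N :> nat)%:R + 'i * (k == (2 * q).+1%N :> nat)%:R) / sqrt2).

Definition gC (v w : mC) : C := \sum_k v 0 k * w 0 k.

Definition Sigma := clifford (0 : C) (2 * n).

Definition wedge_y (q : 'I_(2 * n)) (eta : Sigma) : Sigma := cl_gen _ q * eta.

(* The antiderivation with y_q' |-> g(x_q, y_q'), i.e. 1 if q' = q, 0 otherwise. *)
Definition contract_x (q : 'I_(2 * n)) (eta : Sigma) : Sigma :=
  [ffun A : {set 'I_(2 * n)} =>
     if q \in A then 0
     else (-1) ^+ #|[set a in A | (a < q)%N]| * eta (q |: A)].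

(* Since g(x_q, y_q') = (q == q') and g(x_q, x_q') = g(y_q, y_q') = 0, we have
   v = \sum_q (g(v, y_q) x_q + g(v, x_q) y_q). *)
Definition cliff (v : mC) (eta : Sigma) : Sigma :=
  \sum_q (gC v (y_vec q) *: (('i * sqrt2) *: contract_x q eta)
          + gC v (x_vec q) *: (('i * sqrt2) *: wedge_y q eta)).

Lemma gC_pair (q q' : 'I_(2 * n)) (a b : C) :
  gC (\row_k (((k == (2 * q)%N :> nat)%:R + a * (k == (2 * q).+1%N :> nat)%:R) / sqrt2))
     (\row_k (((k == (2 * q')%N :> nat)%:R + b * (k == (2 * q').+1%N :> nat)%:R) / sqrt2))
  = (q == q')%:R * ((1 + a * b) / 2).
Proof.
have lt0 : (2 * q < 4 * n)%N.
  by have -> : (4 * n = 2 * (2 * n))%N; [rewrite mulnA|rewrite ltn_mul2l ltn_ord].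
have lt1 : ((2 * q).+1 < 4 * n)%N.
  have -> : (4 * n = 2 * (2 * n))%N by rewrite mulnA.
  by rewrite -[_.+2]/(2 + 2 * q)%N -mulnS leq_mul2l ltn_ord.
have ne01 : Ordinal lt1 != Ordinal lt0 by rewrite -val_eqE /= gtn_eqF.
have s2 : sqrt2 * sqrt2 = 2 :> C.
  by rewrite -rmorphM -expr2 sqr_sqrtr ?ler0n // rmorph_nat.
have ev x y : (2 * x == (2 * y).+1)%N = false.
  by apply/eqP => /(congr1 odd); rewrite /= !mul2n !odd_double.
have ev' x y : ((2 * y).+1 == 2 * x)%N = false by rewrite eq_sym ev.
rewrite /gC (bigD1 (Ordinal lt0)) //= (bigD1 (Ordinal lt1)) //= big1 => [|k].
  rewrite !mxE /= !eqxx !ev !ev' eqSS eqn_mul2l /= val_eqE.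
  by rewrite -s2 invfM; ring.
rewrite -!val_eqE /= => /andP[/negPf h0 /negPf h1].
by rewrite !mxE h0 h1 mulr0 addr0 !mul0r.
Qed.

Lemma x_vecE q : x_vec q =
  \row_k (((k == (2 * q)%N :> nat)%:R + (- 'i) * (k == (2 * q).+1%N :> nat)%:R) / sqrt2).
Proof. by apply/rowP => k; rewrite !mxE mulNr. Qed.

Lemma gC_xx q q' : gC (x_vec q) (x_vec q') = 0.
Proof. by rewrite !x_vecE gC_pair mulrNN sqr_i subrr mul0r mulr0. Qed.
Lemma gC_yy q q' : gC (y_vec q) (y_vec q') = 0.
Proof. by rewrite gC_pair sqr_i subrr mul0r mulr0. Qed.
Lemma gC_xy q q' : gC (x_vec q) (y_vec q') = (q == q')%:R.
Proof. by rewrite x_vecE gC_pair mulNr sqr_i opprK divff ?mulr1 // (pnatr_eq0 C 2). Qed.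
Lemma gC_yx q q' : gC (y_vec q) (x_vec q') = (q == q')%:R.
Proof. by rewrite x_vecE gC_pair mulrN sqr_i opprK divff ?mulr1 // (pnatr_eq0 C 2). Qed.

Lemma cliff_x q eta : cliff (x_vec q) eta = ('i * sqrt2) *: contract_x q eta.
Proof.
rewrite /cliff (bigD1 q) //= big1 => [|q' nq]; rewrite gC_xx gC_xy scale0r addr0.
  by rewrite eqxx scale1r addr0.
by rewrite eq_sym (negPf nq) scale0r.
Qed.

Lemma cliff_y q eta : cliff (y_vec q) eta = ('i * sqrt2) *: wedge_y q eta.
Proof.
rewrite /cliff (bigD1 q) //= big1 => [|q' nq]; rewrite gC_yy gC_yx scale0r add0r.
  by rewrite eqxx scale1r addr0.
by rewrite eq_sym (negPf nq) scale0r.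
Qed.

Definition Sigma_act (u : Cl (4 * n)) (eta : Sigma) : Sigma :=
  cl_act (fun k => cliff (delta_mx 0 k)) u eta.

Lemma lt_even_index (p : 'I_n) : (2 * p < 2 * n)%N.
Proof. by rewrite ltn_mul2l ltn_ord. Qed.
Lemma lt_odd_index (p : 'I_n) : ((2 * p).+1 < 2 * n)%N.
Proof. by rewrite -[_.+2]/(2 + 2 * p)%N -mulnS leq_mul2l ltn_ord. Qed.

Definition omega : Sigma :=
  \sum_(p < n) cl_gen _ (Ordinal (lt_even_index p)) * cl_gen _ (Ordinal (lt_odd_index p)).

(* Sigma_3^(tensor m) in the basis of tensor products of the standard basis
   vectors of C^2, and Sigma_4n (tensor) Sigma_3^(tensor m) in the product basis. *)
Definition Sigma3_pow (m : nat) := {ffun {ffun 'I_m -> 'I_2} -> C}.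
Definition twspinor (m : nat) :=
  {ffun {set 'I_(2 * n)} * {ffun 'I_m -> 'I_2} -> C}.

HB.instance Definition _ m :=
  GRing.Lmodule.copy (twspinor m)
    {ffun {set 'I_(2 * n)} * {ffun 'I_m -> 'I_2} -> C^o}.

Definition tensor3 m (s : 'I_m -> Sigma3) : Sigma3_pow m :=
  [ffun f : {ffun 'I_m -> 'I_2} => \prod_t s t (f t) 0].

Definition otimes m (eta : Sigma) (w : Sigma3_pow m) : twspinor m :=
  [ffun Af : {set 'I_(2 * n)} * {ffun 'I_m -> 'I_2} => eta Af.1 * w Af.2].

Definition twspinor_act m (z : Cl (4 * n) * Cl 3) (v : twspinor m) : twspinor m :=
  [ffun Af : {set 'I_(2 * n)} * {ffun 'I_m -> 'I_2} => \sum_(B : {set 'I_(2 * n)}) \sum_(f : {ffun 'I_m -> 'I_2})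
     Sigma_act z.1 (cl_mono _ B) Af.1
     * (\prod_t Sigma3_act z.2 (delta_mx (f t) 0) (Af.2 t) 0)
     * v (B, f)].

(* For odd m the action descends to Spin^3(4n). *)
Lemma twspinor_act_opp m (z : Cl (4 * n) * Cl 3) (v : twspinor m) :
  odd m -> twspinor_act (- z.1, - z.2) v = twspinor_act z v.
Proof.
case: z => u w oddm.
have eu eta A : Sigma_act (- u) eta A = - Sigma_act u eta A.
  by rewrite /Sigma_act cl_act_opp ffunE.
have ew (f f' : {ffun 'I_m -> 'I_2}) :
    \prod_t Sigma3_act (- w) (delta_mx (f t) 0) (f' t) 0 =
    - \prod_t Sigma3_act w (delta_mx (f t) 0) (f' t) 0.
  transitivity (\prod_t (-1 * Sigma3_act w (delta_mx (f t) 0) (f' t) 0)).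
    by apply: eq_bigr => t _; rewrite /Sigma3_act cl_act_opp mxE mulN1r.
  by rewrite big_split /= prodr_const card_ord -signr_odd oddm expr1 mulN1r.
apply/ffunP => Af; rewrite [LHS]ffunE [RHS]ffunE.
apply: eq_bigr => B _; apply: eq_bigr => f _.
by rewrite eu [X in _ * X * _ = _](ew f Af.2) mulrNN.
Qed.

(* The Lie algebra action on Sigma_3^(tensor m) of an element acting on Sigma_3
   by X: the sum over the m positions of X acting on that factor. *)
Definition lie_act m (X : 'M[C]_2) (w : Sigma3_pow m) : Sigma3_pow m :=
  [ffun f : {ffun 'I_m -> 'I_2} =>
     \sum_t \sum_b X (f t) b * w [ffun t' => if t' == t then b else f t']].

Definition hat1 : Sigma3 := delta_mx 0 0.
Definition bold1 m : Sigma3_pow m := tensor3 (fun _ => hat1).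

Definition qadj N (A : 'M[quat R]_N) : 'M[quat R]_N := (map_mx (@qconj R) A)^T.
Definition in_Sp N (A : 'M[quat R]_N) : Prop := qadj A *m A = 1%:M.

Definition Emx (i j : 'I_n.+1) : 'M[quat R]_n.+1 := delta_mx j i - delta_mx i j.
Definition Fmx (i j : 'I_n.+1) : 'M[quat R]_n.+1 :=
  \matrix_(k, l) (((k == i) && (l == j)) || ((k == j) && (l == i)))%:R.

Definition m_basis (k : 'I_(4 * n)) : 'M[quat R]_n.+1 :=
  let p : 'I_n.+1 := inord (k %/ 4).+1 in
  match (k %% 4)%N with
  | 0 => @Qj R *: Fmx ord0 p
  | 1 => @Qk R *: Fmx ord0 p
  | 2 => @Qi R *: Fmx ord0 p
  | _ => Emx ord0 p
  end.

Definition B0 (X Y : 'M[quat R]_n.+1) : R := - q1 (\tr (X *m Y)).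
Definition g (X Y : 'M[quat R]_n.+1) : R := 2^-1 * B0 X Y.

Definition Hpair : Type := quat R * 'M[quat R]_n.
Definition in_H (h : Hpair) : Prop := qconj h.1 * h.1 = 1 /\ in_Sp h.2.
Definition H_mul (h h' : Hpair) : Hpair := (h.1 * h'.1, h.2 *m h'.2).
Definition H_mx (h : Hpair) : 'M[quat R]_n.+1 := block_mx (h.1%:M : 'M_1) 0 0 h.2.

(* The matrix, in the orthonormal basis m_basis, of X |-> h X h^-1. *)
Definition isotropy (h : Hpair) : 'M[R]_(4 * n) :=
  \matrix_(i, j) g (m_basis i) (H_mx h *m m_basis j *m qadj (H_mx h)).

Definition varphi1 (h : Hpair) : 'M[R]_3 := spin_cover (spin_of_quat h.1).

(* phi represents a group homomorphism Sp(1) x Sp(n) -> Spin^3(4n) lifting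
   isotropy x varphi1 through Spin^3(4n) -> SO(4n) x SO(3). *)
Definition is_lift (phi : Hpair -> Cl (4 * n) * Cl 3) : Prop :=
  [/\ forall h, in_H h -> in_Spinr (phi h),
      forall h h', in_H h -> in_H h' ->
        Spinr_eq (phi (H_mul h h')) (Spinr_mul (phi h) (phi h')),
      forall h, in_H h -> spin_cover (phi h).1 = isotropy h &
      forall h, in_H h -> spin_cover (phi h).2 = varphi1 h].

Definition invariant_spinor m (phi : Hpair -> Cl (4 * n) * Cl 3) (v : twspinor m) : Prop :=
  forall h, in_H h -> twspinor_act (phi h) v = v.

Definition psi : twspinor n :=
  \sum_(j < n.+1)
    (-1) ^+ j *: otimes (omega ^+ j) (iter (n - j) (lie_act rho_Y) (bold1 n)).

End HPn.
End Spin.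

(* Main.v *)
(**
On each quaternionic line of the isotropy module H^n the spinors split as an odd part, on
which Sp(1) acts trivially, and an even part C^2 spanned by 1 and omega_p, on which it acts
as on Sigma_3.  By Schur's lemma this determines the action of the lift of (x, 1) on Sigma_4n
up to a scalar; the lift of (1, B) commutes with these operators because (x, 1) and (1, B)
commute.  Hence psi, which is the symmetrization of the tensor product over p of the invariants
1 (x) y - omega_p (x) 1 of C^2 (x) C^2, spans a line preserved by the whole group.  The
resulting character is trivial because Sp(1) and Sp(n) are generated by commutators: unit
quaternions are commutators, and Sp(n) is generated by quasi-reflections.

Conversely, invariance under diagonal matrices in Sp(n) confines a spinor to the span of the
products of the omega_p, and transpositions make its coefficients symmetric in p.  A torus
element of infinite order in Sp(1) then fixes the weights, and a single further element of
Sp(1) determines all coefficients from one of them.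
*)
Require Import Defs.
From mathcomp Require Import all_boot all_order all_fingroup all_algebra.
From mathcomp Require Import reals complex.
From mathcomp Require Import ring lra zify.

Set Implicit Arguments.
Unset Strict Implicit.
Unset Printing Implicit Defensive.

Import Order.TTheory GRing.Theory Num.Theory.
Local Open Scope ring_scope.
Local Open Scope complex_scope.

(** * Clifford algebras and their actions *)

Section Clifford.
Variables (K : comNzRingType) (q : K) (N : nat).
Implicit Types (A B C : {set 'I_N}) (x y z : clifford q N).
Local Notation gen := (cl_gen q (N := N)).
Local Notation mono := (cl_mono q (N := N)).

(** The lift is known only through the two rotations that it covers, and is multiplicative only up
    to the sign (-1,-1); no formula for it on Sp(n) is at hand. Odd n removes the sign, since
    (-u,-w) and (u,w) act alike, so the lift acts by a genuine representation and a preserved line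
    carries a character. Operators on Sigma_4n are recognised by how they intertwine Clifford
    multiplication, which leaves an unknown scalar each time. The line of psi is preserved by Sp(n)
    for the following reason. An operator commuting with a torus of Sp(1) preserves the degree of
    forms, hence the line of the vacuum 1. For each f, the component of psi at f is, up to a factor,
    a homogeneous part of the image of 1 under one fixed element of Sp(1), so it is scaled by the
    same factor as 1. Invariance of psi must come before uniqueness, because it is what fixes the
    scalars: afterwards Sp(1) acts exactly by [spin_act] and every lift of (1, B) fixes the vacuum,
    which turns the operators found for diagonal and permutation matrices into exact formulas. *)

Lemma cl_expand x : x = \sum_A x A *: mono A.
Proof.
apply/ffunP => B; rewrite sum_ffunE (bigD1 B) //= big1 => [|A nAB].
  by rewrite !ffunE eqxx [_ *: _]mulr1 addr0.
by rewrite !ffunE eq_sym (negPf nAB) [_ *: _]mulr0.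
Qed.

Lemma scaler_cliffordE a x A : (a *: x) A = a * x A.
Proof. by rewrite ffunE. Qed.

Lemma cl_mono1 : mono set0 = 1. Proof. by []. Qed.

Lemma symdiff_disj A B : [disjoint A & B] -> symdiff A B = A :|: B.
Proof.
move=> dAB; apply/setP => k; rewrite !inE.
by case: (boolP (k \in A)) => // kA; rewrite (disjointFr dAB).
Qed.

Lemma cl_gen_mono_min (k : 'I_N) A : (forall a, a \in A -> (k < a)%N) ->
  gen k * mono A = mono (k |: A).
Proof.
move=> ltkA; rewrite cl_monoM.
have dkA : [disjoint [set k] & A].
  by rewrite disjoints1; apply/negP => /ltkA; rewrite ltnn.
rewrite symdiff_disj // /cl_coef (disjoint_setI0 dkA) cards0 mulr1.
rewrite /inversions big_set1 big1 ?scale1r // => a /ltkA ltka.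
by rewrite ltnNge ltnW.
Qed.

Lemma enum_setU1_min (k : 'I_N) A : (forall a, a \in A -> (k < a)%N) ->
  enum (k |: A) = k :: enum A.
Proof.
move=> ltkA.
have enum_sorted (B : {set 'I_N}) : sorted (relpre val ltn) (enum B).
  rewrite -sorted_map; apply: (subseq_sorted ltn_trans (s2 := iota 0 N)).
    by rewrite -val_enum_ord map_subseq // enumT filter_subseq.
  exact: iota_ltn_sorted.
apply: (@irr_sorted_eq _ (relpre val ltn)) => //.
- by move=> ? ? ?; apply: ltn_trans.
- by move=> ? /=; rewrite ltnn.
- rewrite /= path_sortedE; last by move=> ? ? ?; apply: ltn_trans.
  by rewrite enum_sorted andbT; apply/allP => a; rewrite mem_enum => /ltkA.
by move=> a; rewrite mem_enum !inE mem_enum.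
Qed.

(** [cl_act] lets the generators of a monomial act in increasing order, the least one outermost, so
    monomials are built by adjoining a new least index. *)
Lemma setU1_min_ind (P : {set 'I_N} -> Prop) : P set0 ->
  (forall (k : 'I_N) A, (forall a, a \in A -> (k < a)%N) -> P A -> P (k |: A)) ->
  forall A, P A.
Proof.
move=> P0 PS A; have [m] := ubnP #|A|; elim: m A => // m IH A leAm.
have [->//|[k0 k0A]] := set_0Vmem A.
case: (arg_minnP (fun k : 'I_N => val k) k0A) => k; rewrite -/(k \in A) => kA mink.
rewrite -(setD1K kA); apply: PS => [a|].
  by rewrite !inE => /andP[nak /mink]; rewrite leq_eqVlt eq_sym val_eqE (negPf nak).
by apply: IH; move: leAm; rewrite (cardsD1 k A) kA.
Qed.

End Clifford.

(** * Modules over the Clifford algebra *)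

Section CliffordAction.
Variables (R : realType) (N : nat) (V : lmodType R[i]) (c : 'I_N -> V -> V).
Local Notation gen := (cl_gen (-1 : R) (N := N)).
Local Notation mono := (cl_mono (-1 : R) (N := N)).
Hypothesis c_linear : forall k, linear (c k).
Hypothesis c_sqr : forall k v, c k (c k v) = - v.
Hypothesis c_anticomm : forall j k v, j != k -> c j (c k v) = - c k (c j v).

Let cD k : {morph c k : v w / v + w}.
Proof. by move=> v w; have := c_linear k 1 v w; rewrite !scale1r. Qed.
Let c0 k : c k 0 = 0.
Proof. by apply: (addrI (c k 0)); rewrite -cD !addr0. Qed.
Let cZ k a v : c k (a *: v) = a *: c k v.
Proof. by have := c_linear k a v 0; rewrite !addr0 c0 addr0. Qed.
Let c_sum k I (r : seq I) P (F : I -> V) :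
  c k (\sum_(i <- r | P i) F i) = \sum_(i <- r | P i) c k (F i).
Proof. exact: (big_morph (c k) (cD k) (c0 k)). Qed.

Lemma cl_actD u w v : cl_act c (u + w) v = cl_act c u v + cl_act c w v.
Proof.
rewrite /cl_act -big_split; apply: eq_bigr => A _ /=.
by rewrite ffunE rmorphD scalerDl.
Qed.

Lemma cl_act0 v : cl_act c 0 v = 0.
Proof. by rewrite /cl_act big1 // => A _; rewrite ffunE rmorph0 scale0r. Qed.

Lemma cl_act_sum I (r : seq I) P (F : I -> Cl R N) v :
  cl_act c (\sum_(i <- r | P i) F i) v = \sum_(i <- r | P i) cl_act c (F i) v.
Proof.
by apply: (big_morph (fun u => cl_act c u v)); [move=> u w; apply: cl_actD|apply: cl_act0].
Qed.

Lemma cl_act_linear u : linear (cl_act c u).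
Proof.
move=> a v w; rewrite /cl_act scaler_sumr -big_split; apply: eq_bigr => A _ /=.
rewrite scalerA [a * _]mulrC -scalerA -scalerDr; congr (_ *: _).
by elim: (enum A) => //= k s ->; rewrite cD cZ.
Qed.

Lemma cl_act1 v : cl_act c 1 v = v.
Proof. by rewrite -cl_mono1 cl_act_mono enum_set0. Qed.

Lemma cl_act_gen k v : cl_act c (gen k) v = c k v.
Proof. by rewrite cl_act_mono enum_set1. Qed.

Let act_min (k : 'I_N) (A : {set 'I_N}) v : (forall a, a \in A -> (k < a)%N) ->
  cl_act c (mono (k |: A)) v = c k (cl_act c (mono A) v).
Proof. by move=> ltkA; rewrite !cl_act_mono enum_setU1_min. Qed.

Let act_gen_mono k A v : cl_act c (gen k * mono A) v = c k (cl_act c (mono A) v).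
Proof.
elim/setU1_min_ind: A k => [|a A ltaA IH] k.
  by rewrite cl_mono1 mulr1 cl_act1 cl_act_gen.
rewrite act_min // -cl_gen_mono_min // mulrA.
case: (ltngtP k a) => [ltka|ltak|/val_inj <-{ltaA}].
- have ltkaA b : b \in a |: A -> (k < b)%N.
    by rewrite !inE => /orP[/eqP-> //|/ltaA/(ltn_trans ltka)].
  by rewrite -mulrA (cl_gen_mono_min _ ltaA) cl_gen_mono_min // !act_min.
(* The generator [k] is moved past [a]. Then [gen k * mono A] is a multiple of a single monomial
   whose indices all exceed [a], so [a] can be split off as the outermost factor. *)
- have nka : k != a by rewrite -val_eqE gtn_eqF.
  rewrite cl_gen_anticomm // mulNr cl_act_opp -mulrA [gen k * mono A]cl_monoM -scalerAr.
  rewrite cl_act_scale cl_gen_mono_min ?act_min; first last.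
  + by move=> b; rewrite !inE; case: eqP => [->//|_]; rewrite addFb => /ltaA.
  + by move=> b; rewrite !inE; case: eqP => [->//|_]; rewrite addFb => /ltaA.
  by rewrite -cZ -cl_act_scale -cl_monoM IH (c_anticomm _ nka).
- by rewrite cl_gen_sqr -scalerAl mul1r cl_act_scale rmorphN rmorph1 scaleN1r c_sqr.
Qed.

Let act_gen k w v : cl_act c (gen k * w) v = c k (cl_act c w v).
Proof.
rewrite [w]cl_expand mulr_sumr !cl_act_sum c_sum; apply: eq_bigr => A _.
by rewrite -scalerAr !cl_act_scale act_gen_mono cZ.
Qed.

(** [cl_act] is defined on the monomial basis, so multiplicativity rests on the Clifford relations
    assumed for [c]; induction on the left monomial reduces it to multiplication by one
    generator. *)
Lemma cl_actM u w v : cl_act c (u * w) v = cl_act c u (cl_act c w v).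
Proof.
rewrite [u]cl_expand mulr_suml !cl_act_sum; apply: eq_bigr => A _.
rewrite -scalerAl !cl_act_scale; congr (_ *: _).
elim/setU1_min_ind: A => [|a A ltaA IH]; first by rewrite cl_mono1 mul1r cl_act1.
by rewrite act_min // -cl_gen_mono_min // -mulrA act_gen IH.
Qed.

End CliffordAction.

(** * Reversal and conjugation of vectors *)

Section Reversal.
Variables (R : realType) (N : nat).
Implicit Types (A B C : {set 'I_N}) (u w : Cl R N).
Local Notation gen := (cl_gen (-1 : R) (N := N)).

(** Each pair in A x B is counted once, by trichotomy. Modulo 2 this compares the signs of e_A e_B
    and e_B e_A, which is what makes [cl_rev] an anti-automorphism. *)
Lemma inversions_sym A B :
  (inversions A B + inversions B A + #|A :&: B| = #|A| * #|B|)%N.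
Proof.
rewrite /inversions [X in (_ + X + _)%N]exchange_big -big_split /=.
have -> : #|A :&: B| = (\sum_(a in A) \sum_(b in B) (a == b))%N.
  rewrite -sum1_card big_mkcond [RHS]big_mkcond; apply: eq_bigr => a _; rewrite inE.
  case: (a \in A) => //=; case: ifP => aB.
    rewrite (bigD1 a) //= eqxx big1 // => b /andP[_ nba].
    by rewrite eq_sym (negPf nba).
  by rewrite big1 // => b bB; case: eqP => // eab; rewrite eab bB in aB.
rewrite -big_split -sum_nat_const; apply: eq_bigr => a _ /=.
rewrite -!big_split -sum1_card; apply: eq_bigr => b _ /=.
by rewrite -val_eqE /=; case: ltngtP.
Qed.

Lemma odd_bin2D a b : odd 'C(a + b, 2) = odd 'C(a, 2) (+) odd 'C(b, 2) (+) (odd a && odd b).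
Proof.
have -> : ('C(a + b, 2) = 'C(a, 2) + 'C(b, 2) + a * b)%N.
  elim: a => [|a IH]; first by rewrite !add0n mul0n addn0.
  rewrite addSn !binS !bin1 IH mulSn; lia.
by rewrite !oddD oddM.
Qed.

Lemma card_symdiff A B : (#|symdiff A B| + #|A :&: B| + #|A :&: B| = #|A| + #|B|)%N.
Proof.
rewrite -!sum1_card ![(\sum_(_ in _) 1)%N]big_mkcond -!big_split /=.
by apply: eq_bigr => k _; rewrite !inE; case: (k \in A); case: (k \in B).
Qed.

Lemma odd_bin2_symdiff A B :
  odd 'C(#|symdiff A B|, 2) =
  odd 'C(#|A|, 2) (+) odd 'C(#|B|, 2) (+) (odd #|A| && odd #|B|) (+) odd #|A :&: B|.
Proof.
rewrite -odd_bin2D -card_symdiff !odd_bin2D oddD.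
by case: (odd #|symdiff A B|); case: (odd #|A :&: B|); case: (odd 'C(_, 2)); case: (odd 'C(_, 2)).
Qed.

Lemma cl_revM u w : cl_rev (u * w) = cl_rev w * cl_rev u.
Proof.
apply/ffunP => C; rewrite !ffunE mulr_sumr (reindex_inj (can_inj (symdiffK C))) /=.
apply: eq_bigr => A _; rewrite !ffunE.
have -> : symdiff (symdiff C A) C = A by rewrite (symdiffC _ C) symdiffK.
rewrite (symdiffC A C); set B := symdiff C A.
have -> : C = symdiff B A by rewrite /B symdiffC [symdiff C A]symdiffC symdiffK.
rewrite /cl_coef [A :&: B]setIC.
transitivity (u B * w A * (-1) ^+ #|B :&: A| *
    ((-1) ^+ 'C(#|symdiff B A|, 2) * (-1) ^+ inversions B A)); first by ring.
transitivity (u B * w A * (-1) ^+ #|B :&: A| *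
    ((-1) ^+ 'C(#|A|, 2) * (-1) ^+ 'C(#|B|, 2) * (-1) ^+ inversions A B)); last by ring.
congr (_ * _); rewrite -!exprD -[LHS]signr_odd -[RHS]signr_odd; congr (_ ^+ nat_of_bool _).
have /(congr1 odd) := inversions_sym B A; rewrite !oddD oddM odd_bin2_symdiff.
by do 7!case: (odd _).
Qed.

Lemma cl_revD u w : cl_rev (u + w) = cl_rev u + cl_rev w.
Proof. by apply/ffunP => A; rewrite !ffunE mulrDr. Qed.

Lemma cl_revZ a u : cl_rev (a *: u) = a *: cl_rev u.
Proof. by apply/ffunP => A; rewrite !ffunE [_ *: _ in LHS]/GRing.scale /= mulrCA. Qed.

Lemma cl_rev0 : cl_rev 0 = 0 :> Cl R N.
Proof. by apply/ffunP => A; rewrite !ffunE mulr0. Qed.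

Lemma cl_rev_gen k : cl_rev (gen k) = gen k.
Proof.
apply/ffunP => A; rewrite !ffunE; case: eqP => [->|_]; last by rewrite mulr0.
by rewrite cards1 mul1r.
Qed.

Lemma cl_rev1 : cl_rev 1 = 1 :> Cl R N.
Proof.
apply/ffunP => A; rewrite !ffunE; case: eqP => [->|_]; last by rewrite mulr0.
by rewrite cards0 mul1r.
Qed.

Lemma cl_rev_vec (v : 'rV[R]_N) : cl_rev (cl_vec v) = cl_vec v.
Proof.
rewrite /cl_vec (big_morph (@cl_rev R N) cl_revD cl_rev0).
by apply: eq_bigr => k _; rewrite cl_revZ cl_rev_gen.
Qed.

Lemma cl_rev_prod (s : seq 'rV[R]_N) :
  cl_rev (\prod_(v <- s) cl_vec v) = \prod_(v <- rev s) cl_vec v.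
Proof.
elim: s => [|v s IH]; first by rewrite !big_nil cl_rev1.
by rewrite big_cons cl_revM IH cl_rev_vec rev_cons -cats1 big_cat big_seq1.
Qed.

Lemma cl_vec_anticomm (v w : 'rV[R]_N) :
  cl_vec v * cl_vec w + cl_vec w * cl_vec v = (- 2 * \sum_k v 0 k * w 0 k) *: 1.
Proof.
rewrite /cl_vec !mulr_suml; under eq_bigr => j _ do rewrite mulr_sumr.
under [X in _ + X = _]eq_bigr => j _ do rewrite mulr_sumr.
rewrite [X in _ + X]exchange_big -big_split mulr_sumr scaler_suml; apply: eq_bigr => j _ /=.
rewrite -big_split (bigD1 j) //= big1 => [|k nkj].
  rewrite addr0 -!scalerAl -!scalerAr !scalerA cl_gen_sqr !scalerA -scalerDl.
  by congr (_ *: _); ring.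
rewrite -!scalerAl -!scalerAr !scalerA (cl_gen_anticomm _ nkj) scalerN.
by rewrite [v 0 j * _]mulrC subrr.
Qed.

Lemma cl_vec_sqr (v : 'rV[R]_N) : \sum_k v 0 k ^+ 2 = 1 -> cl_vec v * cl_vec v = - 1.
Proof.
move=> v1; have := cl_vec_anticomm v v.
under eq_bigr => k _ do rewrite -expr2.
rewrite v1 mulr1 -mulr2n -scaler_nat => /(congr1 (fun x => 2^-1 *: x)).
by rewrite !scalerA mulrN mulVf ?pnatr_eq0 // scale1r scaleN1r.
Qed.

Lemma cl_vecD (v w : 'rV[R]_N) : cl_vec (v + w) = cl_vec v + cl_vec w.
Proof. by rewrite /cl_vec -big_split; apply: eq_bigr => k _; rewrite mxE scalerDl. Qed.

Lemma cl_vecZ a (v : 'rV[R]_N) : cl_vec (a *: v) = a *: cl_vec v.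
Proof. by rewrite /cl_vec scaler_sumr; apply: eq_bigr => k _; rewrite mxE scalerA. Qed.

Lemma cl_vec_delta k : cl_vec (delta_mx 0 k : 'rV[R]_N) = gen k.
Proof.
rewrite /cl_vec (bigD1 k) //= big1 => [|j njk].
  by rewrite mxE !eqxx scale1r addr0.
by rewrite mxE (negPf njk) andbF scale0r.
Qed.

Lemma cl_vec_coef (v : 'rV[R]_N) k : cl_vec v [set k] = v 0 k.
Proof.
rewrite /cl_vec sum_ffunE (bigD1 k) //= big1 => [|j njk].
  by rewrite !ffunE eqxx [_ *: _]mulr1 addr0.
rewrite !ffunE (_ : _ == _ = false) ?[_ *: _]mulr0 //.
by apply: contraNF njk => /eqP/set1_inj->.
Qed.

(** The witness is w - 2 <v, w> v, the reflection of w in the hyperplane orthogonal to v. *)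
Lemma cl_vec_reflect (v w : 'rV[R]_N) : \sum_k v 0 k ^+ 2 = 1 ->
  exists w' : 'rV[R]_N, cl_vec v * cl_vec w * cl_vec v = cl_vec w'.
Proof.
move=> v1; set a := - 2 * \sum_k v 0 k * w 0 k; exists (a *: v + w).
have wv : cl_vec w * cl_vec v = a *: 1 - cl_vec v * cl_vec w.
  by rewrite -(cl_vec_anticomm v w) addrAC subrr add0r.
rewrite -mulrA wv mulrBr mulrA cl_vec_sqr // -scalerAr mulr1 mulN1r opprK.
by rewrite cl_vecD cl_vecZ.
Qed.

Lemma cl_prod_conj (s : seq 'rV[R]_N) (w : 'rV[R]_N) :
  (forall v, v \in s -> \sum_k v 0 k ^+ 2 = 1) ->
  exists w' : 'rV[R]_N,
    (\prod_(v <- s) cl_vec v) * cl_vec w * (\prod_(v <- rev s) cl_vec v) = cl_vec w'.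
Proof.
elim: s => [|v s IH] s1; first by exists w; rewrite !big_nil mul1r mulr1.
have [|w1 Ew1] := IH; first by move=> x xs; rewrite s1 // inE xs orbT.
have [|w2 Ew2] := @cl_vec_reflect v w1; first by rewrite s1 // mem_head.
exists w2; rewrite big_cons rev_cons -cats1 big_cat big_seq1 -Ew2 -Ew1 /=.
by rewrite !mulrA.
Qed.

Lemma cl_prod_rev (s : seq 'rV[R]_N) :
  (forall v, v \in s -> \sum_k v 0 k ^+ 2 = 1) ->
  (\prod_(v <- rev s) cl_vec v) * (\prod_(v <- s) cl_vec v) = (-1) ^+ size s.
Proof.
elim: s => [|v s IH] s1; first by rewrite !big_nil mul1r.
rewrite big_cons rev_cons -cats1 big_cat big_seq1 /= mulrA -[_ * _ * cl_vec v]mulrA.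
rewrite cl_vec_sqr ?s1 ?mem_head // mulrN1 mulNr IH ?exprS ?mulN1r //.
by move=> x xs; rewrite s1 // inE xs orbT.
Qed.

(** What the Schur arguments use of an element of Spin(N). Unlike [in_Spin], it can be checked for
    [spin_of_quat x] without factoring that element into unit vectors. *)
Definition lifts_rotation u :=
  [/\ cl_rev u * u = 1, u * cl_rev u = 1 &
      forall k, exists v : 'rV[R]_N, u * gen k * cl_rev u = cl_vec v].

Lemma in_Spin_lifts u : in_Spin u -> lifts_rotation u.
Proof.
case=> s [even_s s1 ->]; rewrite /lifts_rotation cl_rev_prod.
have s1' v : v \in rev s -> \sum_k v 0 k ^+ 2 = 1 by rewrite mem_rev => /s1.
have := cl_prod_rev s1'; rewrite revK size_rev cl_prod_rev // -signr_odd (negPf even_s).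
by split=> // k; rewrite -cl_vec_delta; apply: cl_prod_conj.
Qed.

Lemma lifts_rotation_intertwine u k : lifts_rotation u ->
  u * gen k = (\sum_i spin_cover u i k *: gen i) * u.
Proof.
case=> uu _ /(_ k)[v Ev]; have -> : \sum_i spin_cover u i k *: gen i = cl_vec v.
  by rewrite /cl_vec; apply: eq_bigr => i _; rewrite mxE Ev cl_vec_coef.
by rewrite -Ev -!mulrA uu mulr1.
Qed.

Lemma lifts_rotation_intertwine_rev u k : lifts_rotation u ->
  gen k * cl_rev u = cl_rev u * (\sum_i spin_cover u i k *: gen i).
Proof.
move=> lu; have [uu1 uu2 _] := lu; rewrite -[LHS]mul1r -uu1 -mulrA [u * _]mulrA.
by rewrite (lifts_rotation_intertwine k lu) -!mulrA uu2 mulr1.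
Qed.

End Reversal.

(** * Even and odd elements; unit quaternions in Spin(3) *)

Section Parity.
Variables (R : realType) (N : nat).
Implicit Types (A B C : {set 'I_N}) (u w : Cl R N).

Definition cl_parity (b : bool) u := forall A, u A != 0 -> odd #|A| = b.

Lemma cl_parityM b c u w : cl_parity b u -> cl_parity c w -> cl_parity (b (+) c) (u * w).
Proof.
move=> pu pw C; rewrite ffunE => nz.
have [A] : exists A, u A * w (symdiff A C) != 0.
  apply/existsP; apply: contraNT nz; rewrite negb_exists => /forallP z.
  by rewrite big1 // => A _; have := z A; rewrite negbK => /eqP->; rewrite mul0r.
rewrite mulf_eq0 negb_or => /andP[/pu <- /pw <-].
rewrite -{1}[C](symdiffK A); have /(congr1 odd) := card_symdiff A (symdiff A C).
by rewrite !oddD -addbA addbb addbF.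
Qed.

Lemma cl_parityD b u w : cl_parity b u -> cl_parity b w -> cl_parity b (u + w).
Proof.
move=> pu pw A; rewrite ffunE; have [->|/pu //] := eqVneq (u A) 0.
by rewrite add0r => /pw.
Qed.

Lemma cl_parityZ b a u : cl_parity b u -> cl_parity b (a *: u).
Proof. by move=> pu A; rewrite scaler_cliffordE mulf_eq0 negb_or => /andP[_ /pu]. Qed.

Lemma cl_parity_mono A : cl_parity (odd #|A|) (cl_mono _ A : Cl R N).
Proof. by move=> B; rewrite ffunE; have [->//|_] := eqVneq B A; rewrite eqxx. Qed.

Lemma cl_parity_gen k : cl_parity true (cl_gen _ k : Cl R N).
Proof. by have := @cl_parity_mono [set k]; rewrite cards1. Qed.

Lemma cl_parity1 : cl_parity false (1 : Cl R N).
Proof. by have := @cl_parity_mono set0; rewrite cards0. Qed.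

Lemma cl_parity_rev b u : cl_parity b u -> cl_parity b (cl_rev u).
Proof. by move=> pu A; rewrite ffunE mulf_eq0 negb_or => /andP[_ /pu]. Qed.

End Parity.

Section SpinOfQuat.
Variable R : realType.
Implicit Types x y : quat R.

(* In Cl(3), reversal is -1 on degree 3, so odd reversal-invariant elements are vectors. *)
Lemma cl3_odd_rev (y : Cl R 3) : cl_parity true y -> cl_rev y = y ->
  exists v : 'rV[R]_3, y = cl_vec v.
Proof.
move=> py ry; exists (\row_k y [set k]).
apply/ffunP => A; rewrite sum_ffunE.
have [oA|eA] := boolP (odd #|A|); last first.
  have -> : y A = 0 by apply/eqP; apply: contraNT eA => /py.
  rewrite big1 // => k _; rewrite !ffunE; case: eqP => [E|_]; last by rewrite [_ *: _]mulr0.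
  by rewrite E cards1 in eA.
have leA : (#|A| <= 3)%N by have := max_card (mem A); rewrite card_ord.
have [A1|A3] : #|A| = 1%N \/ #|A| = 3%N by move: #|A| oA leA => [|[|[|[|m]]]] //; auto.
  have /eqP/cards1P[k ->] := A1.
  rewrite (bigD1 k) //= big1 => [|j njk].
    by rewrite mxE !ffunE eqxx [_ *: _]mulr1 addr0.
  rewrite !ffunE (_ : _ == _ = false) ?[_ *: _]mulr0 //.
  by apply: contraNF njk => /eqP/set1_inj->.
have -> : y A = 0.
  have /ffunP/(_ A) := ry; rewrite ffunE A3 -signr_odd mulN1r => /eqP.
  by rewrite eq_sym -addr_eq0 -mulr2n -mulr_natl mulf_eq0 pnatr_eq0 => /eqP.
rewrite big1 // => k _; rewrite !ffunE; case: eqP => [E|_]; last by rewrite [_ *: _]mulr0.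
by rewrite E cards1 in A3.
Qed.

Lemma quat_units_norm (a b c d : R) (I J K : Cl R 3) :
  I * I = -1 -> J * J = -1 -> K * K = -1 ->
  I * J = - (J * I) -> J * K = - (K * J) -> I * K = - (K * I) ->
  (a *: 1 - (b *: I + c *: J + d *: K)) * (a *: 1 + (b *: I + c *: J + d *: K)) =
  (a ^+ 2 + b ^+ 2 + c ^+ 2 + d ^+ 2) *: 1.
Proof.
move=> II JJ KK IJ JK IK.
set z := b *: I + c *: J + d *: K.
have zz : z * z = (- (b ^+ 2 + c ^+ 2 + d ^+ 2)) *: 1.
  rewrite /z !mulrDl !mulrDr -!scalerAl -!scalerAr !scalerA II JJ KK IJ IK JK !scalerN.
  rewrite [c * b]mulrC [d * b]mulrC [d * c]mulrC !opprD !scalerDl !scaleNr !expr2.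
  move: (_ *: (J * I)) (_ *: (K * I)) (_ *: (K * J)) (_%:A) (_%:A) (_%:A) => x1 x2 x3 x4 x5 x6.
  by apply/ffunP => A; rewrite !ffunE; ring.
rewrite mulrDr !mulrBl -!scalerAl -!scalerAr mul1r mulr1 zz scalerA scaleNr -expr2.
rewrite mul1r subrKA opprK -scalerDl.
by congr (_ *: _); ring.
Qed.

Definition quat_unit x := q1 x ^+ 2 + qi x ^+ 2 + qj x ^+ 2 + qk x ^+ 2 = 1.

Local Notation g3 := (cl_gen (-1 : R) (N := 3)).

Lemma cl_biv_sqr N (j k : 'I_N) : j != k ->
  (cl_gen (-1 : R) j * cl_gen _ k) * (cl_gen _ j * cl_gen _ k) = -1.
Proof.
move=> njk; rewrite {1}(cl_gen_anticomm _ njk) mulNr -mulrA [cl_gen _ j * (_ * _)]mulrA cl_gen_sqr.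
by rewrite -scalerAl mul1r -scalerAr cl_gen_sqr scalerA mulN1r opprK scale1r.
Qed.

Lemma cl_biv_anticomm N (i j k : 'I_N) : i != j -> j != k -> k != i ->
  (cl_gen (-1 : R) i * cl_gen _ j) * (cl_gen _ j * cl_gen _ k) =
  - ((cl_gen _ j * cl_gen _ k) * (cl_gen _ i * cl_gen _ j)).
Proof.
move=> nij njk nki; rewrite -mulrA [cl_gen _ j * (_ * _)]mulrA cl_gen_sqr.
rewrite (cl_gen_anticomm _ njk) (cl_gen_anticomm _ nij) mulrNN -mulrA [cl_gen _ j * (_ * _)]mulrA.
rewrite cl_gen_sqr -!scalerAl mul1r -!scalerAr.
by rewrite mul1r (cl_gen_anticomm _ nki) scalerN opprK.
Qed.

Lemma ord3_neq (j k : nat) : (j < 3)%N -> (k < 3)%N -> j != k -> ord3 j != ord3 k.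
Proof. by move=> lj lk njk; rewrite -val_eqE /= !inordK. Qed.

Lemma spin_of_quatE x : spin_of_quat x =
  q1 x *: 1 + (qi x *: (cl3_gen R 1 * cl3_gen R 2) + qj x *: (cl3_gen R 2 * cl3_gen R 0)
  + qk x *: (cl3_gen R 0 * cl3_gen R 1)).
Proof. by rewrite /spin_of_quat !addrA. Qed.

Lemma cl_rev_spin_of_quat x : cl_rev (spin_of_quat x) =
  q1 x *: 1 - (qi x *: (cl3_gen R 1 * cl3_gen R 2) + qj x *: (cl3_gen R 2 * cl3_gen R 0)
  + qk x *: (cl3_gen R 0 * cl3_gen R 1)).
Proof.
rewrite spin_of_quatE !cl_revD !cl_revZ cl_rev1 !cl_revM !cl_rev_gen.
rewrite [cl3_gen R 1 * cl3_gen R 2]cl_gen_anticomm ?ord3_neq //.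
rewrite [cl3_gen R 2 * cl3_gen R 0]cl_gen_anticomm ?ord3_neq //.
rewrite [cl3_gen R 0 * cl3_gen R 1]cl_gen_anticomm ?ord3_neq //.
by rewrite !scalerN -!opprD opprK.
Qed.

(** Reversal is quaternion conjugation, which gives the inverse. A conjugated generator is odd and
    invariant under reversal, hence a vector in Cl(3). *)
Lemma spin_of_quat_lifts x : quat_unit x -> lifts_rotation (spin_of_quat x).
Proof.
move=> x1.
have pw : cl_parity false (spin_of_quat x).
  have p2 j k : cl_parity false (cl3_gen R j * cl3_gen R k).
    exact: (cl_parityM (@cl_parity_gen R 3 _) (@cl_parity_gen R 3 _)).
  by rewrite spin_of_quatE; do ![apply: cl_parityD|apply: cl_parityZ] => //; apply: cl_parity1.
have [E1 E2] : cl_rev (spin_of_quat x) * spin_of_quat x = 1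
    /\ spin_of_quat x * cl_rev (spin_of_quat x) = 1.
  rewrite cl_rev_spin_of_quat spin_of_quatE.
  set I := cl3_gen R 1 * _; set J := cl3_gen R 2 * _; set K := cl3_gen R 0 * cl3_gen R 1.
  have II : I * I = -1 by rewrite /I /J /K; apply: cl_biv_sqr; rewrite ord3_neq.
  have JJ : J * J = -1 by rewrite /I /J /K; apply: cl_biv_sqr; rewrite ord3_neq.
  have KK : K * K = -1 by rewrite /I /J /K; apply: cl_biv_sqr; rewrite ord3_neq.
  have IJ : I * J = - (J * I) by rewrite /I /J /K; apply: cl_biv_anticomm; rewrite ord3_neq.
  have JK : J * K = - (K * J) by rewrite /I /J /K; apply: cl_biv_anticomm; rewrite ord3_neq.
  have IK : I * K = - (K * I).
    by rewrite (_ : K * I = - (I * K)) ?opprK //; rewrite /I /K; apply: cl_biv_anticomm; rewrite ord3_neq.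
  have E := quat_units_norm _ _ _ _ II JJ KK IJ JK IK.
  split; first by rewrite E x1 scale1r.
  have := E (q1 x) (- qi x) (- qj x) (- qk x).
  by rewrite !scaleNr -!opprD opprK !sqrrN x1 scale1r.
split=> // k.
apply: cl3_odd_rev.
  exact: (cl_parityM (cl_parityM pw (@cl_parity_gen R 3 k)) (cl_parity_rev pw)).
rewrite !cl_revM cl_rev_gen mulrA; congr (_ * _ * _).
by apply/ffunP => A; rewrite !ffunE mulrA -expr2 sqrr_sign mul1r.
Qed.

End SpinOfQuat.

(** * The spin representation of Spin(4n) *)

Section MonomialOp.
Variables (K : comNzRingType) (q : K) (N : nat).
(** An operator whose matrix has at most one nonzero entry per row. Each e_k acts on forms in this
    way, so the Clifford relations become identities between scalars. *)
Definition monomial_op (c : {set 'I_N} -> K) (s : {set 'I_N} -> {set 'I_N})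
  (x : clifford q N) : clifford q N := [ffun A => c A * x (s A)].

Lemma monomial_op_linear c s : linear (monomial_op c s).
Proof.
move=> a x y; apply/ffunP => A; rewrite !ffunE mulrDr; congr (_ + _).
by rewrite /GRing.scale /= mulrCA.
Qed.

Lemma monomial_opE c s (x : clifford q N) A : monomial_op c s x A = c A * x (s A).
Proof. by rewrite ffunE. Qed.

Lemma monomial_op_comp c s c' s' x :
  monomial_op c s (monomial_op c' s' x) =
  monomial_op (fun A => c A * c' (s A)) (fun A => s' (s A)) x.
Proof. by apply/ffunP => A; rewrite !ffunE mulrA. Qed.

Lemma monomial_opN c s x : - monomial_op c s x = monomial_op (fun A => - c A) s x.
Proof. by apply/ffunP => A; rewrite !ffunE mulNr. Qed.

Lemma eq_monomial_op c s c' s' x : c =1 c' -> s =1 s' ->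
  monomial_op c s x = monomial_op c' s' x.
Proof. by move=> Ec Es; apply/ffunP => A; rewrite !ffunE Ec Es. Qed.

Lemma monomial_op_id x : monomial_op (fun=> 1) id x = x.
Proof. by apply/ffunP => A; rewrite !ffunE mul1r. Qed.

Lemma monomial_op_mono c s B : involutive s ->
  monomial_op c s (cl_mono q B) = c (s B) *: cl_mono q (s B).
Proof.
move=> sK; apply/ffunP => A; rewrite !ffunE (can2_eq sK sK) [RHS]/GRing.scale /=.
by case: eqP => [->//|_]; rewrite !mulr0.
Qed.
End MonomialOp.

Section CliffSigma.
Variables (R : realType) (n : nat).
Local Notation C := R[i].
Implicit Types (A B : {set 'I_(2 * n)}) (q r : 'I_(2 * n)) (k : 'I_(4 * n)).
Implicit Types (eta : Sigma R n).

Definition koszul A q : C := (-1) ^+ inversions [set q] A.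

Lemma koszul_sqr A q : koszul A q * koszul A q = 1.
Proof. by rewrite -expr2 sqrr_sign. Qed.

Lemma koszul_symdiff A q r : koszul (symdiff [set q] A) r = (-1) ^+ (q < r)%N * koszul A r.
Proof.
rewrite /koszul -exprD -signr_odd -[RHS]signr_odd oddD odd_inversions_symdiffr.
by rewrite /inversions !big_set1.
Qed.

Lemma in_symdiff1 A q r : (r \in symdiff [set q] A) = (r == q) (+) (r \in A).
Proof. by rewrite !inE. Qed.

Lemma cl_genME eta q A :
  (cl_gen 0 q * eta : Sigma R n) A = (q \in A)%:R * koszul A q * eta (symdiff [set q] A).
Proof.
rewrite ffunE (bigD1 [set q]) //= big1 => [|B nB]; last first.
  by rewrite ffunE (negPf nB) !mul0r.
rewrite ffunE eqxx mul1r addr0 /cl_coef.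
have -> : 0 ^+ #|[set q] :&: symdiff [set q] A| = (q \in A)%:R :> C.
  rewrite -sum1_card big_mkcond (bigD1 q) //= big1 => [|r nrq].
    by rewrite !inE eqxx addn0; case: (q \in A).
  by rewrite !inE (negPf nrq).
have := koszul_symdiff A q q; rewrite ltnn mul1r /koszul => ->.
by rewrite mulrC [(-1) ^+ _ * _]mulrC.
Qed.

Lemma contract_xE eta q A :
  contract_x q eta A = (q \notin A)%:R * koszul A q * eta (symdiff [set q] A).
Proof.
rewrite ffunE; case: (boolP (q \in A)) => qA; first by rewrite !mul0r.
rewrite mul1r /koszul /inversions big_set1; congr (_ ^+ _ * eta _).
  by rewrite -sum1_card big_mkcond [RHS]big_mkcond; apply: eq_bigr => a _; rewrite inE; case: (a \in A).
by apply/setP => r; rewrite !inE; case: eqP => [->|]; rewrite ?(negPf qA).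
Qed.

Lemma half_ord_subproof k : (k./2 < 2 * n)%N.
Proof. by have := ltn_ord k; lia. Qed.
Definition half_ord k : 'I_(2 * n) := Ordinal (half_ord_subproof k).

(** Read at the output set A, with q = [half_ord k]: e_(2q) toggles q with factor i, while e_(2q+1)
    creates q with factor 1 and removes it with factor -1, up to the Koszul sign. *)
Definition cliff_coef k A : C :=
  koszul A (half_ord k) * (if odd k then (-1) ^+ (half_ord k \notin A) else 'i%C).

Lemma gC_delta k (w : 'rV[C]_(4 * n)) : gC (delta_mx 0 k) w = w 0 k.
Proof.
rewrite /gC (bigD1 k) //= big1 => [|j njk]; first by rewrite mxE !eqxx mul1r addr0.
by rewrite mxE (negPf njk) andbF mul0r.
Qed.

Lemma cliff_apply (v : 'rV[C]_(4 * n)) eta A :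
  cliff v eta A = \sum_q
    (gC v (y_vec R q) * ('i * (Num.sqrt (2 : R))%:C * contract_x q eta A)
     + gC v (x_vec R q) * ('i * (Num.sqrt (2 : R))%:C * wedge_y q eta A)).
Proof.
rewrite /cliff sum_ffunE; apply: eq_bigr => q _.
by move: (contract_x q eta) (wedge_y q eta) => x y; rewrite ffunE; congr (_ + _); rewrite !ffunE.
Qed.

Lemma cliff_delta k eta :
  cliff (delta_mx 0 k) eta = monomial_op (cliff_coef k) (symdiff [set half_ord k]) eta.
Proof.
apply/ffunP => A; rewrite monomial_opE.
have s2 : (Num.sqrt 2 : R)%:C != 0 :> C.
  by rewrite eq_complex /= eqxx andbT gt_eqF // sqrtr_gt0 ltr0n.
rewrite cliff_apply (bigD1 (half_ord k)) //= big1 => [|q nq].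
  rewrite addr0 !gC_delta /wedge_y cl_genME contract_xE !mxE /cliff_coef.
  have Ek : k = (k./2.*2 + odd k)%N :> nat by rewrite addnC odd_double_half.
  have -> : (k == 2 * k./2 :> nat)%N = ~~ odd k by rewrite {1}Ek mul2n; case: (odd k); lia.
  have -> : (k == (2 * k./2).+1 :> nat)%N = odd k by rewrite {1}Ek mul2n; case: (odd k); lia.
  have := divff s2; rewrite -!complexiE.
  have i2 := sqr_i R; move: 'i%C (koszul _ _) (eta _) (_%:C) i2 s2 => ii ko et ss i2 s2.
  move: ss^-1 => t ts; rewrite expr2 in i2.
  by case: (odd k); case: (half_ord k \in A) => /=; rewrite ?expr0 ?expr1; ring: i2 ts.
rewrite !gC_delta !mxE /=.
have h : q != k./2 :> nat by rewrite -val_eqE in nq.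
have -> : (k == 2 * q :> nat)%N = false by apply/eqP; move: h => /eqP h E; apply: h; lia.
have -> : (k == (2 * q).+1 :> nat)%N = false by apply/eqP; move: h => /eqP h E; apply: h; lia.
by rewrite mulr0 subr0 addr0 !mul0r addr0.
Qed.

Lemma cliff_delta_linear k : linear (@cliff R n (delta_mx 0 k)).
Proof. by move=> a x y; rewrite !cliff_delta; apply: monomial_op_linear. Qed.

Lemma cliff_coef_sqr k A : cliff_coef k A * cliff_coef k (symdiff [set half_ord k] A) = -1.
Proof.
rewrite /cliff_coef koszul_symdiff ltnn mul1r in_symdiff1 eqxx addTb negbK mulrACA koszul_sqr mul1r.
case: (odd k); last by rewrite -expr2 sqr_i.
by case: (_ \in A); rewrite /= ?mulr1 ?mul1r.
Qed.

Lemma cliff_coef_anticomm j k A : j != k ->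
  cliff_coef j A * cliff_coef k (symdiff [set half_ord j] A) =
  - (cliff_coef k A * cliff_coef j (symdiff [set half_ord k] A)).
Proof.
move=> njk; rewrite /cliff_coef !koszul_symdiff !in_symdiff1.
have [E|nE] := eqVneq (half_ord j) (half_ord k).
  rewrite E ltnn !mul1r !addTb negbK.
  have no : odd j = ~~ odd k.
    have h : j./2 = k./2 by exact: (congr1 val E).
    move: njk; apply: contraNeq => o; apply/eqP/val_inj => /=.
    by rewrite -(odd_double_half j) -(odd_double_half k) h; move: o; do 2!case: (odd _).
  by rewrite no; case: (odd k) => /=; case: (_ \in A); rewrite /= ?expr0 ?expr1; ring.
rewrite !addFb.
move: (koszul _ _) (koszul _ _) (if odd j then _ else _) (if odd k then _ else _) => a b c d.
have [_|_|/val_inj /eqP] := ltngtP (half_ord j) (half_ord k); last by rewrite (negPf nE).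
  by rewrite expr0 expr1; ring.
by rewrite expr0 expr1; ring.
Qed.

Lemma cliff_delta_sqr k eta :
  cliff (delta_mx 0 k) (cliff (delta_mx 0 k) eta) = - eta.
Proof.
rewrite !cliff_delta monomial_op_comp -[in RHS](monomial_op_id eta) monomial_opN.
by apply: eq_monomial_op => A; rewrite ?cliff_coef_sqr ?symdiffK.
Qed.

Lemma cliff_delta_anticomm j k eta : j != k ->
  cliff (delta_mx 0 j) (cliff (delta_mx 0 k) eta) =
  - cliff (delta_mx 0 k) (cliff (delta_mx 0 j) eta).
Proof.
move=> njk; rewrite !cliff_delta !monomial_op_comp monomial_opN.
apply: eq_monomial_op => A; first exact: cliff_coef_anticomm.
by rewrite !symdiffA (symdiffC [set half_ord k]).
Qed.

Lemma Sigma_act_linear u : linear (@Sigma_act R n u).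
Proof. by apply: cl_act_linear => k; apply: cliff_delta_linear. Qed.

Lemma Sigma_actM u w eta : Sigma_act (u * w) eta = Sigma_act u (Sigma_act w eta).
Proof.
apply: cl_actM.
- exact: cliff_delta_linear.
- exact: cliff_delta_sqr.
- exact: cliff_delta_anticomm.
Qed.

Lemma Sigma_act1 eta : Sigma_act 1 eta = eta.
Proof. exact: cl_act1. Qed.

Lemma Sigma_act_gen k eta : Sigma_act (cl_gen _ k) eta = cliff (delta_mx 0 k) eta.
Proof. exact: cl_act_gen. Qed.

End CliffSigma.

Section LinearOnClifford.
Variables (K : comNzRingType) (q : K) (N : nat) (f : clifford q N -> clifford q N).
Hypothesis f_linear : linear f.

Lemma linear_cliffordE x A : f x A = \sum_B f (cl_mono q B) A * x B.
Proof.
have f0 : f 0 = 0.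
  by apply: (addrI (f 0)); have := f_linear 1 0 0; rewrite !scale1r addr0 addr0 => <-.
have fD : {morph f : y z / y + z} by move=> y z; have := f_linear 1 y z; rewrite !scale1r.
have fZ a y : f (a *: y) = a *: f y by have := f_linear a y 0; rewrite f0 !addr0.
rewrite {1}[x]cl_expand (big_morph f fD f0) sum_ffunE; apply: eq_bigr => B _.
by rewrite fZ scaler_cliffordE mulrC.
Qed.

Lemma linear_cliffordZ a x : f (a *: x) = a *: f x.
Proof.
apply/ffunP => A; rewrite ffunE !linear_cliffordE /GRing.scale /= mulr_sumr.
by apply: eq_bigr => B _; rewrite ffunE mulrCA.
Qed.
End LinearOnClifford.

(** * Schur's lemma for the spin representation *)

Section Schur.
Variables (R : realType) (n : nat) (f : Sigma R n -> Sigma R n).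
Hypothesis f_linear : linear f.
Hypothesis f_cliff : forall k eta, f (cliff (delta_mx 0 k) eta) = cliff (delta_mx 0 k) (f eta).

Lemma even_ord_subproof (q : 'I_(2 * n)) : (2 * q < 4 * n)%N.
Proof. by have := ltn_ord q; lia. Qed.
Lemma odd_ord_subproof (q : 'I_(2 * n)) : ((2 * q).+1 < 4 * n)%N.
Proof. by have := ltn_ord q; lia. Qed.
Let ev q : 'I_(4 * n) := Ordinal (even_ord_subproof q).
Let od q : 'I_(4 * n) := Ordinal (odd_ord_subproof q).
Let half_ev q : half_ord (ev q) = q.
Proof. by apply: val_inj; rewrite /= mul2n doubleK. Qed.
Let half_od q : half_ord (od q) = q.
Proof. by apply: val_inj; rewrite /= mul2n uphalf_double. Qed.
Let Nn A B := f (cl_mono 0 B) A.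

(** The product e_(2q) e_(2q+1) is diagonal with eigenvalue i or -i according to whether q is in the
    set, so a commuting operator cannot connect sets that differ at q. *)
Let Nn_diag A B : A != B -> Nn A B = 0.
Proof.
apply: contraNeq => nz; apply/eqP/setP => q.
pose D (eta : Sigma R n) := cliff (delta_mx 0 (ev q)) (cliff (delta_mx 0 (od q)) eta).
have DE eta : D eta = monomial_op (fun E => 'i%C * (-1) ^+ (q \in E)) id eta.
  rewrite /D !cliff_delta half_ev half_od monomial_op_comp.
  apply: eq_monomial_op => E; last by rewrite symdiffK.
  rewrite /cliff_coef half_ev half_od /= mul2n odd_double /= koszul_symdiff ltnn mul1r.
  by rewrite mulrACA koszul_sqr mul1r in_symdiff1 eqxx addTb negbK.
have fD eta : f (D eta) = D (f eta).
  exact: etrans (f_cliff _ _) (congr1 _ (f_cliff _ _)).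
clearbody D; have := congr1 (fun x : Sigma R n => x A) (fD (cl_mono 0 B)).
rewrite !DE monomial_opE monomial_op_mono // (linear_cliffordZ f_linear) ffunE => /(mulIf nz)/eqP.
have i0 : 'i%C != 0 :> R[i] by rewrite eq_complex /= oner_eq0 andbF.
by rewrite (inj_eq (mulfI i0)) => /eqP /signr_inj.
Qed.

(** Since e_(2q) toggles q, commuting with it equates the diagonal entries of sets that differ in
    one element. *)
Let Nn_const q B : Nn (symdiff [set q] B) (symdiff [set q] B) = Nn B B.
Proof.
have := congr1 (fun x : Sigma R n => x (symdiff [set q] B)) (f_cliff (ev q) (cl_mono 0 B)).
rewrite !cliff_delta half_ev monomial_opE symdiffK monomial_op_mono; last exact: symdiffK.
rewrite (linear_cliffordZ f_linear) ffunE; apply: mulfI.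
rewrite /cliff_coef mulf_neq0 // ?signr_eq0 //.
by rewrite /= mul2n odd_double eq_complex /= oner_eq0 andbF.
Qed.

Lemma Sigma_schur : exists c : R[i], forall eta, f eta = c *: eta.
Proof.
exists (Nn set0 set0) => eta; apply/ffunP => A.
rewrite (linear_cliffordE f_linear) (bigD1 A) //= big1 => [|B nBA]; last first.
  by rewrite [f _ _]Nn_diag ?mul0r // eq_sym.
rewrite addr0 [RHS]ffunE; congr (_ * _).
elim/setU1_min_ind: A => // k A ltkA <-; rewrite -[RHS](Nn_const k) symdiff_disj //.
by rewrite disjoints1; apply/negP => /ltkA; rewrite ltnn.
Qed.
End Schur.

Section SigmaKernel.
Variables (R : realType) (n : nat).
Local Notation C := R[i].
Implicit Types (A B : {set 'I_(2 * n)}) (k : 'I_(4 * n)) (u w : Cl R (4 * n)).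

Definition Sigma_ker u A B : C := Sigma_act u (cl_mono 0 B) A.

Lemma Sigma_actE u (eta : Sigma R n) A : Sigma_act u eta A = \sum_B Sigma_ker u A B * eta B.
Proof. exact: (linear_cliffordE (@Sigma_act_linear R n u)). Qed.

Lemma Sigma_kerM u w A B :
  Sigma_ker (u * w) A B = \sum_D Sigma_ker u A D * Sigma_ker w D B.
Proof. by rewrite {1}/Sigma_ker Sigma_actM Sigma_actE. Qed.

Lemma Sigma_ker1 A B : Sigma_ker 1 A B = (A == B)%:R.
Proof. by rewrite /Sigma_ker Sigma_act1 ffunE. Qed.

Lemma Sigma_act_intertwine u k eta : lifts_rotation u ->
  Sigma_act u (cliff (delta_mx 0 k) eta) =
  \sum_i (spin_cover u i k)%:C *: cliff (delta_mx 0 i) (Sigma_act u eta).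
Proof.
move=> lu; rewrite -Sigma_act_gen -Sigma_actM (lifts_rotation_intertwine k lu) Sigma_actM.
rewrite {1}/Sigma_act cl_act_sum; apply: eq_bigr => i _.
by rewrite cl_act_scale; congr (_ *: _); rewrite -Sigma_act_gen.
Qed.

Lemma Sigma_act_unique u (M : Sigma R n -> Sigma R n) : lifts_rotation u -> linear M ->
  (forall k eta, M (cliff (delta_mx 0 k) eta) =
     \sum_i (spin_cover u i k)%:C *: cliff (delta_mx 0 i) (M eta)) ->
  exists c : C, forall eta, M eta = c *: Sigma_act u eta.
Proof.
move=> lu linM interM; have [uu1 uu2 _] := lu.
(* Schur's lemma applies to u^-1 M, which commutes with Clifford multiplication. *)
pose f eta := Sigma_act (cl_rev u) (M eta).
have linf : linear f by move=> a x y; rewrite /f linM Sigma_act_linear.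
have [k eta|c fc] := Sigma_schur linf; last first.
  exists c => eta; rewrite -(linear_cliffordZ (@Sigma_act_linear R n u)) -fc /f.
  by rewrite -Sigma_actM uu2 Sigma_act1.
rewrite /f interM -Sigma_act_gen -Sigma_actM (lifts_rotation_intertwine_rev k lu) Sigma_actM.
congr (Sigma_act _ _); rewrite {1}/Sigma_act cl_act_sum; apply: eq_bigr => i _.
by rewrite cl_act_scale; congr (_ *: _); rewrite -Sigma_act_gen.
Qed.
End SigmaKernel.

(** * The spin representation of Spin(3) *)

Section Sigma3Matrix.
Variable R : realType.
Local Notation C := R[i].
Implicit Types (k : 'I_3) (w : Cl R 3).

Definition pauli k : 'M[C]_2 := nth 0 [:: rho_xi1 R; rho_xi3 R; - rho_xi2 R] k.

Definition Sigma3_mx w : 'M[C]_2 := \matrix_(a, b) Sigma3_act w (delta_mx b 0) a 0.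

Lemma ord3_ind (P : 'I_3 -> Prop) : P (ord3 0) -> P (ord3 1) -> P (ord3 2) -> forall k, P k.
Proof.
move=> P0 P1 P2 [[|[|[|//]]] lt].
- by rewrite (_ : Ordinal lt = ord3 0) //; apply: val_inj; rewrite /= inordK.
- by rewrite (_ : Ordinal lt = ord3 1) //; apply: val_inj; rewrite /= inordK.
- by rewrite (_ : Ordinal lt = ord3 2) //; apply: val_inj; rewrite /= inordK.
Qed.

Lemma rho_xi1E : rho_xi1 R = mx2 'i%C 0 0 (- 'i%C).
Proof. by rewrite /rho_xi1 ?complexiE. Qed.
Lemma rho_xi3E : rho_xi3 R = mx2 0 'i%C 'i%C 0.
Proof. by rewrite /rho_xi3 ?complexiE. Qed.
Lemma mx21 : 1%:M = mx2 1 0 0 1 :> 'M[C]_2.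
Proof.
apply/matrixP => i j; rewrite !mxE.
by case: i => [[|[|//]] ?]; case: j => [[|[|//]] ?].
Qed.

Lemma pauliE : (pauli (ord3 0) = mx2 'i%C 0 0 (- 'i%C)) * (pauli (ord3 1) = mx2 0 'i%C 'i%C 0)
  * (pauli (ord3 2) = mx2 0 (-1) 1 0).
Proof. by rewrite /pauli !inordK //= rho_xi1E rho_xi3E /rho_xi2 mx2N oppr0 opprK. Qed.

Lemma pauli_sqr k : pauli k *m pauli k = - 1%:M.
Proof.
have i2 := sqr_i R; rewrite expr2 in i2.
by elim/ord3_ind: k; rewrite pauliE mx2M mx21 mx2N; congr mx2; ring: i2.
Qed.

Lemma pauli_anticomm j k : j != k -> pauli j *m pauli k = - (pauli k *m pauli j).
Proof.
by elim/ord3_ind: j; elim/ord3_ind: k; rewrite ?eqxx // => _;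
  rewrite !pauliE !mx2M mx2N; congr mx2; ring.
Qed.

Lemma cliff3E k (s : Sigma3 R) : cliff3 k s = pauli k *m s.
Proof. by []. Qed.

Lemma cliff3_linear k : linear (@cliff3 R k).
Proof. by move=> a x y; rewrite !cliff3E linearP. Qed.

Lemma cliff3_sqr k (s : Sigma3 R) : cliff3 k (cliff3 k s) = - s.
Proof. by rewrite !cliff3E mulmxA pauli_sqr mulNmx mul1mx. Qed.

Lemma cliff3_anticomm j k (s : Sigma3 R) : j != k ->
  cliff3 j (cliff3 k s) = - cliff3 k (cliff3 j s).
Proof.
move=> njk; rewrite !cliff3E !mulmxA.
by rewrite (pauli_anticomm njk) mulNmx.
Qed.

Lemma Sigma3_act_linear w : linear (@Sigma3_act R w).
Proof. exact: cl_act_linear cliff3_linear w. Qed.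

Lemma Sigma3_actE w (s : Sigma3 R) : Sigma3_act w s = Sigma3_mx w *m s.
Proof.
have fD : {morph @Sigma3_act R w : x y / x + y}.
  by move=> x y; have := Sigma3_act_linear w 1 x y; rewrite !scale1r.
have f0 : Sigma3_act w 0 = 0 :> Sigma3 R.
  by apply: (addrI (Sigma3_act w 0)); rewrite -fD !addr0.
have fZ a x : Sigma3_act w (a *: x) = a *: Sigma3_act w x.
  by have := Sigma3_act_linear w a x 0; rewrite f0 !addr0.
have -> : s = \sum_b s b 0 *: delta_mx b 0.
  rewrite {1}[s]matrix_sum_delta; apply: eq_bigr => b _.
  by rewrite big_ord1.
rewrite (big_morph _ fD f0) mulmx_sumr; apply: eq_bigr => b _.
rewrite fZ -scalemxAr; congr (_ *: _).
by apply/matrixP => a j; rewrite ord1 -colE !mxE.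
Qed.

Lemma Sigma3_mxM w w' : Sigma3_mx (w * w') = Sigma3_mx w *m Sigma3_mx w'.
Proof.
apply/matrixP => a b; rewrite mxE.
rewrite (_ : Sigma3_act _ _ = Sigma3_act w (Sigma3_act w' (delta_mx b 0))); last first.
  apply: cl_actM; [exact: cliff3_linear|exact: cliff3_sqr|exact: cliff3_anticomm].
by rewrite !Sigma3_actE mulmxA -colE mxE.
Qed.

Lemma Sigma3_mx1 : Sigma3_mx 1 = 1%:M.
Proof. by apply/matrixP => a b; rewrite mxE [Sigma3_act _ _]cl_act1 !mxE eqxx andbT. Qed.

Lemma Sigma3_mx_gen k : Sigma3_mx (cl_gen _ k) = pauli k.
Proof. by apply/matrixP => a b; rewrite mxE [Sigma3_act _ _]cl_act_gen cliff3E -colE mxE. Qed.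

(** The diagonal matrix [pauli (ord3 0)] kills the off-diagonal entries of M, and [pauli (ord3 2)]
    equates the diagonal ones. *)
Lemma pauli_schur (M : 'M[C]_2) : (forall k, M *m pauli k = pauli k *m M) -> exists c, M = c%:M.
Proof.
move=> comm; exists (M 0 0).
have E : M = mx2 (M 0 0) (M 0 1) (M 1 0) (M 1 1).
  apply/matrixP => i j; rewrite mxE.
  by case: i => [[|[|//]] ?]; case: j => [[|[|//]] ?] /=; congr (M _ _); apply: val_inj.
have i0 : 'i%C != 0 :> C by rewrite eq_complex /= oner_eq0 andbF.
have n2 : (2%:R : C) != 0 by rewrite pnatr_eq0.
have := comm (ord3 0); have := comm (ord3 2); rewrite E !pauliE !mx2M.
move: (M 0 0) (M 0 1) (M 1 0) (M 1 1) => a b c d /matrixP h2 /matrixP h0.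
have e1 := h2 0 1; have e2 := h0 1 0; have e3 := h0 0 1; rewrite !mxE /= in e1 e2 e3.
have -> : d = a by apply: oppr_inj; move: e1; rewrite mulrN1 mulN1r mulr0 mul0r addr0 add0r.
have b0 : 2%:R * ('i%C * b) = 0.
  transitivity ('i%C * b + 0 * d - (a * 0 + b * - 'i%C)); first by ring.
  by rewrite e3 subrr.
have c0 : 2%:R * ('i%C * c) = 0.
  transitivity (c * 'i%C + d * 0 - (0 * a + - 'i%C * c)); first by ring.
  by rewrite e2 subrr.
move/eqP: b0; move/eqP: c0; rewrite !mulf_eq0 (negPf i0) (negPf n2) /= => /eqP-> /eqP->.
apply/matrixP => i j; rewrite !mxE.
by case: i => [[|[|//]] ?]; case: j => [[|[|//]] ?].
Qed.

Lemma Sigma3_mx_unique w w0 : lifts_rotation w -> lifts_rotation w0 ->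
  spin_cover w = spin_cover w0 -> exists2 c : C, c != 0 & Sigma3_mx w = c *: Sigma3_mx w0.
Proof.
move=> lw lw0 Ecov; have [w1 w2 _] := lw; have [w01 w02 _] := lw0.
have [k|c Ec] := @pauli_schur (Sigma3_mx (cl_rev w0 * w)).
  have comm : cl_rev w0 * w * cl_gen _ k = cl_gen _ k * (cl_rev w0 * w).
    rewrite [RHS]mulrA (lifts_rotation_intertwine_rev k lw0) -[LHS]mulrA.
    by rewrite (lifts_rotation_intertwine k lw) Ecov [LHS]mulrA.
  by rewrite -(Sigma3_mx_gen k) -[LHS]Sigma3_mxM -[RHS]Sigma3_mxM comm.
have E : Sigma3_mx w = c *: Sigma3_mx w0.
  by rewrite -mul_mx_scalar -Ec -Sigma3_mxM mulrA w02 mul1r.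
exists c => //; apply/eqP => c0.
have : Sigma3_mx (cl_rev w * w) = 1%:M by rewrite w1 Sigma3_mx1.
rewrite Sigma3_mxM E c0 scale0r mulmx0 => /matrixP/(_ 0 0); rewrite !mxE /= => /esym/eqP.
by rewrite (oner_eq0 C).
Qed.

Definition quat_mx (x : quat R) : 'M[C]_2 :=
  mx2 (q1 x +i* qi x) (- qk x +i* qj x) (qk x +i* qj x) (q1 x +i* - qi x).

Lemma Sigma3_mx_quat x : Sigma3_mx (spin_of_quat x) = quat_mx x.
Proof.
have Z a v : Sigma3_mx (a *: v) = a%:C *: Sigma3_mx v.
  by apply/matrixP => i j; rewrite !mxE [Sigma3_act _ _]cl_act_scale mxE.
have D v v' : Sigma3_mx (v + v') = Sigma3_mx v + Sigma3_mx v'.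
  apply/matrixP => i j; rewrite [LHS]mxE [RHS]mxE [Sigma3_act _ _]cl_actD [LHS]mxE.
  by congr (_ + _); rewrite mxE.
rewrite spin_of_quatE !(D, Z) !Sigma3_mxM !Sigma3_mx_gen !pauliE Sigma3_mx1 mx21 !mx2M.
rewrite !mx2Z !mx2D; congr mx2; apply/eqP; rewrite eq_complex /=; apply/andP; split; apply/eqP; ring.
Qed.
End Sigma3Matrix.

(** * Twisted spinors *)

Section TensorAction.
Variables (F : comNzRingType) (I : finType) (m : nat).
Local Notation idx := {ffun 'I_m -> 'I_2}.
Implicit Types (K : I -> I -> F) (M : 'M[F]_2) (v : {ffun I * idx -> F}) (f g h : idx).

(** The operator K (x) M^(tensor m). Keeping K an arbitrary matrix covers both the unknown lift and
    the explicit operators of Sp(1). *)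
Definition tens_act K M v : {ffun I * idx -> F} :=
  [ffun Af : I * idx => \sum_B \sum_(g : idx) K Af.1 B * (\prod_t M (Af.2 t) (g t)) * v (B, g)].

Lemma tens_actE K M v A f :
  tens_act K M v (A, f) = \sum_B \sum_(g : idx) K A B * (\prod_t M (f t) (g t)) * v (B, g).
Proof. by rewrite ffunE. Qed.

Lemma prod_mulmx M M' f h :
  \prod_t (M *m M') (f t) (h t) =
  \sum_(g : idx) (\prod_t M (f t) (g t)) * \prod_t M' (g t) (h t).
Proof.
under eq_bigr => t _ do rewrite mxE.
rewrite bigA_distr_bigA; apply: eq_bigr => g _; exact: big_split.
Qed.

Lemma prod_scalar_mx c f g :
  \prod_t (c%:M : 'M[F]_2) (f t) (g t) = c ^+ m * (f == g)%:R.
Proof.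
have [->|nfg] := eqVneq f g.
  under eq_bigr => t _ do rewrite mxE eqxx mulr1n.
  by rewrite prodr_const card_ord mulr1.
have /existsP[t nt] : [exists t, f t != g t].
  apply: contraNT nfg; rewrite negb_exists => /forallP e.
  by apply/eqP/ffunP => t; have := e t; rewrite negbK => /eqP.
by rewrite (bigD1 t) //= mxE (negPf nt) mulr0n mul0r mulr0.
Qed.

Lemma tens_act_comp K M K' M' v :
  tens_act K M (tens_act K' M' v) =
  tens_act (fun A B => \sum_D K A D * K' D B) (M *m M') v.
Proof.
apply/ffunP => -[A f]; rewrite !tens_actE.
transitivity (\sum_D \sum_(h : idx) \sum_B \sum_(g : idx)
    K A D * (\prod_t M (f t) (h t)) * (K' D B * (\prod_t M' (h t) (g t)) * v (B, g))).
  apply: eq_bigr => D _; apply: eq_bigr => h _; rewrite tens_actE mulr_sumr.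
  by apply: eq_bigr => B _; rewrite mulr_sumr.
under eq_bigr => D _ do (rewrite exchange_big /=; under eq_bigr => B _ do rewrite exchange_big /=).
rewrite exchange_big; apply: eq_bigr => B _; rewrite exchange_big /=; apply: eq_bigr => g _.
rewrite prod_mulmx mulr_suml mulr_suml; apply: eq_bigr => D _.
rewrite mulr_sumr mulr_suml; apply: eq_bigr => h _; ring.
Qed.

Lemma eq_tens_act K K' M M' v : (forall A B, K A B = K' A B) -> M = M' ->
  tens_act K M v = tens_act K' M' v.
Proof.
move=> EK <-; apply/ffunP => -[A f]; rewrite !tens_actE.
by apply: eq_bigr => B _; apply: eq_bigr => g _; rewrite EK.
Qed.

Lemma tens_act_scale a b K M v :
  tens_act (fun A B => a * K A B) (b *: M) v =
  [ffun Af => a * b ^+ m * tens_act K M v Af].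
Proof.
apply/ffunP => -[A f]; rewrite !ffunE mulr_sumr; apply: eq_bigr => B _ /=.
rewrite mulr_sumr; apply: eq_bigr => g _.
under eq_bigr => t _ do rewrite mxE.
rewrite big_split /= prodr_const card_ord; ring.
Qed.
End TensorAction.

Section TwistedAction.
Variables (R : realType) (n m : nat).
Local Notation C := R[i].
Implicit Types (z : Cl R (4 * n) * Cl R 3) (v : twspinor R n m).

Lemma twspinor_actE z v :
  twspinor_act z v = tens_act (Sigma_ker z.1) (Sigma3_mx z.2) v.
Proof.
apply/ffunP => -[A f]; rewrite ffunE tens_actE; apply: eq_bigr => B _; apply: eq_bigr => g _.
by congr (_ * _ * _); apply: eq_bigr => t _; rewrite mxE.
Qed.

Lemma twspinor_actM z z' v :
  twspinor_act (Spinr_mul z z') v = twspinor_act z (twspinor_act z' v).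
Proof.
rewrite !twspinor_actE tens_act_comp; apply: eq_tens_act => [A B|].
  exact: Sigma_kerM.
exact: Sigma3_mxM.
Qed.

Lemma twspinor_actZ z a v : twspinor_act z (a *: v) = a *: twspinor_act z v.
Proof.
apply/ffunP => -[A f]; rewrite [RHS]ffunE !twspinor_actE !tens_actE.
rewrite /GRing.scale /= mulr_sumr; apply: eq_bigr => B _.
rewrite mulr_sumr; apply: eq_bigr => g _.
by rewrite ffunE mulrCA.
Qed.
End TwistedAction.

(** * The isotropy representation *)

Section QuatConj.
Variable R : comNzRingType.
Implicit Types x y : quat R.

Lemma quat_eqP x y : q1 x = q1 y -> qi x = qi y -> qj x = qj y -> qk x = qk y -> x = y.
Proof. by case: x => ????; case: y => ???? /= -> -> -> ->. Qed.

Lemma qconjD x y : qconj (x + y) = qconj x + qconj y.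
Proof. by apply: quat_eqP => //=; rewrite opprD. Qed.
Lemma qconjM x y : qconj (x * y) = qconj y * qconj x.
Proof. by apply: quat_eqP => /=; ring. Qed.
Lemma qconj0 : qconj 0 = 0 :> quat R.
Proof. by apply: quat_eqP => /=; rewrite ?oppr0. Qed.
Lemma qconj1 : qconj 1 = 1 :> quat R.
Proof. by apply: quat_eqP => /=; rewrite ?oppr0. Qed.
Lemma qconjK : involutive (@qconj R).
Proof. by move=> x; apply: quat_eqP => /=; rewrite ?opprK. Qed.
Lemma qconj_sum I (r : seq I) (P : pred I) (E : I -> quat R) :
  qconj (\sum_(i <- r | P i) E i) = \sum_(i <- r | P i) qconj (E i).
Proof. exact: (big_morph _ qconjD qconj0). Qed.
Lemma qconjN x : qconj (- x) = - qconj x.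
Proof. by apply: quat_eqP. Qed.
Lemma q1_sum I (r : seq I) (P : pred I) (E : I -> quat R) :
  q1 (\sum_(i <- r | P i) E i) = \sum_(i <- r | P i) q1 (E i).
Proof. by apply: (big_morph (@q1 R)). Qed.

Definition qdot x y := q1 x * q1 y + qi x * qi y + qj x * qj y + qk x * qk y.

Definition qct m n (A : 'M[quat R]_(m, n)) : 'M[quat R]_(n, m) := (map_mx (@qconj R) A)^T.

Lemma qctM m n p (A : 'M[quat R]_(m, n)) (B : 'M[quat R]_(n, p)) :
  qct (A *m B) = qct B *m qct A.
Proof.
apply/matrixP => i j; rewrite !mxE qconj_sum; apply: eq_bigr => k _.
by rewrite qconjM !mxE.
Qed.

Lemma qctK m n (A : 'M[quat R]_(m, n)) : qct (qct A) = A.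
Proof. by apply/matrixP => i j; rewrite !mxE qconjK. Qed.
End QuatConj.

Section Isotropy.
Variables (R : realType) (n : nat).
Implicit Types (h : Hpair R n) (a c : 'rV[quat R]_n) (k : 'I_(4 * n)).

(** m is identified with H^n by the first row of a matrix; -1 is the upper entry of E_(1,p+1). In
    these coordinates (x, B) acts by a |-> x a B^*. *)
Definition quat_basis (c : nat) : quat R :=
  match c with 0 => @Qj R | 1 => @Qk R | 2 => @Qi R | _ => -1 end.

Lemma quarter_ord_subproof k : (k %/ 4 < n)%N.
Proof. by have := ltn_ord k; lia. Qed.
Definition quarter_ord k : 'I_n := Ordinal (quarter_ord_subproof k).

Definition m_mat a : 'M[quat R]_(1 + n) := block_mx 0 a (- qct a) 0.
Definition m_row k : 'rV[quat R]_n := \row_p (quat_basis (k %% 4) * (p == quarter_ord k)%:R).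

Lemma m_basisE k : m_basis R k = m_mat (m_row k).
Proof.
have E0 : (inord (k %/ 4).+1 : 'I_n.+1) = rshift 1 (quarter_ord k).
  by apply: val_inj; rewrite /= inordK // ltnS quarter_ord_subproof.
have z (p : 'I_n) : (rshift 1 p == ord0 :> 'I_(1 + n)) = false by apply/eqP => /(congr1 val).
have l (p p' : 'I_n) : (rshift 1 p == rshift 1 p' :> 'I_(1 + n)) = (p == p').
  by rewrite (inj_eq (@rshift_inj 1 n)).
have lz : lshift n (0 : 'I_1) = ord0 :> 'I_(1 + n) by apply: val_inj.
apply/matrixP => i j.
case: (@split_ordP 1 n i) => i' ->; case: (@split_ordP 1 n j) => j' ->;
  [rewrite [RHS]block_mxEul|rewrite [RHS]block_mxEur
  |rewrite [RHS]block_mxEdl|rewrite [RHS]block_mxEdr];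
  rewrite ?[i']ord1 ?[j']ord1 {i j} /m_basis /quat_basis E0 ?lz !mxE;
  case: (k %% 4)%N => [|[|[|m]]]; rewrite !mxE ?(eq_sym ord0) ?z ?l ?eqxx /=;
  rewrite ?orbF ?andbT ?andbF ?mulr0 ?subr0 ?sub0r //;
  by case: (_ == quarter_ord k); apply: quat_eqP => /=; ring.
Qed.

Lemma H_mx_conj h a : H_mx h *m m_mat a *m qadj (H_mx h) =
  m_mat ((h.1)%:M *m a *m qct h.2) :> 'M[quat R]_(1 + n).
Proof.
have -> : qadj (H_mx h) = block_mx ((qconj h.1)%:M : 'M_1) 0 0 (qct h.2) :> 'M_(1 + n).
  transitivity (qct (block_mx (h.1%:M : 'M_1) 0 0 h.2)); first by [].
  rewrite /qct map_block_mx tr_block_mx; congr block_mx.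
  - by apply/matrixP => i j; rewrite !mxE !ord1 eqxx.
  - by apply/matrixP => i j; rewrite !mxE qconj0.
  - by apply/matrixP => i j; rewrite !mxE qconj0.
transitivity (block_mx (h.1%:M : 'M_1) 0 0 h.2 *m block_mx 0 a (- qct a) 0
    *m block_mx ((qconj h.1)%:M : 'M_1) 0 0 (qct h.2)); first by [].
rewrite /m_mat !mulmx_block !(mulmx0, mul0mx, addr0, add0r).
congr block_mx; rewrite !qctM qctK mulmxN mulNmx -mulmxA; congr (- (_ *m (_ *m _))).
by apply/matrixP => i j; rewrite !mxE !ord1 eqxx.
Qed.

Lemma g_m_mat a c : g (m_mat a) (m_mat c) = \sum_p qdot (a 0 p) (c 0 p).
Proof.
rewrite /g /B0 (_ : _ *m _ = block_mx 0 a (- qct a) 0 *m block_mx 0 c (- qct c) 0) //.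
rewrite mulmx_block !(mulmx0, mul0mx, addr0, add0r).
rewrite (_ : \tr _ = \tr (a *m - qct c) + \tr (- qct a *m c)); last exact: (@mxtrace_block _ 1 n).
rewrite /mxtrace big_ord1 !mxE /= !q1_sum mulrN mulrDr !mulr_sumr -big_split /= -sumrN.
apply: eq_bigr => p _; rewrite !mxE big_ord1 !mxE /= /qdot.
by field.
Qed.

Lemma isotropyE h i j : isotropy h i j =
  qdot (quat_basis (i %% 4))
       (h.1 * quat_basis (j %% 4) * qconj (h.2 (quarter_ord i) (quarter_ord j))).
Proof.
rewrite mxE !m_basisE.
rewrite [X in g _ X]H_mx_conj g_m_mat (bigD1 (quarter_ord i)) //= big1 => [|p np].
  rewrite addr0 mxE eqxx mulr1; congr qdot.
  rewrite !mxE (bigD1 (quarter_ord j)) //= big1 => [|p np].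
    by rewrite addr0 !mxE big_ord1 !mxE eqxx mulr1 mulr1n.
  by rewrite !mxE big_ord1 !mxE (negPf np) !mulr0 mul0r.
by rewrite mxE (negPf np) mulr0 /qdot /= !mul0r !addr0.
Qed.
End Isotropy.

(** * The action of Sp(1) on spinors *)

Section Pairs.
Variable n : nat.
Implicit Types (p : 'I_n) (q : 'I_(2 * n)) (A B : {set 'I_(2 * n)}).

Definition even_idx p : 'I_(2 * n) := Ordinal (lt_even_index p).
Definition odd_idx p : 'I_(2 * n) := Ordinal (lt_odd_index p).
Lemma pair_of_subproof q : (q./2 < n)%N.
Proof. by have := ltn_ord q; lia. Qed.
Definition pair_of q : 'I_n := Ordinal (pair_of_subproof q).

Lemma idx_cases q : q = even_idx (pair_of q) \/ q = odd_idx (pair_of q).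
Proof. by case: (boolP (odd q)) => oq; [right|left]; apply: val_inj => /=; lia. Qed.

Lemma pair_of_even p : pair_of (even_idx p) = p.
Proof. by apply: val_inj => /=; lia. Qed.
Lemma pair_of_odd p : pair_of (odd_idx p) = p.
Proof. by apply: val_inj => /=; lia. Qed.
Lemma even_odd_idx p p' : (even_idx p == odd_idx p') = false.
Proof. by rewrite -val_eqE /=; lia. Qed.
Lemma odd_even_idx p p' : (odd_idx p == even_idx p') = false.
Proof. by rewrite eq_sym even_odd_idx. Qed.
Lemma even_idx_eq p p' : (even_idx p == even_idx p') = (p == p').
Proof. by rewrite -!val_eqE /=; lia. Qed.
Lemma odd_idx_eq p p' : (odd_idx p == odd_idx p') = (p == p').
Proof. by rewrite -!val_eqE /=; lia. Qed.

Lemma sum_pairs (E : 'I_(2 * n) -> nat) :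
  (\sum_q E q = \sum_p (E (even_idx p) + E (odd_idx p)))%N.
Proof.
rewrite (partition_big pair_of xpredT) //=; apply: eq_bigr => p _.
rewrite (bigD1 (even_idx p)) ?pair_of_even //= (bigD1 (odd_idx p)) /=; last first.
  by rewrite pair_of_odd eqxx odd_even_idx.
rewrite big1 ?addn0 // => q /andP[/andP[/eqP <-]].
by case: (idx_cases q) => {1 3}->; rewrite eqxx.
Qed.

Definition bits A p : bool * bool := (even_idx p \in A, odd_idx p \in A).

Lemma bitsP A B : (forall p, bits A p = bits B p) -> A = B.
Proof.
move=> E; apply/setP => q; have [e o] := E (pair_of q).
by case: (idx_cases q) => ->.
Qed.
End Pairs.

Section SpinorOfQuat.
Variables (R : realType) (n : nat).
Local Notation C := R[i].
Implicit Types (x : quat R) (p : 'I_n) (A B : {set 'I_(2 * n)}) (k : 'I_(4 * n)) (s : bool * bool).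

Definition bit_ord (b : bool) : 'I_2 := if b then 1 else 0.

Definition local_mx x s s' : C :=
  if s.1 == s.2 then if s'.1 == s'.2 then quat_mx x (bit_ord s.1) (bit_ord s'.1) else 0
  else (s == s')%:R.

(** Each local matrix preserves the parity of its pair, so the tensor product over p carries no
    Koszul signs. *)
Definition spin_kernel x A B : C := \prod_p local_mx x (bits A p) (bits B p).

Definition flip (c : nat) s : bool * bool := if (c < 2)%N then (~~ s.1, s.2) else (s.1, ~~ s.2).

(** The part of [cliff_coef] that depends only on the pair containing k, with c = k mod 4; for c >=
    2 the second index of the pair is toggled, which costs the sign of passing the first. *)
Definition local_coef (c : nat) s : C :=
  (if (c < 2)%N then 1 else (-1) ^+ s.1) *
  (if odd c then (-1) ^+ (~~ (if (c < 2)%N then s.1 else s.2)) else 'i%C).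

Lemma local_intertwine x s s' (c : nat) : quat_unit x -> (c < 4)%N ->
  local_mx x s (flip c s') * local_coef c (flip c s') =
  \sum_(d < 4) (qdot (quat_basis R d) (x * quat_basis R c))%:C
     * local_coef d s * local_mx x (flip d s) s'.
Proof.
move=> x1 ltc.
have {}x1 : q1 x ^+ 2 = 1 - (qi x ^+ 2 + qj x ^+ 2 + qk x ^+ 2) by rewrite -x1; ring.
rewrite !big_ord_recl big_ord0 addr0.
case: s => [[] []]; case: s' => [[] []]; move: c ltc => [|[|[|[|//]]]] _;
  rewrite /local_mx /local_coef /flip /bit_ord /quat_mx /quat_basis /= ?mxE /=;
  apply/eqP; rewrite eq_complex /=; apply/andP; split; apply/eqP; rewrite /qdot /=; ring: x1.
Qed.
End SpinorOfQuat.

Section KernelOp.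
Variables (K : comNzRingType) (q : K) (N : nat) (k : {set 'I_N} -> {set 'I_N} -> K).

Lemma kernel_op_linear :
  linear (fun x : clifford q N => [ffun A => \sum_B k A B * x B] : clifford q N).
Proof.
move=> a x y; apply/ffunP => A; rewrite !ffunE /GRing.scale /= mulr_sumr -big_split.
by apply: eq_bigr => B _ /=; rewrite !ffunE mulrDr /GRing.scale /= mulrCA.
Qed.
End KernelOp.

Section SpinorOfQuatAction.
Variables (R : realType) (n : nat).
Local Notation C := R[i].
Implicit Types (x : quat R) (p : 'I_n) (A B : {set 'I_(2 * n)}) (k : 'I_(4 * n)) (s : bool * bool).

Definition pair_sign p A : C := (-1) ^+ (\sum_(r < n | (r < p)%N) ((bits A r).1 + (bits A r).2)).

Lemma koszul_pair A p (b : bool) :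
  koszul R A (if b then odd_idx p else even_idx p) =
  pair_sign p A * (if b then (-1) ^+ (bits A p).1 else 1).
Proof.
rewrite /koszul /pair_sign /inversions big_set1.
have -> : (\sum_(q in A) (q < (if b then odd_idx p else even_idx p : 'I_(2 * n)))%N =
   \sum_(r < n | (r < p)%N) ((bits A r).1 + (bits A r).2) + b && (bits A p).1)%N.
  rewrite big_mkcond sum_pairs /= [in RHS]big_mkcond /=.
  have -> : (b && (even_idx p \in A) = \sum_r (if r == p then b && (even_idx p \in A) : nat else 0%N) :> nat)%N.
    by rewrite -big_mkcond big_pred1_eq.
  rewrite -big_split /=; apply: eq_bigr => r _.
  rewrite -val_eqE /=; have [lt|gt|/val_inj ->] := ltngtP r p; case: b => /=; case: ifP => _; case: ifP => _; lia.
by rewrite exprD; case: b => //=; rewrite andbF.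
Qed.

Lemma half_ordE k : half_ord k =
  if (k %% 4 < 2)%N then even_idx (quarter_ord k) else odd_idx (quarter_ord k).
Proof. by case: ifP => lt; apply: val_inj => /=; lia. Qed.

Lemma cliff_coefE k A : cliff_coef R k A =
  pair_sign (quarter_ord k) A * local_coef R (k %% 4) (bits A (quarter_ord k)).
Proof.
rewrite /cliff_coef half_ordE /local_coef mulrA.
have -> : odd (k %% 4) = odd k by rewrite {2}(divn_eq k 4) oddD oddM andbF.
case: ltnP => _ /=.
  by rewrite (koszul_pair A _ false).
by rewrite (koszul_pair A _ true).
Qed.

Lemma bits_flip k A p : bits (symdiff [set half_ord k] A) p =
  if p == quarter_ord k then flip (k %% 4) (bits A p) else bits A p.
Proof.
rewrite /bits /flip !in_symdiff1 half_ordE.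
have [->|np] := eqVneq p (quarter_ord k); case: ltnP => _ /=;
  rewrite ?even_odd_idx ?odd_even_idx ?even_idx_eq ?odd_idx_eq ?eqxx ?(negPf np) //.
Qed.

Definition rest_kernel x p A B : C := \prod_(r | r != p) local_mx x (bits A r) (bits B r).

Lemma spin_kernelD1 x p A B :
  spin_kernel x A B = local_mx x (bits A p) (bits B p) * rest_kernel x p A B.
Proof. by rewrite /spin_kernel (bigD1 p). Qed.

Lemma pair_sign_flip k A : pair_sign (quarter_ord k) (symdiff [set half_ord k] A) = pair_sign (quarter_ord k) A.
Proof.
rewrite /pair_sign; congr (_ ^+ _); apply: eq_bigr => r ltr.
by rewrite bits_flip -val_eqE /= ltn_eqF.
Qed.

(** A nonzero product forces A and B to have equal parity on every pair other than p, hence equal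
    signs from the pairs before p. *)
Lemma rest_kernel_sign x p A B :
  pair_sign p A * rest_kernel x p A B = pair_sign p B * rest_kernel x p A B.
Proof.
have E D : pair_sign p D = \prod_(r | r != p)
    (if (r < p)%N then (-1) ^+ ((bits D r).1 + (bits D r).2)%N else 1).
  rewrite /pair_sign -prodrXr [LHS]big_mkcond [RHS]big_mkcond; apply: eq_bigr => r _ /=.
  rewrite -val_eqE; case: ltngtP => //.
rewrite !E /rest_kernel -!big_split; apply: eq_bigr => r _ /=.
case: (r < p)%N => //; rewrite /local_mx.
rewrite -[_ ^+ _ in LHS]signr_odd -[_ ^+ _ in RHS]signr_odd.
by rewrite /bits; do 4!case: (_ \in _); rewrite /= ?mulr0.
Qed.

Lemma block_ord_subproof p (c : 'I_4) : (4 * p + c < 4 * n)%N.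
Proof. by have := ltn_ord p; have := ltn_ord c; lia. Qed.
Definition block_ord p (c : 'I_4) : 'I_(4 * n) := Ordinal (block_ord_subproof p c).

Lemma block_ordK p (c : 'I_4) : quarter_ord (block_ord p c) = p /\ (block_ord p c %% 4 = c)%N.
Proof. by have := ltn_ord c; split; [apply: val_inj|]; rewrite /=; lia. Qed.

Lemma sum_block p (E : 'I_(4 * n) -> C) :
  \sum_(i | quarter_ord i == p) E i = \sum_(c < 4) E (block_ord p c).
Proof.
rewrite (reindex_onto (block_ord p) (fun i => inord (i %% 4))) /=.
  apply: eq_bigl => c; have [-> e] := block_ordK p c; rewrite eqxx /=.
  by apply/eqP/val_inj; rewrite /= inordK e.
move=> i /eqP <-; apply: val_inj; rewrite /= inordK ?ltn_mod //.
by rewrite mulnC -divn_eq.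
Qed.

Lemma spin_kernel_intertwine x k A B : quat_unit x ->
  spin_kernel x A (symdiff [set half_ord k] B) * cliff_coef R k (symdiff [set half_ord k] B) =
  \sum_i (isotropy (x, 1%:M) i k : R)%:C * cliff_coef R i A
     * spin_kernel x (symdiff [set half_ord i] A) B.
Proof.
move=> x1; set p := quarter_ord k.
rewrite (bigID (fun i => quarter_ord i == p)) /= [X in _ + X]big1 ?addr0 => [|i ni]; last first.
  rewrite isotropyE mxE (negPf ni) mulr0n qconj0 mulr0 /qdot /=.
  by rewrite !mulr0 !addr0 rmorph0 !mul0r.
rewrite sum_block cliff_coefE pair_sign_flip -/p !(spin_kernelD1 x p).
have rest_flip i D E : quarter_ord i = p ->
  (rest_kernel x p (symdiff [set half_ord i] D) E = rest_kernel x p D E) *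
  (rest_kernel x p D (symdiff [set half_ord i] E) = rest_kernel x p D E).
  by move=> ip; split; apply: eq_bigr => r nr; rewrite bits_flip ip (negPf nr).
rewrite (rest_flip k) // bits_flip -/p eqxx.
transitivity (pair_sign p B * rest_kernel x p A B *
  (local_mx x (bits A p) (flip (k %% 4) (bits B p)) * local_coef R (k %% 4) (flip (k %% 4) (bits B p)))).
  by ring.
rewrite -rest_kernel_sign local_intertwine ?ltn_mod // mulr_sumr; apply: eq_bigr => c _.
have [ec em] := block_ordK p c.
rewrite isotropyE /= em ec mxE eqxx mulr1n qconj1 mulr1.
rewrite cliff_coefE ec em !(spin_kernelD1 x p) (rest_flip _ _ _ ec) bits_flip ec eqxx em.
ring.
Qed.

Definition spin_op x (eta : Sigma R n) : Sigma R n := [ffun A => \sum_B spin_kernel x A B * eta B].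

Lemma spin_op_linear x : linear (spin_op x).
Proof. exact: kernel_op_linear. Qed.

Lemma spin_op_intertwine x k eta : quat_unit x ->
  spin_op x (cliff (delta_mx 0 k) eta) =
  \sum_i (isotropy (x, 1%:M) i k : R)%:C *: cliff (delta_mx 0 i) (spin_op x eta).
Proof.
move=> x1; apply/ffunP => A; rewrite ffunE cliff_delta.
rewrite sum_ffunE (reindex_inj (can_inj (symdiffK [set half_ord k]))) /=.
transitivity (\sum_B (spin_kernel x A (symdiff [set half_ord k] B) *
    cliff_coef R k (symdiff [set half_ord k] B)) * eta B).
  by apply: eq_bigr => B _; rewrite monomial_opE symdiffK mulrA.
transitivity (\sum_B \sum_i (isotropy (x, 1%:M) i k : R)%:C * cliff_coef R i A
     * spin_kernel x (symdiff [set half_ord i] A) B * eta B).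
  by apply: eq_bigr => B _; rewrite (spin_kernel_intertwine k A B x1) mulr_suml.
rewrite exchange_big; apply: eq_bigr => i _ /=.
rewrite [RHS]ffunE cliff_delta monomial_opE [in RHS]ffunE.
rewrite /GRing.scale /= !mulr_sumr; apply: eq_bigr => B _; ring.
Qed.

Lemma Sigma_ker_quat (u : Cl R (4 * n)) x : quat_unit x -> lifts_rotation u ->
  spin_cover u = isotropy (x, 1%:M) ->
  exists2 c : C, c != 0 & forall A B, Sigma_ker u A B = c * spin_kernel x A B.
Proof.
move=> x1 lu Ecov.
have [k eta|c Ec] := @Sigma_act_unique R n u (spin_op x) lu (spin_op_linear x).
  by rewrite Ecov; apply: spin_op_intertwine.
have E A B : spin_kernel x A B = c * Sigma_ker u A B.
  have := congr1 (fun eta : Sigma R n => eta A) (Ec (cl_mono 0 B)).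
  rewrite ffunE [RHS]ffunE (bigD1 B) //= big1 => [|D nD]; last first.
    by rewrite ffunE (negPf nD) mulr0.
  by rewrite ffunE eqxx mulr1 addr0.
have c0 : c != 0.
  (* With exactly one index from each pair, every local factor is 1, so this diagonal entry of the
     kernel is 1 for all x. *)
  pose A := [set q : 'I_(2 * n) | ~~ odd q].
  have bA p : bits A p = (true, false) by rewrite /bits !inE /= mul2n odd_double.
  apply/eqP => c0; have := E A A; rewrite c0 mul0r /spin_kernel big1.
    by move/eqP; rewrite oner_eq0.
  by move=> p _; rewrite bA.
by exists c^-1 => [|A B]; rewrite ?invr_eq0 // E mulKf.
Qed.
End SpinorOfQuatAction.

(** * Sp(1) and Sp(n) are generated by commutators *)

Section QuatUnits.
Variable R : realType.
Implicit Types x q a b : quat R.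

Definition quat_real (r : R) : quat R := Quat r 0 0 0.
Definition quat_norm2 x : R := qdot x x.

Lemma quat_realM r r' : quat_real r * quat_real r' = quat_real (r * r').
Proof. by apply: quat_eqP => /=; ring. Qed.
Lemma quat_realD : {morph quat_real : r r' / r + r'}.
Proof. by move=> r r'; apply: quat_eqP => //=; rewrite addr0. Qed.
Lemma quat_realC r x : quat_real r * x = x * quat_real r.
Proof. by apply: quat_eqP => /=; ring. Qed.
Lemma quat_real1 : quat_real 1 = 1. Proof. by []. Qed.
Lemma qconj_real r : qconj (quat_real r) = quat_real r.
Proof. by apply: quat_eqP => /=; rewrite ?oppr0. Qed.
Lemma quat_norm2E x : quat_norm2 x = q1 x ^+ 2 + qi x ^+ 2 + qj x ^+ 2 + qk x ^+ 2.
Proof. by rewrite /quat_norm2 /qdot -!expr2. Qed.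
Lemma qconj_mul x : qconj x * x = quat_real (quat_norm2 x).
Proof. by rewrite quat_norm2E; apply: quat_eqP => /=; ring. Qed.
Lemma mul_qconj x : x * qconj x = quat_real (quat_norm2 x).
Proof. by rewrite quat_norm2E; apply: quat_eqP => /=; ring. Qed.
Lemma quat_norm2_ge0 x : 0 <= quat_norm2 x.
Proof. by rewrite quat_norm2E !addr_ge0 ?sqr_ge0. Qed.
Lemma quat_norm2_eq0 x : quat_norm2 x = 0 -> x = 0.
Proof.
rewrite quat_norm2E => /eqP; rewrite !paddr_eq0 ?addr_ge0 ?sqr_ge0 // !sqrf_eq0.
by move=> /andP[/andP[/andP[/eqP e1 /eqP e2] /eqP e3] /eqP e4]; apply: quat_eqP.
Qed.

Lemma quat_unitP x : quat_unit x <-> qconj x * x = 1.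
Proof.
rewrite /quat_unit -quat_norm2E qconj_mul; split=> [->//|]; exact: (congr1 (@q1 R)).
Qed.

Lemma quat_unitV x : quat_unit x -> x * qconj x = 1.
Proof. by rewrite /quat_unit -quat_norm2E mul_qconj => ->. Qed.

Lemma quat_unit_conj x : quat_unit x -> quat_unit (qconj x).
Proof. by rewrite /quat_unit /= !sqrrN. Qed.

Lemma quat_unitM x y : quat_unit x -> quat_unit y -> quat_unit (x * y).
Proof.
move=> /quat_unitP x1 /quat_unitP y1; apply/quat_unitP.
by rewrite qconjM mulrA -[_ * _ * x]mulrA x1 mulr1 y1.
Qed.

(** The root is (1 + q) / |1 + q|, where |1 + q|^2 = 2 + 2 Re q, and i when q = -1. A unit imaginary
    b orthogonal to Im p conjugates p into its inverse. *)
Lemma quat_sqrt q : quat_unit q ->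
  exists p, [/\ quat_unit p, p * p = q & exists2 b, quat_unit b & b * p = qconj p * b].
Proof.
case: q => a b c d; rewrite /quat_unit /= => q1.
have [a1|na1] := eqVneq a (-1).
  have /eqP : b ^+ 2 + c ^+ 2 + d ^+ 2 = 0.
    by apply: (addrI (a ^+ 2)); rewrite addr0 !addrA q1 a1 sqrrN expr1n.
  rewrite !paddr_eq0 ?addr_ge0 ?sqr_ge0 // !sqrf_eq0 => /andP[/andP[/eqP-> /eqP->] /eqP->].
  exists (Qi R); split; first by rewrite /quat_unit /=; ring.
    by rewrite a1; apply: quat_eqP => /=; ring.
  by exists (Qj R); [rewrite /quat_unit /=; ring|apply: quat_eqP => /=; ring].
have s_gt0 : 0 < 2 + 2 * a.
  have : 0 < (a + 1) ^+ 2 by rewrite exprn_even_gt0 //= addr_eq0.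
  have : 0 <= 1 - a ^+ 2.
    have -> : 1 - a ^+ 2 = b ^+ 2 + c ^+ 2 + d ^+ 2 by rewrite -q1; ring.
    by rewrite !addr_ge0 ?sqr_ge0.
  nra.
pose s := Num.sqrt (2 + 2 * a).
have ss : s ^+ 2 = 2 + 2 * a by rewrite sqr_sqrtr // ltW.
have s0 : s != 0 by rewrite gt_eqF // sqrtr_gt0.
exists (Quat ((1 + a) / s) (b / s) (c / s) (d / s)).
have E : (s^-1) ^+ 2 = (2 + 2 * a)^-1 by rewrite exprVn ss.
have n0 : 2 + 2 * a != 0 by rewrite gt_eqF.
have n1 : 1 + a != 0 by rewrite addrC addr_eq0.
split.
- rewrite /quat_unit /= !exprMn E.
  transitivity ((1 + 2 * a + (a ^+ 2 + b ^+ 2 + c ^+ 2 + d ^+ 2)) / (2 + 2 * a)); first by ring.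
  by rewrite q1 addrAC divff.
- apply: quat_eqP => /=.
  + transitivity ((1 + 2 * a + a ^+ 2 + a ^+ 2 - (a ^+ 2 + b ^+ 2 + c ^+ 2 + d ^+ 2)) * s^-1 ^+ 2); first by ring.
    by rewrite q1 E; field.
  + transitivity ((2 + 2 * a) * b * s^-1 ^+ 2); first by ring.
    by rewrite E; field.
  + transitivity ((2 + 2 * a) * c * s^-1 ^+ 2); first by ring.
    by rewrite E; field.
  + transitivity ((2 + 2 * a) * d * s^-1 ^+ 2); first by ring.
    by rewrite E; field.
(* The vector (-c, b, 0) is orthogonal to (b, c, d); when it vanishes, Im p is a multiple of k and i
   serves instead. *)
have [bc0|nbc] := eqVneq (b ^+ 2 + c ^+ 2) 0.
  move/eqP: bc0; rewrite paddr_eq0 ?sqr_ge0 // !sqrf_eq0 => /andP[/eqP-> /eqP->].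
  by exists (Qi R); [rewrite /quat_unit /=; ring|apply: quat_eqP => /=; ring].
pose t := Num.sqrt (b ^+ 2 + c ^+ 2).
have tt : t ^+ 2 = b ^+ 2 + c ^+ 2 by rewrite sqr_sqrtr // addr_ge0 ?sqr_ge0.
have Et : (t^-1) ^+ 2 = (b ^+ 2 + c ^+ 2)^-1 by rewrite exprVn tt.
exists (Quat 0 (- c / t) (b / t) 0).
  by rewrite /quat_unit /= !exprMn Et; field.
by apply: quat_eqP => /=; ring.
Qed.

(** If b p b^-1 = p^-1, then p b p^-1 b^-1 = p^2. *)
Lemma quat_commutator q : quat_unit q ->
  exists a b, [/\ quat_unit a, quat_unit b & q * (b * a) = a * b].
Proof.
move=> /quat_sqrt[p [p1 <- [b b1 bp]]]; exists p, b; split=> //.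
by rewrite bp mulrA -[p * p * _]mulrA quat_unitV // mulr1.
Qed.
End QuatUnits.

Lemma rank1_mulmx (S : nzRingType) n (v : 'cV[S]_n) (w : 'rV_n) (X Y : 'M_1) :
  (1%:M + v *m X *m w) *m (1%:M + v *m Y *m w) =
  1%:M + v *m (Y + (X + X *m (w *m v) *m Y)) *m w.
Proof. by rewrite mulmxDl mul1mx mulmxDr mulmx1 !mulmxDr !mulmxDl !mulmxA !addrA. Qed.

Lemma scalar_mxD (S : nzRingType) n (x y : S) : x%:M + y%:M = (x + y)%:M :> 'M_n.
Proof. by rewrite raddfD. Qed.

(** * Quasi-reflections generate Sp(n) *)

Section QuasiReflections.
Variables (R : realType) (n : nat).
Implicit Types (v : 'cV[quat R]_n) (q : quat R) (B : 'M[quat R]_n).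

Definition vnorm2 v : R := \sum_r quat_norm2 (v r 0).

(** For v nonzero this is the right H-linear map with v |-> v q that fixes the orthogonal complement
    of v. *)
Definition quasi_refl v q : 'M[quat R]_n :=
  1%:M + v *m ((q - 1) * quat_real (vnorm2 v)^-1)%:M *m qct v.

Lemma qct_mul_self v : qct v *m v = (quat_real (vnorm2 v))%:M.
Proof.
apply/matrixP => i j; rewrite !ord1 !mxE eqxx mulr1n.
have -> : quat_real (vnorm2 v) = \sum_r quat_real (quat_norm2 (v r 0)).
  exact: (big_morph _ (@quat_realD R) (erefl _)).
by apply: eq_bigr => r _; rewrite !mxE qconj_mul.
Qed.

Lemma quasi_reflM v q q' : vnorm2 v != 0 ->
  quasi_refl v q *m quasi_refl v q' = quasi_refl v (q * q').
Proof.
move=> nz; rewrite /quasi_refl rank1_mulmx qct_mul_self -!scalar_mxM !scalar_mxD.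
have NV : quat_real (vnorm2 v) * quat_real (vnorm2 v)^-1 = 1 by rewrite quat_realM divff.
move: (quat_real (vnorm2 v)) (quat_real (vnorm2 v)^-1) (quat_realC (vnorm2 v)^-1) NV => N V VC NV.
suff -> : (q' - 1) * V + ((q - 1) * V + (q - 1) * V * N * ((q' - 1) * V)) = (q * q' - 1) * V by [].
have -> : (q - 1) * V * N * ((q' - 1) * V) = (q - 1) * (q' - 1) * V.
  by rewrite -[_ * V * N]mulrA VC NV mulr1 mulrA.
rewrite -!mulrDl; congr (_ * _).
by apply: quat_eqP => /=; ring.
Qed.

Lemma qct_quasi_refl v q : qct (quasi_refl v q) = quasi_refl v (qconj q).
Proof.
have qctD m k (A B : 'M[quat R]_(m, k)) : qct (A + B) = qct A + qct B.
  by apply/matrixP => i j; rewrite !mxE qconjD.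
have qct_scal k x : qct (x%:M : 'M_k) = (qconj x)%:M.
  by apply/matrixP => i j; rewrite !mxE eq_sym; case: eqP => _; rewrite ?mulr1n // !mulr0n qconj0.
have E : (qconj q - 1) * quat_real (vnorm2 v)^-1 = qconj ((q - 1) * quat_real (vnorm2 v)^-1).
  by rewrite qconjM qconj_real quat_realC qconjD qconjN qconj1.
by rewrite /quasi_refl E qctD !qctM qctK !qct_scal qconj1 mulmxA.
Qed.

Lemma quasi_refl1 v : quasi_refl v 1 = 1%:M.
Proof. by rewrite /quasi_refl subrr mul0r raddf0 mulmx0 mul0mx addr0. Qed.

Lemma quasi_refl_Sp v q : vnorm2 v != 0 -> quat_unit q -> in_Sp (quasi_refl v q).
Proof.
move=> v0 /quat_unitP q1; rewrite /in_Sp.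
transitivity (qct (quasi_refl v q) *m quasi_refl v q); first by [].
by rewrite qct_quasi_refl quasi_reflM // q1 quasi_refl1.
Qed.

Lemma in_SpM A B : in_Sp A -> in_Sp B -> in_Sp (A *m B).
Proof.
rewrite /in_Sp => A1 B1; transitivity (qct (A *m B) *m (A *m B)); first by [].
by rewrite qctM -mulmxA [qct A *m _]mulmxA [qct A *m A]A1 mul1mx.
Qed.

Lemma in_Sp_col B i j : in_Sp B -> \sum_r qconj (B r i) * B r j = (i == j)%:R.
Proof.
move=> /matrixP/(_ i j); rewrite [LHS]mxE [RHS]mxE => <-.
by apply: eq_bigr => r _; rewrite /qadj !mxE.
Qed.

Lemma quasi_refl_mul v q (u : 'cV[quat R]_n) r :
  (quasi_refl v q *m u) r 0 =
  u r 0 + v r 0 * ((q - 1) * quat_real (vnorm2 v)^-1) * \sum_l qconj (v l 0) * u l 0.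
Proof.
rewrite /quasi_refl mulmxDl mul1mx -mulmxA [LHS]mxE mxE big_ord1 [X in X * _]mxE big_ord1.
by rewrite mxE eqxx mulr1n [X in _ * X]mxE; congr (_ + _ * _); apply: eq_bigr => l _; rewrite !mxE.
Qed.

Local Notation unitv i := (delta_mx i 0 : 'cV[quat R]_n).

Lemma dot_unitv v i : \sum_l qconj (v l 0) * unitv i l 0 = qconj (v i 0).
Proof.
rewrite (bigD1 i) //= big1 => [|l nl]; first by rewrite mxE !eqxx mulr1 addr0.
by rewrite mxE (negPf nl) mulr0.
Qed.

Lemma quasi_refl_to_col B (m : 'I_n) : in_Sp B ->
  (forall i : 'I_n, (i < m)%N -> col i B = unitv i) ->
  let v := col m B - unitv m in v != 0 ->
  [/\ vnorm2 v != 0, forall (i : 'I_n) q, (i < m)%N -> quasi_refl v q *m unitv i = unitv i &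
      exists2 q, quat_unit q & quasi_refl v q *m unitv m = col m B].
Proof.
move=> SpB fixB v v0.
have vE r : v r 0 = B r m - (r == m)%:R by rewrite !mxE eqxx andbT.
have nz : vnorm2 v != 0.
  apply: contraNneq v0 => /eqP; rewrite psumr_eq0 => [/allP z|r _]; last exact: quat_norm2_ge0.
  apply/eqP/matrixP => r j; rewrite ord1 [RHS]mxE; apply: quat_norm2_eq0.
  by apply/eqP; have := z r; rewrite mem_index_enum; apply.
have dotdelta := dot_unitv v.
split=> // [i q lti|].
  (* Column i of B is e_i, so its orthogonality to column m says that the entry of column m in row i
     vanishes. *)
  have vi : v i 0 = 0.
    rewrite vE; have nim : i != m by rewrite -val_eqE ltn_eqF.
    have := in_Sp_col i m SpB; rewrite (negPf nim) (bigD1 i) //= big1 => [|r nr].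
      have /matrixP/(_ i 0) := fixB i lti; rewrite !mxE !eqxx /= => ->.
      by rewrite qconj1 mul1r addr0 subr0.
    have /matrixP/(_ r 0) := fixB i lti; rewrite !mxE (negPf nr) /= => ->.
    by rewrite qconj0 mul0r.
  by apply/matrixP => r j; rewrite ord1 quasi_refl_mul dotdelta vi qconj0 mulr0 addr0.
have normB : \sum_r quat_norm2 (B r m) = 1.
  have /(congr1 (@q1 R)) := in_Sp_col m m SpB; rewrite eqxx q1_sum /= => <-.
  by apply: eq_bigr => r _; rewrite -[LHS]/(q1 (quat_real _)) -qconj_mul.
have nv : vnorm2 v = - 2 * q1 (v m 0).
  transitivity (\sum_r (quat_norm2 (B r m) + (r == m)%:R * (1 - 2 * q1 (B r m)))).
    apply: eq_bigr => r _; rewrite vE; case: eqP => _; rewrite /= ?mul0r ?subr0 ?addr0 //.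
    by rewrite !quat_norm2E /=; ring.
  rewrite big_split /= normB (bigD1 m) //= big1 => [|r nr]; last by rewrite (negPf nr) mul0r.
  by rewrite eqxx vE eqxx /=; ring.
have vm0 : quat_norm2 (v m 0) != 0.
  apply: contraNneq nz => /quat_norm2_eq0 vm; by rewrite nv vm /= mulr0.
(* This solves (q - 1) conj(v_m) = |v|^2, so that the rank-one term sends e_m to v. It is a unit
   because |v|^2 = -2 Re v_m, an identity which also shows that v_m is not zero. *)
exists (1 + v m 0 * quat_real (vnorm2 v / quat_norm2 (v m 0))).
  have E : q1 (v m 0) = - (vnorm2 v) / 2 by rewrite nv; field.
  rewrite /quat_unit /= E; move: vm0; rewrite quat_norm2E E.
  move: (qi (v m 0)) (qj (v m 0)) (qk (v m 0)) (vnorm2 v) => a b c d h.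
  field; apply: contraNneq h => e; apply/eqP; apply: (mulfI (_ : 4%:R != 0 :> R)); rewrite ?pnatr_eq0 // mulr0 -e; by field.
apply/colP => r; rewrite quasi_refl_mul dotdelta [RHS]mxE.
rewrite addrAC subrr add0r -[v m 0 * _ * _]mulrA quat_realM.
have -> : vnorm2 v / quat_norm2 (v m 0) / vnorm2 v = (quat_norm2 (v m 0))^-1 by field; apply/andP.
rewrite -mulrA -[v m 0 * _ * _]mulrA quat_realC [v m 0 * (_ * _)]mulrA mul_qconj quat_realM divff // quat_real1 mulr1.
by rewrite vE mxE eqxx andbT addrC subrK.
Qed.

(* Induction on the number of fixed basis vectors: a quasi-reflection moves e_m to its
   image and fixes e_i for i < m. *)
Lemma Sp_ind (P : 'M[quat R]_n -> Prop) : P 1%:M ->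
  (forall A B, in_Sp A -> in_Sp B -> P A -> P B -> P (A *m B)) ->
  (forall v q, vnorm2 v != 0 -> quat_unit q -> P (quasi_refl v q)) ->
  forall B, in_Sp B -> P B.
Proof.
move=> P1 PM PR.
suff claim k B : in_Sp B -> (k <= n)%N ->
    (forall i : 'I_n, (i < n - k)%N -> col i B = unitv i) -> P B.
  by move=> B SpB; apply: (claim n) => // i; rewrite subnn.
elim: k B => [|k IH] B SpB lekn fixB.
  rewrite (_ : B = 1%:M) //; apply/matrixP => r i.
  have /matrixP/(_ r 0) : col i B = unitv i by apply: fixB; rewrite subn0.
  by rewrite !mxE eqxx andbT => ->.
have ltm : (n - k.+1 < n)%N by lia.
pose m := Ordinal ltm.
have fixS A : in_Sp A -> (forall i : 'I_n, (i < m)%N -> col i A = unitv i) ->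
    col m A = unitv m -> P A.
  move=> SpA fixA fixm; apply: IH => // [|i lti]; first by lia.
  have [/fixA//|lem] := ltnP i m.
  by rewrite (_ : i = m) //; apply: val_inj; move: lem lti => /=; lia.
have [/eqP|v0] := eqVneq (col m B - unitv m) 0.
  by rewrite subr_eq0 => /eqP; apply: fixS.
have [nz fixR [q q1 Rq]] := @quasi_refl_to_col B m SpB fixB v0.
set v := _ - _ in nz fixR Rq.
have RV : quasi_refl v q *m quasi_refl v (qconj q) = 1%:M.
  by rewrite quasi_reflM // quat_unitV // quasi_refl1.
have RV' : quasi_refl v (qconj q) *m quasi_refl v q = 1%:M.
  by rewrite quasi_reflM // (proj1 (quat_unitP q) q1) quasi_refl1.
have SpR := quasi_refl_Sp nz q1.
have SpR' := quasi_refl_Sp nz (quat_unit_conj q1).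
have -> : B = quasi_refl v q *m (quasi_refl v (qconj q) *m B) by rewrite mulmxA RV mul1mx.
apply: (PM _ _ SpR (in_SpM SpR' SpB) (PR _ _ nz q1)).
apply: fixS; first exact: in_SpM.
  by move=> i lti; rewrite colE -mulmxA -colE fixB // fixR.
by rewrite colE -mulmxA -colE -Rq mulmxA RV' mul1mx.
Qed.
End QuasiReflections.

(** * The coefficients of psi *)

Section PsiCoefficients.
Variables (R : realType) (n : nat).
Local Notation C := R[i].
Implicit Types (p : 'I_n) (A B : {set 'I_(2 * n)}) (T : {set 'I_n}).

Definition paired A := [forall p, (even_idx p \in A) == (odd_idx p \in A)].
Definition supp A : {set 'I_n} := [set p | even_idx p \in A].
Definition pair_set T : {set 'I_(2 * n)} := [set q | pair_of q \in T].

Lemma even_pair_set T p : (even_idx p \in pair_set T) = (p \in T).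
Proof. by rewrite inE pair_of_even. Qed.
Lemma odd_pair_set T p : (odd_idx p \in pair_set T) = (p \in T).
Proof. by rewrite inE pair_of_odd. Qed.
Lemma bits_pair_set T p : bits (pair_set T) p = (p \in T, p \in T).
Proof. by rewrite /bits even_pair_set odd_pair_set. Qed.

Lemma supp_pair_set T : supp (pair_set T) = T.
Proof. by apply/setP => p; rewrite inE even_pair_set. Qed.

Lemma paired_pair_set T : paired (pair_set T).
Proof. by apply/forallP => p; rewrite even_pair_set odd_pair_set. Qed.

Lemma paired_odd A p : paired A -> (odd_idx p \in A) = (even_idx p \in A).
Proof. by move=> /forallP/(_ p)/eqP. Qed.

Lemma pair_set_supp A : paired A -> pair_set (supp A) = A.
Proof.
by move=> pA; apply: bitsP => p; rewrite bits_pair_set inE /bits paired_odd.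
Qed.

Definition drop_pair p A := symdiff [set odd_idx p] (symdiff [set even_idx p] A).

Lemma even_drop_pair p A r : (even_idx r \in drop_pair p A) = (r == p) (+) (even_idx r \in A).
Proof. by rewrite !in_symdiff1 even_odd_idx even_idx_eq. Qed.
Lemma odd_drop_pair p A r : (odd_idx r \in drop_pair p A) = (r == p) (+) (odd_idx r \in A).
Proof. by rewrite !in_symdiff1 odd_even_idx odd_idx_eq. Qed.

Lemma pair_genME p (eta : Sigma R n) A :
  (cl_gen 0 (even_idx p) * (cl_gen 0 (odd_idx p) * eta) : Sigma R n) A =
  ((even_idx p \in A) && (odd_idx p \in A))%:R * eta (drop_pair p A).
Proof.
rewrite !cl_genME koszul_symdiff in_symdiff1 odd_even_idx addFb.
have := koszul_pair R A p true; have := koszul_pair R A p false => /= -> ->.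
rewrite /= ltnSn expr1 /bits /=; case: (even_idx p \in A); last by rewrite !mul0r.
case: (odd_idx p \in A); last by rewrite !mul0r mulr0.
rewrite /= expr1 mulr1 !mul1r mulrA mulN1r mulrN1 opprK.
by rewrite /pair_sign -expr2 sqrr_sign mul1r.
Qed.

Lemma omegaME (eta : Sigma R n) A :
  (omega R n * eta) A = \sum_p ((even_idx p \in A) && (odd_idx p \in A))%:R * eta (drop_pair p A).
Proof.
rewrite mulr_suml sum_ffunE; apply: eq_bigr => p _.
by rewrite -mulrA -pair_genME.
Qed.

(** The products y_(2p) y_(2p+1) commute and have square 0, so a set of j pairs arises in j!
    orders. *)
Lemma omega_expE j A : (omega R n ^+ j) A = (paired A && (#|supp A| == j))%:R * j`!%:R.
Proof.
elim: j A => [|j IH] A.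
  rewrite expr0 ffunE fact0 mulr1; congr (_%:R); congr nat_of_bool.
  apply/eqP/andP => [->|[pA /eqP/cards0_eq s0]].
    split; first by apply/forallP => p; rewrite !inE.
    by rewrite cards_eq0; apply/eqP/setP => p; rewrite !inE.
  by rewrite -(pair_set_supp pA) s0; apply/setP => q; rewrite !inE.
rewrite exprS omegaME; under eq_bigr => p _ do rewrite IH.
have drop_supp p : even_idx p \in A -> supp (drop_pair p A) = supp A :\ p.
  move=> Ap; apply/setP => r; rewrite [LHS]inE even_drop_pair in_setD1 [in RHS]inE.
  by have [->|_] := eqVneq r p; rewrite ?Ap.
have drop_paired p : (even_idx p \in A) && (odd_idx p \in A) -> paired (drop_pair p A) = paired A.
  move=> /andP[Ap1 Ap2]; apply: eq_forallb => r; rewrite even_drop_pair odd_drop_pair.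
  by have [->|//] := eqVneq r p; rewrite Ap1 Ap2.
case: (boolP (paired A)) => pA; rewrite ?andTb ?andFb; last first.
  rewrite mul0r big1 // => p _; case: (boolP (_ && _)) => Ap; last by rewrite mul0r.
  by rewrite drop_paired // (negPf pA) mul0r mulr0.
transitivity (\sum_(p in supp A) (#|supp A| == j.+1)%:R * j`!%:R : C).
  rewrite [RHS]big_mkcond; apply: eq_bigr => p _; rewrite inE paired_odd // andbb.
  case: (boolP (even_idx p \in A)) => Ap; last by rewrite mul0r.
  rewrite mul1r drop_supp // drop_paired ?paired_odd ?Ap // pA andTb.
  by rewrite (cardsD1 p (supp A)) inE Ap add1n eqSS.
rewrite sumr_const; have [->|_] := eqVneq #|supp A| j.+1; last by rewrite !mul0r mul0rn.
by rewrite !mul1r factS mulnC natrM mulr_natr.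
Qed.

Definition ones m (f : {ffun 'I_m -> 'I_2}) : {set 'I_m} := [set t | f t == 1].

Lemma ord2_neq0 (b : 'I_2) : (b != 0) = (b == 1).
Proof. by case: b => [[|[|//]] ?]. Qed.

Lemma bold1E m (f : {ffun 'I_m -> 'I_2}) : bold1 R m f = (#|ones f| == 0)%:R.
Proof.
rewrite ffunE; case: (boolP (#|ones f| == 0)) => [|nz].
  rewrite cards_eq0 => /eqP/setP e; apply: big1 => t _; rewrite mxE.
  by have := e t; rewrite !inE -ord2_neq0 => /negbFE ->.
have [t] : exists t, t \in ones f by apply/set0Pn; rewrite -cards_eq0.
by rewrite inE -ord2_neq0 => /negPf ft; rewrite (bigD1 t) //= mxE ft mul0r.
Qed.

Lemma lie_act_YE m (w : Sigma3_pow R m) (f : {ffun 'I_m -> 'I_2}) :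
  lie_act (rho_Y R) w f = \sum_(t in ones f) w [ffun r => if r == t then 0 else f r].
Proof.
rewrite ffunE rho_YE [RHS]big_mkcond; apply: eq_bigr => t _.
rewrite !big_ord_recl big_ord0 addr0 !mxE /= inE.
case: (f t) => [[|[|//]] ?] /=; rewrite ?mul0r ?mul1r ?addr0 //.
Qed.

(** Each application of Y turns one more factor hat1 into y_1, and k given positions can be filled
    in k! orders. *)
Lemma iter_lie_act_YE m k (f : {ffun 'I_m -> 'I_2}) :
  iter k (lie_act (rho_Y R)) (bold1 R m) f = (#|ones f| == k)%:R * k`!%:R.
Proof.
elim: k f => [|k IH] f; first by rewrite /= bold1E mulr1.
rewrite iterS lie_act_YE.
transitivity (\sum_(t in ones f) (#|ones f| == k.+1)%:R * k`!%:R : C).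
  apply: eq_bigr => t tf; rewrite IH (cardsD1 t (ones f)) tf add1n eqSS.
  congr ((_ == _)%:R * _); apply: eq_card => r; rewrite !inE ffunE.
  by have [_|_] := eqVneq r t.
rewrite sumr_const; have [->|_] := eqVneq #|ones f| k.+1; last by rewrite !mul0r mul0rn.
by rewrite !mul1r factS mulnC natrM mulr_natr.
Qed.

Lemma psiE A (f : {ffun 'I_n -> 'I_2}) :
  psi R n (A, f) = (paired A && (#|supp A| + #|ones f| == n)%N)%:R
    * ((-1) ^+ #|supp A| * (#|supp A|`!%:R * (n - #|supp A|)`!%:R)).
Proof.
rewrite sum_ffunE.
have les : (#|supp A| < n.+1)%N by rewrite ltnS -[X in (_ <= X)%N]card_ord max_card.
rewrite (bigD1 (Ordinal les)) //= big1 ?addr0 => [|j nj].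
  rewrite !ffunE /= omega_expE iter_lie_act_YE eqxx andbT /GRing.scale /=.
  have -> : (#|ones f| == n - #|supp A|)%N = (#|supp A| + #|ones f| == n)%N.
    by apply/eqP/eqP; lia.
  case: (paired A); case: (_ == n)%N; rewrite /= ?mul0r ?mulr0 //; ring.
rewrite !ffunE /= omega_expE (_ : (#|supp A| == j)%N = false) ?andbF ?mul0r; last first.
  by apply: contraNF nj => /eqP e; apply/eqP/val_inj.
by rewrite [_ *: _]mulr0.
Qed.
End PsiCoefficients.

(** * Spinors fixed by two elements of Sp(1) *)

Section Torus.
Variables (R : realType) (n : nat).
Local Notation C := R[i].
Implicit Types (p : 'I_n) (A B : {set 'I_(2 * n)}) (T : {set 'I_n}).

(* (3 + 4i)/5 is not a root of unity, so the weights of the torus element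
   below separate the degrees. *)
Definition zeta : C := (3 / 5) +i* (4 / 5).
Definition zetab : C := (3 / 5) +i* (- (4 / 5)).
Definition quat_i : quat R := Quat (3 / 5) (4 / 5) 0 0.
(** A unit outside the torus of [quat_i]. The entries of its matrix are 3/5 and 4i/5, all nonzero,
    so their powers can be cancelled. *)
Definition quat_j : quat R := Quat (3 / 5) 0 (4 / 5) 0.

Lemma quat_i_unit : quat_unit quat_i.
Proof. by rewrite /quat_unit /=; field. Qed.
Lemma quat_j_unit : quat_unit quat_j.
Proof. by rewrite /quat_unit /=; field. Qed.

Lemma zetaV : zeta * zetab = 1.
Proof. by apply/eqP; rewrite eq_complex /=; apply/andP; split; apply/eqP; field. Qed.

Lemma zeta_exp_neq1 k : (0 < k)%N -> zeta ^+ k != 1.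
Proof.
case: k => // k _.
(* Since (3 + 4i)^2 = -7 + 24i is congruent to 3 + 4i modulo 5, so is every positive power; thus its
   imaginary part is never 0, whereas zeta^k = 1 would make it the real number 5^k. *)
have [m [l E]] : exists m l : int,
    ((3 : R) +i* 4) ^+ k.+1 = ((5 * m + 3)%:~R +i* (5 * l + 4)%:~R).
  elim: k => [|k [m [l IH]]].
    by exists 0, 0; rewrite expr1 !mulr0 !add0r.
  exists (3 * m - 4 * l - 2), (4 * m + 3 * l + 4); rewrite exprS IH.
  apply/eqP; rewrite eq_complex /= !(intrD, intrM, rmorphN); apply/andP; split; apply/eqP; ring.
have E5 : (3 : R) +i* 4 = (5 : R)%:C * zeta.
  by apply/eqP; rewrite eq_complex /=; apply/andP; split; apply/eqP; field.
apply/eqP => z1; move: E; rewrite E5 exprMn z1 mulr1 -rmorphXn => -[_ /esym/eqP].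
rewrite intr_eq0; lia.
Qed.

Lemma prod_delta (I : finType) (S : eqType) (a b : I -> S) (c : I -> C) :
  \prod_i ((a i == b i)%:R * c i) = [forall i, a i == b i]%:R * \prod_i c i.
Proof.
case: (boolP [forall i, a i == b i]) => [/forallP e|].
  by rewrite mul1r; apply: eq_bigr => i _; rewrite e mul1r.
rewrite negb_forall => /existsP[i /negPf ni].
by rewrite (bigD1 i) //= ni !mul0r.
Qed.

Definition deg A : nat := \sum_p ((even_idx p \in A) + (odd_idx p \in A)).

(** A pair has weight zeta, 1 or zeta^-1 according to whether A contains none, one or both of its
    indices. *)
Lemma spin_kernel_torus A B :
  spin_kernel quat_i A B = (A == B)%:R * (zeta ^+ n * zetab ^+ deg A).
Proof.
have E p : local_mx quat_i (bits A p) (bits B p) = (bits A p == bits B p)%:R *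
    (zeta * zetab ^+ ((even_idx p \in A) + (odd_idx p \in A))).
  rewrite /bits; case: (even_idx p \in A); case: (odd_idx p \in A);
    case: (even_idx p \in B); case: (odd_idx p \in B);
    rewrite /local_mx /bit_ord /= ?mul0r ?mxE //= ?mul1r ?mulr1 ?expr1 ?zetaV ?oppr0 //=.
  by rewrite exprS expr1 mulrA zetaV mul1r.
rewrite /spin_kernel (eq_bigr _ (fun p _ => E p)) prod_delta big_split /= prodr_const card_ord.
rewrite prodrXr; congr (_%:R * _); congr nat_of_bool.
apply/forallP/eqP => [e|-> //]; by apply: bitsP => p; apply/eqP.
Qed.

Lemma prod_quat_mx_torus m (f g : {ffun 'I_m -> 'I_2}) :
  \prod_t quat_mx quat_i (f t) (g t) = (f == g)%:R * (zeta ^+ m * zetab ^+ (2 * #|ones f|)).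
Proof.
have E t : quat_mx quat_i (f t) (g t) = (f t == g t)%:R * (zeta * zetab ^+ (2 * (f t == 1))).
  rewrite mxE; case: (f t) => [[|[|//]] ?]; case: (g t) => [[|[|//]] ?];
    rewrite /= ?mul0r ?oppr0 ?mul1r ?mulr1 //.
  by rewrite exprS expr1 mulrA zetaV mul1r.
rewrite (eq_bigr _ (fun t _ => E t)) prod_delta big_split /= prodr_const card_ord.
rewrite prodrXr -big_distrr /=; congr (_%:R * (_ * _ ^+ (_ * _))).
  by congr nat_of_bool; apply/forallP/eqP => [e|-> //]; apply/ffunP => t; apply/eqP.
by rewrite -sum1_card big_mkcond [RHS]big_mkcond; apply: eq_bigr => t _; rewrite inE; case: (f t == 1).
Qed.

Definition spin_act m x (v : twspinor R n m) : twspinor R n m := tens_act (spin_kernel x) (quat_mx x) v.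

Lemma zeta_weight d e : zeta ^+ d * zetab ^+ e = 1 -> d = e.
Proof.
move=> h; apply/eqP; rewrite eqn_leq; apply: contraT; rewrite negb_and -!ltnNge => /orP[] lt.
  have : zeta ^+ (d - e) = 1.
    by rewrite -h -{2}(subnK (ltnW lt)) exprD -mulrA -exprMn zetaV expr1n mulr1.
  by move/eqP; rewrite (negPf (zeta_exp_neq1 _)) // subn_gt0.
have hb : zetab ^+ (e - d) = 1.
  by rewrite -h -{2}(subnK (ltnW lt)) exprD mulrCA -exprMn zetaV expr1n mulr1.
have : zeta ^+ (e - d) = 1 by rewrite -[LHS]mulr1 -hb -exprMn zetaV expr1n.
by move/eqP; rewrite (negPf (zeta_exp_neq1 _)) // subn_gt0.
Qed.

(** The total weight zeta^(n - deg A + m - 2 #ones f) must be 1, and zeta is not a root of unity. *)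
Lemma torus_weight m (v : twspinor R n m) A f : spin_act quat_i v = v -> v (A, f) != 0 ->
  (deg A + 2 * #|ones f| = n + m)%N.
Proof.
move=> /ffunP/(_ (A, f)); rewrite /spin_act tens_actE (bigD1 A) //= [X in _ + X]big1 => [|B nB].
  rewrite (bigD1 f) //= [X in _ + X + _]big1 => [|g ng]; last first.
    by rewrite prod_quat_mx_torus eq_sym (negPf ng) mul0r mulr0 mul0r.
  rewrite spin_kernel_torus prod_quat_mx_torus !eqxx !mul1r !addr0 => E nz.
  apply/esym/zeta_weight/(mulIf nz); rewrite mul1r -[RHS]E !exprD; congr (_ * _).
  by rewrite mulrACA.
by apply: big1 => g _; rewrite spin_kernel_torus eq_sym (negPf nB) !mul0r.
Qed.

Lemma deg_paired A : paired A -> deg A = (2 * #|supp A|)%N.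
Proof.
move=> pA; rewrite /deg -sum1_card big_distrr [RHS]big_mkcond /=; apply: eq_bigr => p _.
by rewrite inE paired_odd //; case: (even_idx p \in A).
Qed.

Lemma swap_card_eq (w : {set 'I_n} -> C) :
  (forall T a b, a \in T -> b \notin T -> w (b |: (T :\ a)) = w T) ->
  forall T T', #|T| = #|T'| -> w T = w T'.
Proof.
move=> sw T T'; have [m] := ubnP #|T :\: T'|; elim: m T => // m IH T ltm eT.
have [sTT'|/subsetPn[a aT naT']] := boolP (T \subset T').
  by congr w; apply/eqP; rewrite eqEcard sTT' eT /=.
have /subsetPn[b bT' nbT] : ~~ (T' \subset T).
  apply: contra naT' => sT'T; have /eqP -> : T' == T by rewrite eqEcard sT'T eT /=.
  exact: aT.
rewrite -(sw T a b aT nbT); apply: IH.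
  have lt : (#|(b |: (T :\ a)) :\: T'| < #|T :\: T'|)%N.
    apply: proper_card; apply/properP; split.
      apply/subsetP => r; rewrite !inE => /andP[nr /orP[/eqP rb|/andP[_ rT]]].
        by rewrite rb bT' in nr.
      by rewrite nr rT.
    exists a; first by rewrite !inE naT' aT.
    rewrite !inE eqxx naT' /= orbF; apply: contra nbT => /eqP <-; exact: aT.
  by apply: leq_trans lt _.
rewrite cardsU1 !inE (negPf nbT) andbF /= -eT (cardsD1 a T) aT.
by [].
Qed.

(** For each f, torus weights fix the number of pairs and symmetry leaves one unknown coefficient.
    Invariance under [quat_j], read at the top form, expresses it through the single number [w0]. *)
Lemma spin_fixed_psi (v : twspinor R n n) :
  (forall A f, v (A, f) != 0 -> paired A) ->
  (forall T a b f, a \in T -> b \notin T ->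
     v (pair_set (b |: (T :\ a)), f) = v (pair_set T, f)) ->
  spin_act quat_i v = v -> spin_act quat_j v = v ->
  exists c : C, v = c *: psi R n.
Proof.
move=> v_paired v_swap vi vj.
have v_card f := swap_card_eq (fun T a b => @v_swap T a b f).
have weight T f : v (pair_set T, f) != 0 -> (#|T| + #|ones f| = n)%N.
  move=> nz; have := torus_weight vi nz; rewrite deg_paired ?paired_pair_set // supp_pair_set; lia.
pose f0 : {ffun 'I_n -> 'I_2} := [ffun=> 0].
pose w0 := v (pair_set setT, f0).
have top f : v (pair_set setT, f) = (f == f0)%:R * w0.
  have [->|nf] := eqVneq f f0; first by rewrite mul1r.
  rewrite mul0r; apply/eqP; apply: contraNT nf => /weight; rewrite cardsT card_ord => e.
  have /eqP : #|ones f| = 0%N by lia.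
  rewrite cards_eq0 => /eqP/setP o; apply/eqP/ffunP => t; rewrite ffunE.
  by have := o t; rewrite !inE -ord2_neq0 => /negbFE/eqP.
have conj1 : quat_mx (qconj quat_j) *m quat_mx quat_j = 1%:M.
  rewrite /quat_mx mx2M mx21 /=; congr mx2; apply/eqP; rewrite eq_complex /=;
    apply/andP; split; apply/eqP; by field.
pose c := (3 / 5)%:C : C; pose s := (0 +i* (4 / 5)) : C.
have cardI (S : {set 'I_n}) : #|[predC S]| = (n - #|S|)%N.
  by rewrite -[X in (X - _)%N]card_ord -(cardC (mem S)) addKn.
(* Invariance is rewritten so that [quat_j] acting on forms alone equals its inverse acting on the
   tensor factors alone. At the top form the second side involves only [w0], by [top]. *)
have row h : \sum_(T : {set 'I_n}) c ^+ #|T| * s ^+ (n - #|T|) * v (pair_set T, h) =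
    w0 * (c ^+ (n - #|ones h|) * (- s) ^+ #|ones h|).
  have prodC (h' : {ffun 'I_n -> 'I_2}) (a b : C) :
      \prod_t (if h' t == 1 then a else b) = b ^+ (n - #|ones h'|) * a ^+ #|ones h'|.
    rewrite (bigID (mem (ones h'))) /= mulrC; congr (_ * _).
      rewrite (eq_bigr (fun=> b)) => [|t]; last by rewrite inE => /negPf->.
      by rewrite prodr_const -cardI.
    rewrite (eq_bigr (fun=> a)) => [|t]; last by rewrite inE => ->.
    by rewrite prodr_const.
  transitivity (\sum_(f : {ffun 'I_n -> 'I_2}) (\prod_t quat_mx (qconj quat_j) (h t) (f t))
      * spin_act quat_j v (pair_set setT, f)); last first.
    rewrite vj (bigD1 f0) //= [X in _ + X]big1 => [|f nf]; last by rewrite top (negPf nf) mul0r mulr0.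
    rewrite top eqxx mul1r addr0 mulrC; congr (_ * _); rewrite -prodC; apply: eq_bigr => t _.
    rewrite mxE ffunE; case: (h t) => [[|[|//]] ?] /=; apply/eqP; rewrite eq_complex /=;
      apply/andP; split; apply/eqP; by field.
  transitivity (\sum_B spin_kernel quat_j (pair_set setT) B * v (B, h)).
    rewrite [RHS](bigID (@paired n)) /= [X in _ + X]big1 ?addr0 => [|B nB]; last first.
      suff -> : v (B, h) = 0 by rewrite mulr0.
      by apply/eqP; apply: contraNT nB; apply: v_paired.
    rewrite [RHS](reindex_onto (@pair_set n) (@supp n)) => [|B pB]; last exact: pair_set_supp.
    rewrite [RHS](eq_bigl xpredT) => [|T]; last by rewrite paired_pair_set supp_pair_set eqxx.
    apply: eq_bigr => T _; congr (_ * _).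
    rewrite /spin_kernel (bigID (mem T)) /=; congr (_ * _).
      rewrite (eq_bigr (fun=> c)) => [|p pT]; first by rewrite prodr_const.
      by rewrite !bits_pair_set in_setT pT /local_mx mxE /= oppr0.
    rewrite (eq_bigr (fun=> s)) => [|p /negPf pT].
      by rewrite prodr_const -cardI.
    by rewrite !bits_pair_set in_setT pT /local_mx mxE.
  transitivity (\sum_B \sum_(g : {ffun 'I_n -> 'I_2}) (\sum_(f : {ffun 'I_n -> 'I_2})
      (\prod_t quat_mx (qconj quat_j) (h t) (f t)) * \prod_t quat_mx quat_j (f t) (g t))
      * (spin_kernel quat_j (pair_set setT) B * v (B, g))).
    apply: eq_bigr => B _; under eq_bigr => g _ do rewrite -prod_mulmx conj1 prod_scalar_mx expr1n mul1r.
    rewrite (bigD1 h) //= [X in _ + X]big1 => [|g ng]; last by rewrite eq_sym (negPf ng) mul0r.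
    by rewrite eqxx mul1r addr0.
  rewrite /spin_act; under [RHS]eq_bigr => f _ do rewrite tens_actE mulr_sumr.
  rewrite [RHS]exchange_big; apply: eq_bigr => B _ /=.
  under [RHS]eq_bigr => f _ do rewrite mulr_sumr.
  rewrite [RHS]exchange_big; apply: eq_bigr => g _ /=.
  by rewrite mulr_suml; apply: eq_bigr => f _; ring.
have [q3 q4] : (3 / 5 != 0 :> R) /\ (4 / 5 != 0 :> R) by rewrite !mulf_neq0 ?invr_eq0 ?pnatr_eq0.
have c0 : c != 0 by rewrite eq_complex /= negb_and q3.
have s0 : s != 0 by rewrite eq_complex /= negb_and q4 orbT.
exists (w0 * (-1) ^+ n / n`!%:R); apply/ffunP => -[A f]; rewrite [RHS]ffunE psiE.
case: (boolP (paired A)) => pA; last first.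
  rewrite mul0r [_ *: _]mulr0; apply/eqP; apply: contraNT pA; exact: v_paired.
rewrite -(pair_set_supp pA) supp_pair_set; move: (supp A) => T.
have [e|ne] := eqVneq (#|T| + #|ones f|)%N n; last first.
  rewrite mul0r [_ *: _]mulr0; apply/eqP; apply: contraNT ne => /weight->; exact: eqxx.
have leT : (#|T| <= n)%N by lia.
have := row f; have -> : #|ones f| = (n - #|T|)%N by lia.
rewrite (bigID (fun S : {set 'I_n} => #|S| == #|T|)) /= [X in _ + X]big1 ?addr0 => [|S nS]; last first.
  suff -> : v (pair_set S, f) = 0 by rewrite mulr0.
  by apply/eqP; apply: contraNT nS => /weight; rewrite -[in RHS]e => /eqP; rewrite eqn_add2r.
rewrite (eq_bigr (fun=> c ^+ #|T| * s ^+ (n - #|T|) * v (pair_set T, f))) => [|S /eqP eS]; last first.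
  by rewrite (v_card f _ _ eS) eS.
rewrite sumr_const; set N := (X in _ *+ X).
have {N}-> : N = 'C(n, #|T|).
  by have := card_draws 'I_n #|T|; rewrite card_ord => <-; apply: eq_card => S; rewrite !inE.
rewrite subKn // => E.
have fn0 k : k`!%:R != 0 :> C by rewrite pnatr_eq0 -lt0n fact_gt0.
have cs0 : c ^+ #|T| * s ^+ (n - #|T|) != 0 by rewrite mulf_neq0 // expf_neq0.
(* Only the sets of size #|T| contribute, all with the same value, whence the binomial coefficient;
   it is n! divided by the factorials in the coefficient of psi. *)
have E' : 'C(n, #|T|)%:R * v (pair_set T, f) = w0 * (-1) ^+ (n - #|T|).
  by apply: (mulfI cs0); rewrite mulrCA mulr_natl E [(- s) ^+ _]exprNn; ring.
have bf : n`!%:R = 'C(n, #|T|)%:R * (#|T|`!%:R * (n - #|T|)`!%:R) :> C.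
  by rewrite -!natrM bin_fact.
have sgn : (-1) ^+ n * (-1) ^+ #|T| = (-1) ^+ (n - #|T|) :> C.
  by rewrite -{1}(subnK leT) exprD -mulrA -expr2 sqrr_sign mulr1.
rewrite /GRing.scale /= mul1r.
apply: (mulfI (fn0 n)); rewrite {1}bf.
transitivity ('C(n, #|T|)%:R * v (pair_set T, f) * (#|T|`!%:R * (n - #|T|)`!%:R)); first by ring.
rewrite E' -sgn; move: (fn0 n); move: (n`!%:R) => F F0.
by field.
Qed.
End Torus.

(** * The symmetrized invariant and its identification with psi *)

Section PsiFixed.
Variables (R : realType) (n : nat).
Local Notation C := R[i].
Implicit Types (p : 'I_n) (A B : {set 'I_(2 * n)}) (T : {set 'I_n}) (x : quat R).

(* The coefficients of the invariant 1 (x) y - omega (x) 1 of C^2 (x) C^2. *)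
Definition eps (s : bool * bool) (b : 'I_2) : C :=
  if s.1 == s.2 then (if s.1 then - (b == 0)%:R else (b == 1)%:R) else 0.

Lemma eps_fixed x s b : quat_unit x ->
  \sum_s' \sum_b' local_mx x s s' * quat_mx x b b' * eps s' b' = eps s b.
Proof.
move=> x1; have {}x1 : q1 x ^+ 2 = 1 - (qi x ^+ 2 + qj x ^+ 2 + qk x ^+ 2) by rewrite -x1; ring.
have -> E : \sum_(s' : bool * bool) E s' = E (true, true) + E (true, false) + E (false, true) + E (false, false) :> C.
  rewrite (bigD1 (true, true)) //= (bigD1 (true, false)) //= (bigD1 (false, true)) //=.
  by rewrite (bigD1 (false, false)) //= big1 ?addr0 ?addrA // => -[[] []].
rewrite !big_ord_recl !big_ord0 /eps /local_mx /= !mulr0 !add0r !addr0.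
case: s => [[] []]; case: b => [[|[|//]] ?]; rewrite /= ?mxE /=;
  apply/eqP; rewrite eq_complex /=; apply/andP; split; apply/eqP; by ring: x1.
Qed.

Definition sym_psi : twspinor R n n :=
  [ffun Af : {set 'I_(2 * n)} * {ffun 'I_n -> 'I_2} =>
     \sum_(pi : 'S_n) \prod_p eps (bits Af.1 p) (Af.2 (pi p))].

Lemma sum_bits (E : {ffun 'I_n -> bool * bool} -> C) :
  \sum_A E [ffun p => bits A p] = \sum_F E F.
Proof.
pose inv (F : {ffun 'I_n -> bool * bool}) : {set 'I_(2 * n)} :=
  [set q : 'I_(2 * n) | if odd q then (F (pair_of q)).2 else (F (pair_of q)).1].
rewrite [RHS](reindex (fun A => [ffun p => bits A p])) //; exists inv => [A _|F _].
  apply: bitsP => p; rewrite /bits /inv !inE /= mul2n odd_double /=.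
  by rewrite !pair_of_even !pair_of_odd !ffunE.
apply/ffunP => p; rewrite ffunE /bits /inv !inE /= mul2n odd_double /=.
by rewrite pair_of_even pair_of_odd; case: (F p).
Qed.

Lemma sym_psi_fixed x : quat_unit x -> spin_act x sym_psi = sym_psi.
Proof.
move=> x1; apply/ffunP => -[A f]; rewrite [RHS]ffunE /spin_act tens_actE.
transitivity (\sum_(pi : 'S_n) \sum_B \sum_(g : {ffun 'I_n -> 'I_2})
    \prod_p (local_mx x (bits A p) (bits B p) * quat_mx x (f (pi p)) (g (pi p)) * eps (bits B p) (g (pi p)))).
  rewrite [RHS]exchange_big; apply: eq_bigr => B _ /=; rewrite [RHS]exchange_big; apply: eq_bigr => g _ /=.
  rewrite ffunE mulr_sumr; apply: eq_bigr => pi _ /=.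
  rewrite !big_split /=; congr (_ * _ * _).
  by rewrite (reindex_inj (@perm_inj _ pi)).
apply: eq_bigr => pi _ /=.
pose E p s b := local_mx x (bits A p) s * quat_mx x (f (pi p)) b * eps s b.
transitivity (\sum_(F : {ffun 'I_n -> bool * bool}) \sum_(G : {ffun 'I_n -> 'I_2}) \prod_p E p (F p) (G p)).
  rewrite -sum_bits; apply: eq_bigr => B _.
  (* Relabelling the tensor positions by pi pairs position pi p with the quaternionic line p, after
     which both sums distribute over the product. *)
  rewrite [LHS](reindex (fun G : {ffun 'I_n -> 'I_2} => [ffun t => G (pi^-1%g t)])) /=.
    apply: eq_bigr => G _; apply: eq_bigr => p _.
    by rewrite /E !ffunE permK.
  exists (fun G : {ffun 'I_n -> 'I_2} => [ffun t => G (pi t)]) => G _; apply/ffunP => t; rewrite !ffunE ?permK ?permKV //.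
transitivity (\sum_(F : {ffun 'I_n -> bool * bool}) \prod_p \sum_b E p (F p) b).
  by apply: eq_bigr => F _; rewrite bigA_distr_bigA.
rewrite -(bigA_distr_bigA (fun p s => \sum_b E p s b)).
by apply: eq_bigr => p _; apply: eps_fixed.
Qed.

Lemma sym_psi_swap T a b f : a \in T -> b \notin T ->
  sym_psi (pair_set (b |: (T :\ a)), f) = sym_psi (pair_set T, f).
Proof.
move=> aT bT; rewrite !ffunE /= (reindex_inj (mulgI (tperm a b))) /=.
apply: eq_bigr => pi _; rewrite (reindex_inj (@perm_inj _ (tperm a b))); apply: eq_bigr => p _.
rewrite permM tpermK !bits_pair_set; congr eps.
have -> : (tperm a b p \in b |: T :\ a) = (p \in T); last by [].
rewrite !inE; case: tpermP => [->|->|/eqP na /eqP nb]; first by rewrite eqxx aT.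
- by rewrite eqxx /= orbF (negPf bT); apply/eqP => e; rewrite e (negPf bT) in aT.
- by rewrite (negPf nb) na.
Qed.

Lemma sym_psi_paired A f : sym_psi (A, f) != 0 -> paired A.
Proof.
apply: contraNT; rewrite negb_forall => /existsP[p np]; rewrite ffunE big1 // => pi _.
by rewrite (bigD1 p) //= /eps /bits /= (negPf np) mul0r.
Qed.

Lemma sym_psi_neq0 : sym_psi (pair_set setT, [ffun=> 0]) != 0.
Proof.
rewrite ffunE (eq_bigr (fun=> (-1) ^+ n)) => [|pi _].
  rewrite sumr_const -mulr_natr mulf_neq0 ?signr_eq0 // pnatr_eq0 -lt0n.
  by apply/card_gt0P; exists 1%g.
rewrite /= (eq_bigr (fun=> -1)) ?prodr_const ?card_ord // => p _.
by rewrite bits_pair_set in_setT ffunE.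
Qed.

(** The uniqueness statement [spin_fixed_psi] applies to [sym_psi] and makes it a nonzero multiple
    of psi, so psi inherits its invariance. *)
Lemma spin_act_psi x : quat_unit x -> spin_act x (psi R n) = psi R n.
Proof.
move=> x1.
have [c Ec] := spin_fixed_psi sym_psi_paired sym_psi_swap
  (sym_psi_fixed (quat_i_unit R)) (sym_psi_fixed (quat_j_unit R)).
have c0 : c != 0.
  apply: contraNneq sym_psi_neq0 => c0; rewrite Ec ffunE c0.
  by apply/eqP; exact: mul0r.
have E : psi R n = c^-1 *: sym_psi by rewrite Ec scalerA mulVf // scale1r.
apply/ffunP => -[A f]; transitivity (c^-1 * spin_act x sym_psi (A, f)); last first.
  by rewrite (sym_psi_fixed x1) E [in RHS]/GRing.scale /= [RHS]ffunE.
rewrite E /spin_act !tens_actE mulr_sumr; apply: eq_bigr => B _.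
rewrite mulr_sumr; apply: eq_bigr => g _.
by rewrite [X in _ * X = _]ffunE [_ *: _]/(_ * _) mulrCA.
Qed.
End PsiFixed.

(** * Invariance of psi *)

Section Lift.
Variables (R : realType) (n : nat) (phi : Hpair R n -> Cl R (4 * n) * Cl R 3).
Hypotheses (n_odd : odd n) (phi_lift : is_lift phi).
Local Notation C := R[i].
Implicit Types (x : quat R) (B : 'M[quat R]_n) (v : twspinor R n n).

Definition lift_act h v : twspinor R n n := twspinor_act (phi h) v.

Lemma in_Sp1 : in_Sp (1%:M : 'M[quat R]_n).
Proof.
rewrite /in_Sp mulmx1; apply/matrixP => i j; rewrite !mxE eq_sym.
by case: eqP => _; rewrite ?mulr1n ?mulr0n ?qconj0 ?qconj1.
Qed.

Lemma in_H_quat x : quat_unit x -> in_H (x, 1%:M : 'M[quat R]_n).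
Proof. by move=> /quat_unitP x1; split=> //; apply: in_Sp1. Qed.

Lemma in_H_Sp B : in_Sp B -> in_H (1, B).
Proof. by split=> //=; rewrite qconj1 mulr1. Qed.

Lemma lift_actM h h' v : in_H h -> in_H h' ->
  lift_act (H_mul h h') v = lift_act h (lift_act h' v).
Proof.
case: phi_lift => _ phiM _ _ Hh Hh'; rewrite /lift_act -twspinor_actM.
case: (phiM _ _ Hh Hh') => ->; [reflexivity|exact: esym (twspinor_act_opp _ _ n_odd)].
Qed.

Lemma lift_actZ h a v : lift_act h (a *: v) = a *: lift_act h v.
Proof. exact: twspinor_actZ. Qed.

Lemma lift_lifts h : in_H h -> lifts_rotation (phi h).1 /\ lifts_rotation (phi h).2.
Proof. by case: phi_lift => phiS _ _ _ /phiS[? ?]; split; apply: in_Spin_lifts. Qed.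

(** Reversing both components gives the inverse operator. This is what makes the character on the
    line of psi nonzero. *)
Lemma lift_act_inj h v : in_H h -> lift_act h v = 0 -> v = 0.
Proof.
move=> /lift_lifts[[u1 _ _] [w1 _ _]] h0.
have : twspinor_act (cl_rev (phi h).1, cl_rev (phi h).2) (lift_act h v) = v.
  rewrite /lift_act -twspinor_actM twspinor_actE /= u1 w1 Sigma3_mx1.
  apply/ffunP => -[A f]; rewrite tens_actE (bigD1 A) //= [X in _ + X]big1 => [|D nD]; last first.
    by apply: big1 => g _; rewrite Sigma_ker1 eq_sym (negPf nD) !mul0r.
  rewrite (bigD1 f) //= [X in _ + X + _]big1 => [|g ng]; last first.
    by rewrite prod_scalar_mx eq_sym (negPf ng) !(mulr0, mul0r).
  by rewrite Sigma_ker1 prod_scalar_mx !eqxx expr1n !mul1r !addr0.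
move=> <-; rewrite h0.
by have := twspinor_actZ (cl_rev (phi h).1, cl_rev (phi h).2) 0 (0 : twspinor R n n); rewrite !scale0r.
Qed.

Lemma psi_neq0 : psi R n != 0.
Proof.
apply/eqP => /ffunP/(_ (pair_set setT, [ffun=> 0])); rewrite psiE [RHS]ffunE.
have -> : #|ones ([ffun=> 0] : {ffun 'I_n -> 'I_2})| = 0%N.
  by apply/eqP; rewrite cards_eq0; apply/eqP/setP => t; rewrite !inE ffunE.
rewrite paired_pair_set supp_pair_set cardsT card_ord addn0 eqxx mul1r subnn fact0 mulr1.
by move/eqP; rewrite mulf_eq0 signr_eq0 pnatr_eq0 -leqn0 leqNgt fact_gt0.
Qed.

Lemma quat_mx1 : quat_mx (1 : quat R) = 1%:M.
Proof. by rewrite mx21; congr mx2; apply/eqP; rewrite eq_complex /= ?oppr0 !eqxx. Qed.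

Lemma lift_Sigma3 h : in_H h -> quat_unit h.1 ->
  exists2 c : C, c != 0 & Sigma3_mx (phi h).2 = c *: quat_mx h.1.
Proof.
move=> Hh x1; have [_ lw] := lift_lifts Hh; case: phi_lift => _ _ _ /(_ h Hh) cov.
rewrite -Sigma3_mx_quat; apply: Sigma3_mx_unique => //; exact: spin_of_quat_lifts.
Qed.

Lemma lift_act_quat x : quat_unit x ->
  exists2 c : C, c != 0 & forall v, lift_act (x, 1%:M) v = c *: spin_act x v.
Proof.
move=> x1; have Hx := in_H_quat x1; have [lu _] := lift_lifts Hx.
have [c3 c30 E3] := lift_Sigma3 Hx x1.
case: phi_lift => _ _ /(_ _ Hx) cov _.
have [c c0 Ec] := Sigma_ker_quat x1 lu cov.
exists (c * c3 ^+ n) => [|v]; first by rewrite mulf_neq0 ?expf_neq0.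
rewrite /lift_act twspinor_actE (eq_tens_act (K' := fun A D => c * spin_kernel x A D) _ _ E3) //.
by rewrite tens_act_scale; apply/ffunP => Af; rewrite !ffunE.
Qed.

(** The rotation [varphi1 (1, B)] is trivial, so the second component acts on Sigma_3 by a scalar
    and only a kernel on forms remains. *)
Lemma lift_act_Sp B : in_Sp B -> exists2 a : C, a != 0 & forall v A f,
  lift_act (1, B) v (A, f) = \sum_D (a * Sigma_ker (phi (1, B)).1 A D) * v (D, f).
Proof.
move=> SpB; have HB := in_H_Sp SpB.
have u1 : quat_unit (1 : quat R) by apply/quat_unitP; rewrite qconj1 mulr1.
have [c3 c30] := lift_Sigma3 HB u1; rewrite quat_mx1 => E3.
exists (c3 ^+ n) => [|v A f]; first exact: expf_neq0.
rewrite /lift_act twspinor_actE E3 scalemx1 tens_actE; apply: eq_bigr => D _.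
rewrite (bigD1 f) //= [X in _ + X]big1 => [|g ng].
  by rewrite prod_scalar_mx eqxx mulr1 addr0 [_ * Sigma_ker _ _ _]mulrC.
by rewrite prod_scalar_mx eq_sym (negPf ng) !mulr0 mul0r.
Qed.

(** The lift of (x, 1) also acts on the tensor factors. Testing on a basis vector over [f0] and
    reading the component at [f0] leaves the relation on forms times c and a power of the (0,0)
    entry, which is cancelled. *)
Lemma Sp_kernel_commute B K x : in_Sp B -> quat_unit x -> quat_mx x 0 0 != 0 ->
  (forall v A f, lift_act (1, B) v (A, f) = \sum_D K A D * v (D, f)) ->
  forall A D, \sum_E spin_kernel x A E * K E D = \sum_E K A E * spin_kernel x E D.
Proof.
move=> SpB x1 x0 EK A D; have HB := in_H_Sp SpB; have Hx := in_H_quat x1.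
have [c c0 Ec] := lift_act_quat x1.
have [f0 f0E] : exists f0 : {ffun 'I_n -> 'I_2}, forall t, f0 t = 0.
  by exists [ffun=> 0] => t; rewrite ffunE.
pose d : twspinor R n n := [ffun Af => (Af == (D, f0))%:R].
have comm : lift_act (x, 1%:M) (lift_act (1, B) d) = lift_act (1, B) (lift_act (x, 1%:M) d).
  have e : H_mul (x, 1%:M) (1, B) = H_mul (1, B) (x, 1%:M).
    by rewrite /H_mul /= mulr1 mul1r mul1mx mulmx1.
  exact: etrans (esym (lift_actM d Hx HB))
    (etrans (congr1 (fun h => lift_act h d) e) (lift_actM d HB Hx)).
have dE S g : d (S, g) = (S == D)%:R * (g == f0)%:R by rewrite ffunE xpair_eqE -mulnb natrM.
clearbody d.
have sumd g (F : {set 'I_(2 * n)} -> C) : \sum_S F S * d (S, g) = F D * (g == f0)%:R.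
  rewrite (bigD1 D isT) [X in _ + X = _]big1 => [|S nS]; first by rewrite dE eqxx mul1r addr0.
  by rewrite dE (negPf nS) mul0r mulr0.
have rho0 : \prod_t quat_mx x (f0 t) (f0 t) = quat_mx x 0 0 ^+ n.
  rewrite -[in RHS](card_ord n) -prodr_const; by apply: eq_bigr => t _; rewrite f0E.
have spinE (w : twspinor R n n) a S : (forall S' g, w (S', g) = a S' * (g == f0)%:R) ->
    lift_act (x, 1%:M) w (S, f0) = c * quat_mx x 0 0 ^+ n * \sum_S' spin_kernel x S S' * a S'.
  move=> Ew; rewrite Ec ffunE /spin_act tens_actE -mulrA; congr (_ * _).
  rewrite mulr_sumr; apply: eq_bigr => S' _.
  rewrite (bigD1 f0 isT) [X in _ + X = _]big1 => [|g ng]; last by rewrite Ew (negPf ng) !mulr0.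
  by rewrite Ew eqxx rho0 mulr1 addr0 mulrCA mulrA.
have e1 := congr1 (fun w : twspinor R n n => w (A, f0)) comm.
have e0 := spinE (lift_act (1, B) d) (fun S => K S D) A
  (fun S' g => etrans (EK _ _ _) (sumd g (K S'))).
have e2 : lift_act (1, B) (lift_act (x, 1%:M) d) (A, f0) =
    c * quat_mx x 0 0 ^+ n * \sum_E K A E * spin_kernel x E D.
  rewrite EK mulr_sumr; apply: eq_bigr => S _; rewrite (spinE _ _ _ dE).
  suff -> : \sum_S' spin_kernel x S S' * (S' == D)%:R = spin_kernel x S D by rewrite mulrCA.
  rewrite (bigD1 D isT) [X in _ + X = _]big1 => [|S' nS]; last by rewrite (negPf nS) mulr0.
  by rewrite eqxx mulr1 addr0.
have cr : c * quat_mx x 0 0 ^+ n != 0 := mulf_neq0 c0 (expf_neq0 n x0).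
exact: (mulfI cr (etrans (esym e0) (etrans e1 e2))).
Qed.
End Lift.

(** * The character on the line of psi is trivial *)

Section LiftFixesPsi.
Variables (R : realType) (n : nat) (phi : Hpair R n -> Cl R (4 * n) * Cl R 3).
Hypotheses (n_odd : odd n) (phi_lift : is_lift phi).
Local Notation C := R[i].
Implicit Types (x : quat R) (B : 'M[quat R]_n) (v : twspinor R n n) (A D E : {set 'I_(2 * n)}).

Lemma spin_kernel_col0 x A : spin_kernel x A set0 =
  (paired A)%:R * (quat_mx x 0 0 ^+ (n - #|supp A|) * quat_mx x 1 0 ^+ #|supp A|).
Proof.
have b0 p : bits (set0 : {set 'I_(2 * n)}) p = (false, false) by rewrite /bits !inE.
case: (boolP (paired A)) => [pA|]; last first.
  rewrite negb_forall => /existsP[p np]; rewrite mul0r /spin_kernel (bigD1 p) //=.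
  rewrite b0 /local_mx /bits; move: np.
  by case: (even_idx p \in A); case: (odd_idx p \in A) => //= _; rewrite mul0r.
rewrite mul1r -{1}(pair_set_supp pA); move: (supp A) => T.
rewrite /spin_kernel (bigID (mem T)) /= mulrC; congr (_ * _).
  have cT : #|[predC T]| = (n - #|T|)%N.
    by rewrite -[X in (X - _)%N]card_ord -(cardC (mem T)) addKn.
  rewrite -cT -prodr_const; apply: eq_bigr => p /negPf pT.
  by rewrite b0 bits_pair_set pT.
rewrite -prodr_const; apply: eq_bigr => p pT.
by rewrite b0 bits_pair_set pT.
Qed.

(** Both sides depend on a paired set only through its number of pairs, and the indicator keeps one
    such number; the nonzero entries of [quat_j] allow the constant to be adjusted. *)
Lemma psi_spin_kernel (f : {ffun 'I_n -> 'I_2}) : exists c : C, forall A,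
  psi R n (A, f) = (deg A == (2 * (n - #|ones f|))%N)%:R * (c * spin_kernel (quat_j R) A set0).
Proof.
pose k := (n - #|ones f|)%N.
pose a := quat_mx (quat_j R) 0 0 ^+ (n - k) * quat_mx (quat_j R) 1 0 ^+ k.
have [q3 q4] : (3 / 5 != 0 :> R) /\ (4 / 5 != 0 :> R) by rewrite !mulf_neq0 ?invr_eq0 ?pnatr_eq0.
have a0 : a != 0.
  by rewrite /a /quat_mx !mxE /= mulf_neq0 // expf_neq0 // eq_complex /= negb_and ?q3 ?q4 ?orbT.
have lef : (#|ones f| <= n)%N by rewrite -[X in (_ <= X)%N]card_ord max_card.
exists ((-1) ^+ k * (k`!%:R * (n - k)`!%:R) / a) => A.
rewrite psiE spin_kernel_col0; case: (boolP (paired A)) => pA; last by rewrite !mul0r !mulr0.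
rewrite deg_paired // eqn_mul2l /= !mul1r -/k.
have -> : (#|supp A| + #|ones f| == n)%N = (#|supp A| == k) by apply/eqP/eqP; rewrite /k; lia.
have [->|_] := eqVneq #|supp A| k; last by rewrite !mul0r.
by rewrite !mul1r -/a divfK.
Qed.

Lemma zetab_inj d e : zetab R ^+ d = zetab R ^+ e -> d = e.
Proof.
move=> E; apply: (@zeta_weight R); rewrite -E -exprMn.
by rewrite zetaV expr1n.
Qed.

Lemma deg_eq0 A : (deg A == 0)%N = (A == set0).
Proof.
apply/idP/eqP => [|->]; last by rewrite /deg big1 // => p _; rewrite !inE.
rewrite /deg sum_nat_eq0 => /forallP z; apply: bitsP => p; rewrite /bits !inE.
by have := z p; rewrite addn_eq0 !eqb0 => /andP[/negPf-> /negPf->].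
Qed.

Lemma Sp_kernel_psi B (K : {set 'I_(2 * n)} -> {set 'I_(2 * n)} -> C) : in_Sp B ->
  (forall v A f, lift_act phi (1, B) v (A, f) = \sum_D K A D * v (D, f)) ->
  (forall A, K A set0 = K set0 set0 * (A == set0)%:R) /\
  lift_act phi (1, B) (psi R n) = K set0 set0 *: psi R n.
Proof.
move=> SpB EK.
have zn0 k : zeta R ^+ k != 0.
  by apply/eqP => z0; have := zetaV R => /(congr1 (fun z => z ^+ k)) /eqP; rewrite exprMn z0 mul0r expr1n eq_sym oner_eq0.
have rho_i : quat_mx (quat_i R) 0 0 != 0 by have := zn0 1%N; rewrite expr1 mxE.
have rho_j : quat_mx (quat_j R) 0 0 != 0.
  by rewrite mxE eq_complex /= negb_and mulf_neq0 ?invr_eq0 ?pnatr_eq0.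
(* Commuting with the torus equates the weights of A and D whenever [K A D] is nonzero. *)
have Kdeg A D : K A D != 0 -> deg A = deg D.
  move=> nz; have := Sp_kernel_commute n_odd phi_lift SpB (quat_i_unit R) rho_i EK A D.
  rewrite (bigD1 A isT) [X in _ + X = _]big1 => [|S nS]; last first.
    by rewrite spin_kernel_torus eq_sym (negPf nS) !mul0r.
  rewrite (bigD1 D isT) [X in _ = _ + X]big1 => [|S nS]; last first.
    by rewrite spin_kernel_torus (negPf nS) mul0r mulr0.
  rewrite !spin_kernel_torus !eqxx !mul1r !addr0 mulrC => /(mulfI nz)/(mulfI (zn0 n)).
  exact: zetab_inj.
have K0 A : K A set0 = K set0 set0 * (A == set0)%:R.
  have [->|nA] := eqVneq A set0; first by rewrite mulr1.
  rewrite mulr0; apply/eqP; apply: contraNT nA => /Kdeg E.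
  by rewrite -deg_eq0 E deg_eq0.
split=> //; apply/ffunP => -[A f]; rewrite EK [RHS]ffunE.
have [c Ec] := psi_spin_kernel f.
have := Sp_kernel_commute n_odd phi_lift SpB (quat_j_unit R) rho_j EK A set0.
rewrite (bigD1 set0 isT) [X in _ + X = _]big1 => [|S nS]; last by rewrite K0 (negPf nS) !mulr0.
rewrite addr0 => EA.
(* As K preserves the degree, the condition on D can be imposed on A instead and leaves the sum,
   where commutation with [quat_j] applies. *)
transitivity ((deg A == (2 * (n - #|ones f|))%N)%:R * c * \sum_D K A D * spin_kernel (quat_j R) D set0).
  rewrite mulr_sumr; apply: eq_bigr => D _; rewrite Ec.
  have [->|/Kdeg ->] := eqVneq (K A D) 0; first by rewrite !mul0r mulr0.
  ring.
rewrite -EA Ec; move: (spin_kernel _ _ _) (K _ _) ((_ == _)%:R) => s k d; rewrite [RHS]/GRing.scale /=. ring.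
Qed.

Lemma Sp_psi_scalar B : in_Sp B -> exists2 c : C, c != 0 & lift_act phi (1, B) (psi R n) = c *: psi R n.
Proof.
move=> SpB; have [a _ EK] := lift_act_Sp phi_lift SpB.
have [_ E] := Sp_kernel_psi SpB EK; eexists; last exact: E.
apply: contraNneq (psi_neq0 R n) => c0.
apply/eqP; apply: (lift_act_inj phi_lift (in_H_Sp SpB)).
by rewrite E c0 scale0r.
Qed.

Lemma quat_psi_scalar x : quat_unit x ->
  exists2 c : C, c != 0 & lift_act phi (x, 1%:M) (psi R n) = c *: psi R n.
Proof.
move=> x1; have [c c0 Ec] := lift_act_quat phi_lift x1.
by exists c; rewrite // Ec spin_act_psi.
Qed.

(* Characters are trivial on commutators. *)
Lemma commutator_fixes_psi h h' h'' (c c' : C) : in_H h -> in_H h' -> in_H h'' ->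
  H_mul h'' (H_mul h' h) = H_mul h h' -> c != 0 -> c' != 0 ->
  lift_act phi h (psi R n) = c *: psi R n -> lift_act phi h' (psi R n) = c' *: psi R n ->
  in_H (H_mul h' h) -> lift_act phi h'' (psi R n) = psi R n.
Proof.
move=> Hh Hh' Hh'' E c0 c'0 Ec Ec' Hm.
have e1 := lift_actM n_odd phi_lift (psi R n) Hh'' Hm.
have e2 := lift_actM n_odd phi_lift (psi R n) Hh' Hh.
have e3 := lift_actM n_odd phi_lift (psi R n) Hh Hh'.
rewrite Ec lift_actZ Ec' in e2; rewrite Ec' lift_actZ Ec in e3.
have e4 : lift_act phi h'' (c *: (c' *: psi R n)) = c' *: (c *: psi R n).
  rewrite -e2 -e3 -E; exact: esym e1.
move: e4; rewrite !scalerA lift_actZ mulrC => e4.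
by apply: (scalerI (mulf_neq0 c'0 c0)).
Qed.

Lemma Sp_fixes_psi B : in_Sp B -> lift_act phi (1, B) (psi R n) = psi R n.
Proof.
have fixM (A D : 'M[quat R]_n) : in_Sp A -> in_Sp D -> lift_act phi (1, A) (psi R n) = psi R n ->
    lift_act phi (1, D) (psi R n) = psi R n -> lift_act phi (1, A *m D) (psi R n) = psi R n.
  move=> SpA SpD EA ED.
  have := lift_actM n_odd phi_lift (psi R n) (in_H_Sp SpA) (in_H_Sp SpD).
  by rewrite ED EA /H_mul /= mulr1.
move: B; apply: Sp_ind => // [|v q v0 q1].
  (* At the identity the scalar is nonzero and equal to its own square. *)
  have [c c0 Ec] := Sp_psi_scalar (in_Sp1 R n).
  have := lift_actM n_odd phi_lift (psi R n) (in_H_Sp (in_Sp1 R n)) (in_H_Sp (in_Sp1 R n)).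
  rewrite /H_mul /= mulr1 mulmx1 Ec lift_actZ Ec.
  by move/(scalerI c0) => <-.
have [a [b [a1 b1 qba]]] := quat_commutator q1.
have Spa := quasi_refl_Sp v0 a1; have Spb := quasi_refl_Sp v0 b1; have Spq := quasi_refl_Sp v0 q1.
have [ca ca0 Ea] := Sp_psi_scalar Spa; have [cb cb0 Eb] := Sp_psi_scalar Spb.
have E : quasi_refl v q *m (quasi_refl v b *m quasi_refl v a) = quasi_refl v a *m quasi_refl v b.
  apply: etrans (congr1 (mulmx _) (quasi_reflM b a v0)) _.
  apply: etrans (quasi_reflM q (b * a) v0) (etrans _ (esym (quasi_reflM a b v0))).
  by rewrite qba.
have EH : H_mul (1, quasi_refl v q) (H_mul (1, quasi_refl v b) (1, quasi_refl v a)) =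
    H_mul (1, quasi_refl v a) (1, quasi_refl v b).
  have e1 : 1 * (1 * 1) = 1 * 1 :> quat R by rewrite !mulr1.
  exact: (congr2 pair e1 E).
apply: (commutator_fixes_psi (in_H_Sp Spa) (in_H_Sp Spb) (in_H_Sp Spq) EH ca0 cb0 Ea Eb).
by have := in_H_Sp (in_SpM Spb Spa); rewrite /H_mul /= mulr1.
Qed.

Lemma quat_fixes_psi x : quat_unit x -> lift_act phi (x, 1%:M) (psi R n) = psi R n.
Proof.
move=> x1; have [a [b [a1 b1 qba]]] := quat_commutator x1.
have [ca ca0 Ea] := quat_psi_scalar a1; have [cb cb0 Eb] := quat_psi_scalar b1.
apply: (commutator_fixes_psi (in_H_quat n a1) (in_H_quat n b1) (in_H_quat n x1) _ ca0 cb0 Ea Eb).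
  by rewrite /H_mul /= qba !mulmx1.
have := in_H_quat n (quat_unitM b1 a1); rewrite /H_mul /= mulmx1; exact.
Qed.

(** Both operators fix psi, so the scalar between them is 1. *)
Lemma lift_act_quatE x v : quat_unit x -> lift_act phi (x, 1%:M) v = spin_act x v.
Proof.
move=> x1; have [c c0 Ec] := lift_act_quat phi_lift x1.
have := quat_fixes_psi x1; rewrite Ec spin_act_psi // Ec => /eqP.
rewrite -subr_eq0 -{2}[psi R n]scale1r -scalerBl scaler_eq0 (negPf (psi_neq0 R n)) orbF subr_eq0.
by move=> /eqP->; rewrite scale1r.
Qed.

Lemma psi_invariant c : invariant_spinor phi (c *: psi R n).
Proof.
move=> [x B] [/= /quat_unitP x1 SpB].
have -> : (x, B) = H_mul (x, 1%:M) (1, B) by rewrite /H_mul /= mulr1 mul1mx.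
have := lift_actM n_odd phi_lift (c *: psi R n) (in_H_quat n x1) (in_H_Sp SpB).
move=> e; apply: etrans e _.
by rewrite [X in lift_act _ _ X]lift_actZ Sp_fixes_psi // lift_actZ quat_fixes_psi.
Qed.
End LiftFixesPsi.

(** * Spinors invariant under Sp(n) *)

Section Phases.
Variables (R : realType) (n : nat).
Local Notation C := R[i].
Implicit Types (p : 'I_n) (A D : {set 'I_(2 * n)}) (k : 'I_(4 * n)) (s : bool * bool).

(** [t] tells whether the diagonal entry on this line is i or 1. The entry i acts trivially on the
    even part and by -i and i on the two odd basis vectors. *)
Definition local_phase (t : bool) s : C :=
  if t then (if s.1 == s.2 then 1 else if s.1 then - 'i%C else 'i%C) else 1.

Local Notation turn t c d := (qdot (quat_basis R d) (1 * quat_basis R c * qconj (if t then @Qi R else 1))).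

(* Right multiplication by -i permutes the basis j, k, i, -1 up to sign. *)
Let turn_idx (t : bool) (c : nat) : nat := if t then nth 0%N [:: 1; 0; 3; 2]%N c else c.
Let turn_sign (t : bool) (c : nat) : R := if t && ((c == 1) || (c == 2))%N then -1 else 1.

Let turnE (t : bool) (c d : nat) : (c < 4)%N -> (d < 4)%N ->
  turn t c d = if d == turn_idx t c then turn_sign t c else 0.
Proof.
by move: c d => [|[|[|[|//]]]] [|[|[|[|//]]]] // _ _; case: t; rewrite /turn_sign /qdot /=; ring.
Qed.

Lemma local_phase_intertwine (t : bool) s (c : nat) : (c < 4)%N ->
  local_phase t s * local_coef R c s =
  \sum_(d < 4) (turn t c d)%:C * local_coef R d s * local_phase t (flip d s).
Proof.
move=> ltc; have lt4 : (turn_idx t c < 4)%N by case: t; move: c ltc => [|[|[|[|//]]]].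
have i2 := sqr_i R; rewrite expr2 in i2.
rewrite (bigD1 (Ordinal lt4) isT) [X in _ = _ + X]big1 => [|d nd] /=; last first.
  by rewrite turnE // -(val_eqE d) /= in nd *; rewrite (negPf nd) rmorph0 !mul0r.
rewrite addr0 turnE // eqxx /turn_sign.
move: c ltc {lt4} => [|[|[|[|//]]]] _; case: t; case: s => [[] []];
  rewrite /local_phase /local_coef /flip /= ?rmorphN ?rmorph1 ?expr0 ?expr1; by ring: i2.
Qed.

Lemma turn_half (t : bool) (c d : nat) : (c < 4)%N -> (d < 4)%N ->
  ((c < 2) != (d < 2))%N -> turn t c d = 0.
Proof.
move=> ltc ltd ne; rewrite turnE //; case: eqP => // e; move: ne; rewrite e.
by move: c {e ltd} ltc => [|[|[|[|//]]]]; case: t.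
Qed.

(** [y1] and [y2] stand for the values of a form after toggling the first or the second index of the
    pair. Right multiplication by -i preserves the halves {j, k} and {i, -1}, so the terms that
    survive toggle the same index. *)
Lemma local_phase_intertwine2 (t : bool) s (c : nat) (y1 y2 : C) : (c < 4)%N ->
  local_phase t s * local_coef R c s * (if (c < 2)%N then y1 else y2) =
  \sum_(d < 4) (turn t c d)%:C * local_coef R d s * local_phase t (flip d s)
    * (if (d < 2)%N then y1 else y2).
Proof.
move=> ltc; rewrite local_phase_intertwine // mulr_suml; apply: eq_bigr => d _.
have [->//|ne] := eqVneq (d < 2)%N (c < 2)%N.
by rewrite turn_half 1?eq_sym // rmorph0 !mul0r.
Qed.

Definition phase p A : C := local_phase true (bits A p).

Definition sp_diag p : 'M[quat R]_n := \matrix_(i, j) ((if i == p then @Qi R else 1) *+ (i == j)).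

Lemma sp_diag_Sp p : in_Sp (sp_diag p).
Proof.
apply/matrixP => i j; rewrite [LHS]mxE [RHS]mxE (bigD1 i isT) [X in _ + X = _]big1 => [|r nr].
  rewrite addr0 /qadj !mxE eqxx mulr1n; have [_|_] := eqVneq i j; last by rewrite mulr0.
  by rewrite !mulr1n; case: ifP => _; [apply: quat_eqP => /=; ring|rewrite qconj1 mulr1].
by rewrite /qadj !mxE (negPf nr) mulr0n qconj0 mul0r.
Qed.

Lemma isotropy_Sp (B : 'M[quat R]_n) i j : isotropy (1, B) i j =
  qdot (quat_basis R (i %% 4)) (1 * quat_basis R (j %% 4) * qconj (B (quarter_ord i) (quarter_ord j))).
Proof. exact: isotropyE. Qed.

Lemma phase_intertwine p k A (eta : {set 'I_(2 * n)} -> C) :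
  phase p A * (cliff_coef R k A * eta (symdiff [set half_ord k] A)) =
  \sum_i (isotropy (1, sp_diag p) i k : R)%:C *
    (cliff_coef R i A * (phase p (symdiff [set half_ord i] A) * eta (symdiff [set half_ord i] A))).
Proof.
set q := quarter_ord k.
rewrite (bigID (fun i => quarter_ord i == q)) /= [X in _ + X]big1 ?addr0 => [|i ni]; last first.
  by rewrite isotropy_Sp mxE (negPf ni) mulr0n qconj0 mulr0 /qdot /= !mulr0 !addr0 rmorph0 mul0r.
rewrite sum_block cliff_coefE.
pose y1 := eta (symdiff [set even_idx q] A); pose y2 := eta (symdiff [set odd_idx q] A).
have Ey (j : 'I_(4 * n)) : quarter_ord j = q ->
    eta (symdiff [set half_ord j] A) = if (j %% 4 < 2)%N then y1 else y2.
  by move=> jq; rewrite half_ordE jq; case: ifP.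
have Ep (j : 'I_(4 * n)) : quarter_ord j = q ->
    phase p (symdiff [set half_ord j] A) =
    if q == p then local_phase true (flip (j %% 4) (bits A q)) else phase p A.
  by move=> jq; rewrite /phase bits_flip jq eq_sym; case: eqP => [->|].
rewrite (Ey k) // -/q.
have [e|ne] := eqVneq q p.
  rewrite /phase -e.
  transitivity (pair_sign R q A * (local_phase true (bits A q) * local_coef R (k %% 4) (bits A q)
      * (if (k %% 4 < 2)%N then y1 else y2))); first by ring.
  rewrite local_phase_intertwine2 ?ltn_mod // mulr_sumr; apply: eq_bigr => c _.
  have [ec em] := block_ordK q c.
  rewrite isotropy_Sp mxE em ec cliff_coefE ec em (Ey _ ec) em bits_flip ec eqxx em.
  rewrite mulr1n; ring.
transitivity (phase p A * pair_sign R q A * (local_phase false (bits A q) * local_coef R (k %% 4) (bits A q)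
    * (if (k %% 4 < 2)%N then y1 else y2))).
  by rewrite /local_phase; ring.
rewrite local_phase_intertwine2 ?ltn_mod // mulr_sumr; apply: eq_bigr => c _.
have [ec em] := block_ordK q c.
rewrite isotropy_Sp mxE em ec cliff_coefE ec em (Ey _ ec) em (Ep _ ec) (negPf ne).
rewrite eqxx mulr1n /local_phase; ring.
Qed.
End Phases.

(** * Permutation matrices in Sp(n) *)

Section PairCreation.
Variables (R : realType) (n : nat).
Local Notation C := R[i].
Implicit Types (p : 'I_n) (A D : {set 'I_(2 * n)}) (T : {set 'I_n}) (k : 'I_(4 * n)).

Lemma isotropy_perm (s : 'S_n) k i :
  isotropy (1, perm_mx s : 'M[quat R]_n) i k =
  ((i %% 4 == k %% 4)%N && (s (quarter_ord i) == quarter_ord k))%:R.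
Proof.
rewrite isotropy_Sp !mxE; case: (s _ == _) => /=; last first.
  by rewrite andbF qconj0 mulr0 /qdot /= !mulr0 !addr0.
rewrite qconj1 mulr1 mul1r andbT.
by move: (i %% 4)%N (k %% 4)%N (ltn_pmod i (isT : 0 < 4)%N) (ltn_pmod k (isT : 0 < 4)%N)
  => [|[|[|[|//]]]] [|[|[|[|//]]]] // _ _; rewrite /qdot /=; ring.
Qed.

Lemma perm_mx_Sp (s : 'S_n) : in_Sp (perm_mx s : 'M[quat R]_n).
Proof.
apply/matrixP => i j; rewrite [LHS]mxE [RHS]mxE.
rewrite (bigD1 ((s^-1)%g i) isT) [X in _ + X = _]big1 => [|r nr].
  by rewrite addr0 /qadj !mxE permKV eqxx qconj1 mul1r.
rewrite /qadj !mxE (_ : (s r == i) = false) ?qconj0 ?mul0r //.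
by apply: contraNF nr => /eqP <-; rewrite permK.
Qed.

(** This solves y_q . eta = i sqrt 2 (y_q wedge eta) for the wedge product, with y_q = (e_(2q) + i
    e_(2q+1)) / sqrt 2. Operators that permute the e_k under conjugation can then be evaluated on
    exterior products. *)
Lemma cl_gen_cliff p (b : bool) (eta : Sigma R n) :
  cl_gen 0 (if b then odd_idx p else even_idx p) * eta =
  (- 'i%C / 2) *: cliff (delta_mx 0 (block_ord p (inord (2 * b)))) eta
  + 2^-1 *: cliff (delta_mx 0 (block_ord p (inord (2 * b).+1))) eta.
Proof.
have [e1 m1] := block_ordK p (inord (2 * b)); have [e2 m2] := block_ordK p (inord (2 * b).+1).
rewrite inordK in m1; last by case: (b).
rewrite inordK in m2; last by case: (b).
have h1 : half_ord (block_ord p (inord (2 * b))) = if b then odd_idx p else even_idx p.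
  by rewrite half_ordE e1 m1; case: (b).
have h2 : half_ord (block_ord p (inord (2 * b).+1)) = if b then odd_idx p else even_idx p.
  by rewrite half_ordE e2 m2; case: (b).
have odd4 k : odd k = odd (k %% 4) by rewrite {1}(divn_eq k 4) oddD oddM andbF.
rewrite !cliff_delta h1 h2; set q := if b then _ else _.
apply/ffunP => A; rewrite cl_genME [RHS]ffunE [X in _ = X + _]ffunE [X in _ = _ + X]ffunE !monomial_opE.
rewrite /cliff_coef h1 h2 -/q !odd4 m1 m2.
have -> : odd (2 * b)%N = false by rewrite mul2n odd_double.
have -> : odd (2 * b).+1 = true by rewrite /= mul2n odd_double.
rewrite /GRing.scale /=.
have i2 := sqr_i R; rewrite expr2 in i2.
have h : 2^-1 * 2 = 1 :> C by rewrite mulVf // pnatr_eq0.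
by case: (q \in A); rewrite /= ?expr0 ?expr1; ring: i2 h.
Qed.

Lemma cl_mono_pair p T : p \notin T ->
  (cl_mono 0 (pair_set (p |: T)) : Sigma R n) =
  cl_gen 0 (even_idx p) * (cl_gen 0 (odd_idx p) * cl_mono 0 (pair_set T)).
Proof.
move=> npT; apply/ffunP => A; rewrite pair_genME !ffunE.
have [/andP[eA oA]|nA] := boolP ((even_idx p \in A) && (odd_idx p \in A)); last first.
  rewrite mul0r; case: eqP => // E; move: nA; rewrite E even_pair_set odd_pair_set.
  by rewrite setU11.
rewrite mul1r; congr (_%:R); congr nat_of_bool; apply/eqP/eqP => [->|E]; apply: bitsP => r.
  rewrite /bits even_drop_pair odd_drop_pair !even_pair_set !odd_pair_set in_setU1.
  by have [->|_] := eqVneq r p; rewrite ?(negPf npT).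
have := congr1 (fun D => bits D r) E; rewrite /bits even_drop_pair odd_drop_pair.
rewrite !even_pair_set !odd_pair_set in_setU1 => -[].
have [->|_ /= -> ->//] := eqVneq r p; by rewrite eA oA.
Qed.
End PairCreation.

(** * Invariant spinors are multiples of psi *)

Section InvariantSpinors.
Variables (R : realType) (n : nat) (phi : Hpair R n -> Cl R (4 * n) * Cl R 3).
Hypotheses (n_odd : odd n) (phi_lift : is_lift phi).
Local Notation C := R[i].
Implicit Types (p : 'I_n) (A D : {set 'I_(2 * n)}) (T : {set 'I_n}) (v : twspinor R n n).
Implicit Types (B : 'M[quat R]_n) (k : 'I_(4 * n)).

(** By [Sp_kernel_psi] the vacuum is scaled by the same factor as psi, and psi is fixed. This
    supplies the normalization that Schur's lemma leaves open. *)
Lemma lift_act_Sp_vacuum B : in_Sp B -> exists a : C,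
  (forall v A f, lift_act phi (1, B) v (A, f) = \sum_D (a * Sigma_ker (phi (1, B)).1 A D) * v (D, f))
  /\ forall A, a * Sigma_ker (phi (1, B)).1 A set0 = (A == set0)%:R.
Proof.
move=> SpB; have [a _ EK] := lift_act_Sp phi_lift SpB; exists a; split=> //.
have [E0 Epsi] := Sp_kernel_psi n_odd phi_lift SpB EK.
move=> A; rewrite E0; suff -> : a * Sigma_ker (phi (1, B)).1 set0 set0 = 1 by rewrite mul1r.
move/eqP: Epsi; rewrite (Sp_fixes_psi n_odd phi_lift SpB) -subr_eq0 -{1}[psi R n]scale1r -scalerBl.
by rewrite scaler_eq0 (negPf (psi_neq0 R n)) orbF subr_eq0 => /eqP.
Qed.

Lemma lift_act_diag p v A f :
  lift_act phi (1, sp_diag R p) v (A, f) = phase R p A * v (A, f).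
Proof.
have SpB := sp_diag_Sp R p; have [a [EK E0]] := lift_act_Sp_vacuum SpB.
have [lu _] := lift_lifts phi_lift (in_H_Sp SpB).
case: phi_lift => _ _ /(_ _ (in_H_Sp SpB)) cov _.
have [k eta|c Ec] := Sigma_act_unique lu (monomial_op_linear (phase R p) id).
  apply/ffunP => D; rewrite cov !cliff_delta monomial_opE monomial_opE phase_intertwine sum_ffunE.
  by apply: eq_bigr => i _; rewrite [RHS]ffunE cliff_delta !monomial_opE.
have ker D S : phase R p D * (D == S)%:R = c * Sigma_ker (phi (1, sp_diag R p)).1 D S.
  have := congr1 (fun eta : Sigma R n => eta D) (Ec (cl_mono 0 S)).
  by rewrite monomial_opE ffunE [RHS]ffunE.
have ph0 : phase R p set0 = 1 by rewrite /phase /bits !inE.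
have e0 := ker set0 set0; rewrite ph0 eqxx mulr1 in e0.
have e1 := E0 set0; rewrite eqxx in e1.
(* Both kernels equal 1 at the vacuum, where the phase is trivial. *)
have ac : a = c.
  apply: (mulIf (x := Sigma_ker (phi (1, sp_diag R p)).1 set0 set0)); last by rewrite e1 -e0.
  by apply/eqP => z; move/eqP: e1; rewrite z mulr0 eq_sym oner_eq0.
rewrite EK (bigD1 A isT) [X in _ + X = _]big1 => [|D nD]; rewrite ac -ker.
  by rewrite eqxx mulr1 addr0.
by rewrite eq_sym (negPf nD) mulr0 mul0r.
Qed.

(** Conjugation by the lift permutes the wedge operators, so its values on the products of the
    omega_p follow from its value on the vacuum by adjoining one pair at a time; pairs have even
    degree, so no sign arises. *)
Lemma perm_kernel (s : 'S_n) (a : C) : (forall p, s (s p) = p) ->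
  (forall A, a * Sigma_ker (phi (1, perm_mx s)).1 A set0 = (A == set0)%:R) ->
  forall T A, a * Sigma_ker (phi (1, perm_mx s)).1 A (pair_set T) = (A == pair_set (s @: T))%:R.
Proof.
move=> ss E0; have SpB := perm_mx_Sp R s.
have [lu _] := lift_lifts phi_lift (in_H_Sp SpB).
case: phi_lift => _ _ /(_ _ (in_H_Sp SpB)) cov _.
set u := (phi _).1 in lu cov E0 *.
have U_cliff (eta : Sigma R n) p (c : 'I_4) :
    Sigma_act u (cliff (delta_mx 0 (block_ord p c)) eta) =
    cliff (delta_mx 0 (block_ord (s p) c)) (Sigma_act u eta).
  (* The isotropy matrix moves line p to s^-1 p, which is s p because s is an involution. *)
  rewrite Sigma_act_intertwine // cov (bigD1 (block_ord (s p) c) isT).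
  have [ep mp] := block_ordK p c; have [es ms] := block_ordK (s p) c.
  rewrite isotropy_perm ep mp es ms ss !eqxx /= scale1r big1 ?addr0 // => i ni.
  rewrite isotropy_perm ep mp (_ : _ && _ = false) ?scale0r //.
  apply: contraNF ni => /andP[/eqP ei /eqP si].
  by apply/eqP/val_inj; rewrite /= -si ss -ei [LHS](divn_eq i 4) mulnC.
have linU := @Sigma_act_linear R n u.
have U_gen p (b : bool) (eta : Sigma R n) :
    Sigma_act u (cl_gen 0 (if b then odd_idx p else even_idx p) * eta) =
    cl_gen 0 (if b then odd_idx (s p) else even_idx (s p)) * Sigma_act u eta.
  rewrite !cl_gen_cliff linU (linear_cliffordZ linU).
  exact: (congr2 (fun x y : Sigma R n => (- 'i%C / 2) *: x + 2^-1 *: y) (U_cliff eta p _) (U_cliff eta p _)).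
have U_mono T : a *: Sigma_act u (cl_mono 0 (pair_set T)) = (cl_mono 0 (pair_set (s @: T)) : Sigma R n).
  elim/setU1_min_ind: T => [|p T ltpT IH].
    have -> : pair_set set0 = set0 :> {set 'I_(2 * n)} by apply/setP => q; rewrite !inE.
    rewrite imset0; have -> : pair_set set0 = set0 :> {set 'I_(2 * n)} by apply/setP => q; rewrite !inE.
    by apply/ffunP => A; rewrite [LHS]ffunE [RHS]ffunE -E0.
  have npT : p \notin T by apply/negP => /ltpT; rewrite ltnn.
  have nspT : s p \notin s @: T by rewrite (mem_imset _ _ (@perm_inj _ s)).
  rewrite imsetU1 cl_mono_pair // cl_mono_pair // -IH -!scalerAr; congr (a *: _).
  apply: etrans (U_gen p false _) _; congr (_ * _); exact: (U_gen p true).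
move=> T A; have := congr1 (fun eta : Sigma R n => eta A) (U_mono T).
by rewrite [LHS]ffunE [RHS]ffunE.
Qed.

Lemma invariant_paired v A f : invariant_spinor phi v -> v (A, f) != 0 -> paired A.
Proof.
move=> inv_v nz; apply/forallP => p.
have := lift_act_diag p v A f; rewrite /lift_act (inv_v _ (in_H_Sp (sp_diag_Sp R p))).
rewrite -{1}[v (A, f)]mul1r => /(mulIf nz); rewrite /phase /local_phase /bits /=.
case: (even_idx p \in A); case: (odd_idx p \in A) => //= /eqP;
  by rewrite eq_complex /= ?oppr0 oner_eq0.
Qed.

Lemma invariant_swap v T a b f : invariant_spinor phi v -> a \in T -> b \notin T ->
  v (pair_set (b |: (T :\ a)), f) = v (pair_set T, f).
Proof.
move=> inv_v aT nbT; pose s : 'S_n := tperm a b.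
have ss p : s (s p) = p by apply: tpermK.
have [c [EK E0]] := lift_act_Sp_vacuum (perm_mx_Sp R s).
have Eker := perm_kernel ss E0.
have -> : b |: (T :\ a) = s @: T.
  apply/setP => r; rewrite -[in RHS](ss r) (mem_imset _ _ (@perm_inj _ s)) !inE.
  rewrite /s; case: tpermP => [->|->|/eqP na /eqP nb]; rewrite ?eqxx ?aT ?orbT //=.
  - by rewrite (negPf nbT) orbF; apply/eqP => e; rewrite -e aT in nbT.
  - by rewrite (negPf nb) na.
have := EK v (pair_set (s @: T)) f; rewrite /lift_act (inv_v _ (in_H_Sp (perm_mx_Sp R s))) => ->.
rewrite (bigD1 (pair_set T) isT) [X in _ + X = _]big1 => [|D nD].
  by rewrite Eker eqxx mul1r addr0.
have [->|/(invariant_paired inv_v) pD] := eqVneq (v (D, f)) 0; first by rewrite mulr0.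
rewrite -(pair_set_supp pD) Eker; case: eqP => [E|]; last by rewrite mul0r.
move: nD; rewrite -(pair_set_supp pD).
have /(congr1 (@supp n)) := E; rewrite !supp_pair_set => /(imset_inj (@perm_inj _ s)) <-.
by rewrite eqxx.
Qed.

Lemma invariant_psi v : invariant_spinor phi v -> exists c, v = c *: psi R n.
Proof.
move=> inv_v; apply: spin_fixed_psi => [A f|T a b f||].
- exact: invariant_paired.
- exact: invariant_swap.
- rewrite -(lift_act_quatE n_odd phi_lift _ (quat_i_unit R)).
  exact: inv_v (in_H_quat n (quat_i_unit R)).
- rewrite -(lift_act_quatE n_odd phi_lift _ (quat_j_unit R)).
  exact: inv_v (in_H_quat n (quat_j_unit R)).
Qed.
End InvariantSpinors.

Theorem theorem3p20 (R : realType) (n : nat) (hn : (1 < n)%N) (hodd : odd n)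
    (phi : Hpair R n -> Cl R (4 * n) * Cl R 3) (hphi : is_lift phi)
    (v : twspinor R n n) :
  invariant_spinor phi v <-> exists c : R[i], v = c *: psi R n.
Proof.
split=> [|[c ->]]; first exact: invariant_psi.
exact: psi_invariant.
Qed.
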